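(* Suppose that $n_j=n$, $\varepsilon_j=\varepsilon$, $\delta_j=\delta$ for $j=1,\dots,m$, and $\delta\ll(mn)^{-1}$. Let $\nu=\alpha-1/p$. Then, for $x_0\in[0,1]$, the pointwise minimax risk at $x_0$ satisfies $$\inf_{\hat f\in\mathcal M(\boldsymbol\varepsilon,\boldsymbol\delta)}\ \sup_{f\in\mathcal B^{\alpha,R}_{p,q}}\mathbb E_f|\hat f(x_0)-f(x_0)|^2\asymp\min\left\{M_{m,n}\left((mn^2\varepsilon^2)^{-\frac{2\nu}{2\nu+2}}+(mn)^{-\frac{2\nu}{2\nu+1}}\right),\,1\right\},$$ where $M_{m,n}\ge1$ is a sequence at most of the order $\log(mn)$.
   Context: Data. There are $m$ servers; server $j$ holds $n_j$ observations $Z^{(j)}=(Z^{(j)}_i)_{i=1}^{n_j}$, $Z_i^{(j)}=(Y_i^{(j)},X_i^{(j)})\in\mathcal Z=\mathbb R\times[0,1]$. All $N=\sum_{j=1}^m n_j$ observations are i.i.d. from $P_f$, under which $X_i^{(j)}\sim U[0,1]$, $Y_i^{(j)}=f(X_i^{(j)})+\xi_i^{(j)}$, with $\xi_i^{(j)}\sim N(0,1)$ independent of $X_i^{(j)}$. Privacy. Server $j$ outputs a randomized transcript $T^{(j)}$ in a standard Borel space $(\mathcal T,\mathscr T)$, drawn from a conditional law $\mathbb P(\cdot\mid Z^{(j)})$ depending only on $Z^{(j)}$ (no interaction between servers). It is $(\varepsilon_j,\delta_j)$-differentially private if $\mathbb P(T^{(j)}\in A\mid Z^{(j)}=z)\le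 e^{\varepsilon_j}\mathbb P(T^{(j)}\in A\mid Z^{(j)}=z')+\delta_j$ for all $A\in\mathscr T$ and all $z,z'\in\mathcal Z^{n_j}$ differing in at most one of their $n_j$ entries. Here $0<\varepsilon_j\le C_\varepsilon$ for a fixed constant $C_\varepsilon>0$, and $(\boldsymbol\varepsilon,\boldsymbol\delta)=\{(\varepsilon_j,\delta_j)\}_{j=1}^m$. $\mathcal M(\boldsymbol\varepsilon,\boldsymbol\delta)$ is the class of distributed estimation protocols: transcript mechanisms, with $T^{(j)}$ being $(\varepsilon_j,\delta_j)$-differentially private for each $j$, together with an estimator $\hat f$ which is a (function-valued) function of $T=(T^{(1)},\dots,T^{(m)})$. $\mathbb E_f$ is expectation under the joint law of data and transcripts when data are drawn from $P_f$. Function class. $p\ge2$, $q\ge1$, $\nu=\alpha-1/p>1/2$, and $R>0$ is a constant. Let $\{\psi_{lk}\}$, $l\ge l_0$, be a Cohen–Daubechies–Vial compactly supported $A$-regular orthonormal wavelet basis of $L_2[0,1]$ with $A>\alpha$ (level $l_0$ denotes the father wavelets; levels $l>l_0$ contain $2^l$ wavelets, $k=0,\dots,2^l-1$), and $f_{lk}=\langle f,\psi_{lk}\rangle$. Then $\|f\|_{\mathcal B^\alpha_{p,q}}=\big(\sum_{l\ge l_0}(2^{l(\alpha+1/2-1/p)}\|(f_{lk})_k\|_p)^q\big)^{1/q}$ (supremum over $l$ if $q=\infty$), and $\mathcal B^{\alpha,R}_{p,q}=\{f\in L_2[0,1]:\|f\|_{\mathcal B^\alpha_{p,q}}\le R\}$.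 Asymptotics. Statements are asymptotic in $m,n,\varepsilon,\delta$, with $N=mn\to\infty$. $a\lesssim b$ means $a\le Cb$ for a constant $C>0$ not depending on $m,n,\varepsilon,\delta$ (it may depend on the fixed quantities, such as $\alpha,p,q,R,C_\varepsilon$ and the wavelet basis); $a\asymp b$ means $a\lesssim b$ and $b\lesssim a$; $a\ll b$ means $a/b=o(1)$. *)

(* Defs.v *)
From HB Require Import structures.
From mathcomp Require Import all_boot all_order all_algebra.
From mathcomp Require Import all_classical all_reals all_analysis.

Set Implicit Arguments.
Unset Strict Implicit.
Unset Printing Implicit Defensive.

Import Order.TTheory GRing.Theory Num.Theory.
Import numFieldNormedType.Exports.

Local Open Scope classical_set_scope.
Local Open Scope ring_scope.

Section wavelets.
Context {R : realType}.
Implicit Types (phi psi f : R -> R) (edgeL edgeR : nat -> R -> R).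
Let mu := @lebesgue_measure R.

Definition of_class_C (A : nat) (f : R -> R) : Prop :=
  (forall i x, (i < A)%N -> derivable (derive1n i f) x 1) /\
  continuous (derive1n A f).

(** Compactly supported orthonormal father/mother pair on the real line with
    [N] vanishing moments, in the translate where both functions live on
    [1 - N, N], so that the two filters are indexed by 1 - N, ..., N. *)
Record daubechies_pair (N : nat) (phi psi : R -> R) : Prop := {
  dp_supp_phi : forall x, ~~ (1 - N%:R <= x <= N%:R) -> phi x = 0 ;
  dp_supp_psi : forall x, ~~ (1 - N%:R <= x <= N%:R) -> psi x = 0 ;
  dp_mean : \int[mu]_(x in setT) phi x = 1 ;
  dp_ortho_phi : forall k : int,
    \int[mu]_(x in setT) (phi x * phi (x - k%:~R)) = (k == 0)%:R ;
  dp_ortho_psi : forall k : int,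
    \int[mu]_(x in setT) (psi x * psi (x - k%:~R)) = (k == 0)%:R ;
  dp_ortho_phi_psi : forall k : int,
    \int[mu]_(x in setT) (phi x * psi (x - k%:~R)) = 0 ;
  dp_filter_phi : exists h : 'I_(N.*2) -> R, forall x,
    phi x = \sum_i h i * phi (2 * x - (i%:R + 1 - N%:R)) ;
  dp_filter_psi : exists g : 'I_(N.*2) -> R, forall x,
    psi x = \sum_i g i * phi (2 * x - (i%:R + 1 - N%:R)) ;
  dp_moments : forall d, (d < N)%N ->
    \int[mu]_(x in setT) (x ^+ d * psi x) = 0 }.

(** The [2 ^ j] functions of scale [j] on [0,1]: [N] left edge functions, the
    dilated translates of [f] supported in [0,1], and [N] right edge functions.
    The left (right) edge profiles are functions on [0,+oo[ (on ]-oo,0]); their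
    values elsewhere play no role when [x] lies in [0,1]. *)
Definition interval_family (N : nat) f edgeL edgeR (j k : nat) (x : R) : R :=
  2 `^ (j%:R / 2) *
  (if (k < N)%N then edgeL k (2 ^+ j * x)
   else if (k < 2 ^ j - N)%N then f (2 ^+ j * x - k%:R)
   else edgeR (2 ^ j - k.+1)%N (2 ^+ j * (x - 1))).

Definition unit_interval : set (measurableTypeR R) := [set` `[(0 : R), 1]].

Definition inner01 (f g : R -> R) : R := \int[mu]_(x in unit_interval) (f x * g x).

(** [l0 + 1] is the scale of the father wavelets; the multiresolution spaces of
    scale [j > l0] are the spans of the [2 ^ j] scaling functions and of the
    [2 ^ j] wavelets of that scale. Being [A]-regular means being of class C^A
    with at least [A] vanishing moments; the edge functions inherit both
    properties from [phi], through the edge, nesting and polynomial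
    reproduction conditions. *)
Record cdv_system (A l0 N : nat) phi psi
    (phiL phiR psiL psiR : nat -> R -> R) : Prop := {
  cdv_N_gt0 : (0 < N)%N ;
  cdv_scale : (N.*2 <= 2 ^ l0.+1)%N ;
  cdv_pair : daubechies_pair N phi psi ;
  cdv_moments_regular : (A <= N)%N ;
  cdv_smooth_phi : of_class_C A phi ;
  cdv_smooth_psi : of_class_C A psi ;
  cdv_edge_left : forall k, (k < N)%N -> exists c : 'I_(N.*2.-1) -> R,
    forall x, 0 <= x ->
      phiL k x = \sum_i c i * phi (x - (i%:R + 1 - N%:R)) ;
  cdv_edge_right : forall k, (k < N)%N -> exists c : 'I_(N.*2.-1) -> R,
    forall x, x <= 0 ->
      phiR k x = \sum_i c i * phi (x - (i%:R - N%:R)) ;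
  cdv_supp_left : forall k x, (k < N)%N -> (N.*2.-1)%:R < x ->
    phiL k x = 0 /\ psiL k x = 0 ;
  cdv_supp_right : forall k x, (k < N)%N -> x < - (N.*2.-1)%:R ->
    phiR k x = 0 /\ psiR k x = 0 ;
  cdv_polynomials : forall j d, (l0 < j)%N -> (d < N)%N ->
    exists c : nat -> R, forall x, 0 <= x <= 1 ->
      x ^+ d = \sum_(k < 2 ^ j) c k * interval_family N phi phiL phiR j k x ;
  cdv_nested_V : forall j k, (l0 < j)%N -> (k < 2 ^ j)%N ->
    exists c : nat -> R, forall x, 0 <= x <= 1 ->
      interval_family N phi phiL phiR j k x =
      \sum_(i < 2 ^ j.+1) c i * interval_family N phi phiL phiR j.+1 i x ;
  cdv_nested_W : forall j k, (l0 < j)%N -> (k < 2 ^ j)%N ->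
    exists c : nat -> R, forall x, 0 <= x <= 1 ->
      interval_family N psi psiL psiR j k x =
      \sum_(i < 2 ^ j.+1) c i * interval_family N phi phiL phiR j.+1 i x ;
  cdv_ortho_V : forall j k k', (l0 < j)%N -> (k < 2 ^ j)%N -> (k' < 2 ^ j)%N ->
    inner01 (interval_family N phi phiL phiR j k)
            (interval_family N phi phiL phiR j k') = (k == k')%:R ;
  cdv_ortho_W : forall j j' k k', (l0 < j)%N -> (l0 < j')%N ->
    (k < 2 ^ j)%N -> (k' < 2 ^ j')%N ->
    inner01 (interval_family N psi psiL psiR j k)
            (interval_family N psi psiL psiR j' k') =
    ((j == j') && (k == k'))%:R ;
  cdv_ortho_VW : forall j j' k k', (l0 < j)%N -> (j <= j')%N ->
    (k < 2 ^ j)%N -> (k' < 2 ^ j')%N ->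
    inner01 (interval_family N phi phiL phiR j k)
            (interval_family N psi psiL psiR j' k') = 0 }.

(** Level [l0] holds the father wavelets, which have scale [l0 + 1]: there must
    be [2 ^ (l0 + 1)] of them for the wavelets of levels [l > l0] to complete
    them to a basis. *)
Definition level_size (l0 l : nat) : nat :=
  if l == l0 then (2 ^ l0.+1)%N else (2 ^ l)%N.

Definition wcoef (w : nat -> nat -> R -> R) (f : R -> R) (l k : nat) : R :=
  inner01 f (w l k).

Definition complete_L2_01 (l0 : nat) (w : nat -> nat -> R -> R) : Prop :=
  forall g : measurableTypeR R -> measurableTypeR R,
    measurable_fun unit_interval g ->
    mu.-integrable unit_interval (fun x => (g x ^+ 2)%:E) ->
    (forall l k, (l0 <= l)%N -> (k < level_size l0 l)%N -> wcoef w g l k = 0) ->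
    {ae mu, forall x, 0 <= x <= 1 -> g x = 0}.

Definition cdv_basis (A l0 : nat) (w : nat -> nat -> R -> R) : Prop :=
  (exists N phi psi phiL phiR psiL psiR,
     cdv_system A l0 N phi psi phiL phiR psiL psiR /\
     forall l k x, (l0 <= l)%N -> (k < level_size l0 l)%N -> 0 <= x <= 1 ->
       w l k x = if l == l0 then interval_family N phi phiL phiR l0.+1 k x
                 else interval_family N psi psiL psiR l k x) /\
  complete_L2_01 l0 w.

End wavelets.

Section besov.
Context {R : realType}.

(** [1 / p], with [1 / +oo = 0]. *)
Definition inv_exponent (p : \bar R) : R := fine (p^-1)%E.

Definition seq_norm (p : \bar R) (a : nat -> \bar R) : \bar R :=
  Lnorm (@counting nat R) p a.

Definition besov_norm (l0 : nat) (w : nat -> nat -> R -> R) (alpha : R)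
    (p q : \bar R) (f : R -> R) : \bar R :=
  seq_norm q (fun l =>
    if (l0 <= l)%N then
      ((2 `^ (l%:R * (alpha + 2^-1 - inv_exponent p)))%:E *
       seq_norm p (fun k =>
         if (k < level_size l0 l)%N then (wcoef w f l k)%:E else 0))%E
    else 0%E).

(** For [alpha - 1/p > 0] the elements of the Besov space are equivalence
    classes of functions with a unique representative continuous on [0,1]; that
    representative is the one evaluated pointwise. It is bounded, hence in
    L2[0,1]. Values outside [0,1] are irrelevant, functions being defined on
    the whole line only for typing reasons. *)
Definition besov_ball (l0 : nat) (w : nat -> nat -> R -> R) (alpha : R)
    (p q : \bar R) (rho : R) :
    set {mfun measurableTypeR R >-> measurableTypeR R} :=
  [set f | {within [set` `[(0 : R), 1]], continuous (f : R -> R)} /\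
           (besov_norm l0 w alpha p q f <= rho%:E)%E].

End besov.

Section product_law.
Context {R : realType} d (T : measurableType d).

Definition cons_pair n (u : T * n.-tuple T) : n.+1.-tuple T :=
  [the n.+1.-tuple T of u.1 :: u.2].

Lemma measurable_cons_pair n : measurable_fun setT (@cons_pair n).
Proof.
apply: (@measurable_cons _ _ _ _ fst n snd).
- exact: measurable_fst.
- exact: measurable_snd.
Qed.

HB.instance Definition _ n :=
  isMeasurableFun.Build _ _ _ _ (@cons_pair n) (@measurable_cons_pair n).

Fixpoint product_law m : ('I_m -> probability T R) ->
    probability (m.-tuple T) R :=
  match m return ('I_m -> probability T R) -> probability (m.-tuple T) R with
  | 0%N => fun _ => dirac [tuple]
  | m'.+1 => fun P =>
      distribution (P ord0 \x product_law (fun i => P (lift ord0 i)))%E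
        (@cons_pair m')
  end.

End product_law.

Section model.
Context {R : realType}.

(** An observation is a pair [(Y, X)]. *)
Definition obs : Type := (measurableTypeR R * measurableTypeR R)%type.

HB.instance Definition _ := Measurable.on obs.

Definition regression_map (f : {mfun measurableTypeR R >-> measurableTypeR R})
  (u : measurableTypeR R * measurableTypeR R) : obs := (f u.1 + u.2, u.1).

Lemma measurable_regression_map f : measurable_fun setT (regression_map f).
Proof.
apply/measurable_fun_pairP; split; last exact: measurable_fst.
rewrite (_ : _ \o _ = (f \o fst) \+ snd)//.
apply: measurable_realfun.measurable_funD; last exact: measurable_snd.
exact: (measurableT_comp (measurable_funPT f) measurable_fst).
Qed.

HB.instance Definition _ f :=
  isMeasurableFun.Build _ _ _ _ (regression_map f)
    (measurable_regression_map f).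

(** The law of [(f X + xi, X)] with [X ~ U[0,1]] and [xi ~ N(0,1)]
    independent. *)
Definition obs_law f : probability obs R :=
  distribution (uniform_prob (@ltr01 R) \x normal_prob (0 : R) (1 : R))%E
    (regression_map f).

Definition sample_law f n : probability (n.-tuple obs) R :=
  product_law (fun _ : 'I_n => obs_law f).

End model.
Arguments obs R : clear implicits.

Section mechanisms.
Context {R : realType}.

Definition standard_borel d (T : measurableType d) : Prop :=
  exists (U : completePseudoMetricType R) (e : T -> U),
    [/\ hausdorff_space U, @second_countable U, bijective e &
        forall A : set T,
          measurable A <-> exists2 B : set U, <<s open >> B & A = e @^-1` B].

Section law.
Context d1 d2 (S : measurableType d1) (T : measurableType d2).
Variables (P : probability S R) (K : R.-pker S ~> T).

Definition output_law (A : set T) : \bar R := (\int[P]_z K z A)%E.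

Let output_law0 : output_law set0 = 0%E.
Proof. by apply: integral0_eq => z _; rewrite measure0. Qed.

Let output_law_ge0 A : (0 <= output_law A)%E.
Proof. by apply: integral_ge0 => z _; exact: measure_ge0. Qed.

Let output_law_sigma_additive : semi_sigma_additive output_law.
Proof.
move=> U mU tU mUU; rewrite [X in _ --> X](_ : _ =
  \int[P]_z (\sum_(n <oo) K z (U n)))%E; last first.
  apply: eq_integral => V _.
  by apply/esym/cvg_lim => //; exact/measure_semi_sigma_additive.
apply/cvg_closeP; split.
  by apply: is_cvg_nneseries => n _ _; exact: integral_ge0.
rewrite closeE// integral_nneseries// => n.
exact: measurable_kernel.
Qed.

HB.instance Definition _ := isMeasure.Build _ _ R output_law
  output_law0 output_law_ge0 output_law_sigma_additive.

Let output_law_setT : output_law setT = 1%E.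
Proof.
rewrite /output_law (eq_integral (cst 1%E)).
  by rewrite integral_cst// mul1e; exact: probability_setT.
by move=> z _; exact: prob_kernel.
Qed.

HB.instance Definition _ :=
  Measure_isProbability.Build _ _ R output_law output_law_setT.

End law.

Definition in_sample_space n (z : n.-tuple (obs R)) : Prop :=
  forall i, 0 <= (tnth z i).2 <= 1.

Definition hamming n (z z' : n.-tuple (obs R)) : nat :=
  #|[set i | tnth z i != tnth z' i]|%SET.

(** Mechanisms are kernels on [(R x R)^n]; since the privacy constraint
    only involves samples with design points in [0,1], and so do the laws of
    the data, what a mechanism does elsewhere is irrelevant. *)
Definition differentially_private n d (T : measurableType d)
    (K : R.-pker (n.-tuple (obs R)) ~> T) (eps delta : R) : Prop :=
  forall (A : set T) (z z' : n.-tuple (obs R)),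
    measurable A -> in_sample_space z -> in_sample_space z' ->
    (hamming z z' <= 1)%N ->
    (K z A <= (expR eps)%:E * K z' A + delta%:E)%E.

(** A non-interactive protocol for [m] servers: each server applies its own
    kernel to its own sample only. *)
Record protocol (m : nat) (n : 'I_m -> nat) (eps delta : 'I_m -> R) := {
  tr_display : measure_display ;
  tr_space : measurableType tr_display ;
  tr_standard_borel : standard_borel tr_space ;
  mechanism : forall j : 'I_m, R.-pker ((n j).-tuple (obs R)) ~> tr_space ;
  mechanism_dp : forall j, differentially_private (mechanism j) (eps j) (delta j) ;
  estimator : m.-tuple tr_space -> R -> measurableTypeR R ;
  estimator_measurable : forall x,
    measurable_fun setT (fun t => estimator t x) }.

Arguments estimator {m n eps delta} _ _ _.
Arguments mechanism {m n eps delta} _ _.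

(** Law of [(T^(1), ..., T^(m))]: the data sets and the internal randomizations
    of different servers are independent. *)
Definition transcript_law m (n : 'I_m -> nat) (eps delta : 'I_m -> R)
    (prot : protocol n eps delta) f : probability (m.-tuple (tr_space prot)) R :=
  product_law (fun j => output_law (sample_law f (n j)) (mechanism prot j)).

Definition pointwise_risk m (n : 'I_m -> nat) (eps delta : 'I_m -> R)
    (prot : protocol n eps delta) (x0 : R)
    (f : {mfun measurableTypeR R >-> measurableTypeR R}) : \bar R :=
  (\int[transcript_law prot f]_t (`|estimator prot t x0 - f x0| ^+ 2)%:E)%E.

Definition minimax_risk m (n : 'I_m -> nat) (eps delta : 'I_m -> R) (x0 : R)
    (F : set {mfun measurableTypeR R >-> measurableTypeR R}) : \bar R :=
  ereal_inf [set r | exists prot : protocol n eps delta,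
                       r = ereal_sup [set pointwise_risk prot x0 f | f in F]].

End mechanisms.

Definition private_rate {R : realType} (nu : R) (m n : nat) (eps : R) : R :=
  (m%:R * n%:R ^+ 2 * eps ^+ 2) `^ (- (2 * nu / (2 * nu + 2))) +
  (m * n)%:R `^ (- (2 * nu / (2 * nu + 1))).

(* Main.v *)
From HB Require Import structures.
Require Import Defs.
From mathcomp Require Import all_boot all_order all_algebra.
From mathcomp Require Import all_classical all_reals all_analysis.
From mathcomp Require Import measurable_realfun ess_sup_inf zify ring lra.

Set Implicit Arguments.
Unset Strict Implicit.
Unset Printing Implicit Defensive.

Import Order.TTheory GRing.Theory Num.Theory.
Import numFieldNormedType.Exports.

Local Open Scope classical_set_scope.
Local Open Scope ring_scope.

(** The rate is attained without any logarithmic factor, so [M = 1] will do. Put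
    [r = 2^-nu]; whatever [p] and [q] are, membership in the ball bounds the
    wavelet coefficients of level [l] by a multiple of [(2^(nu + 1/2))^-l].

    Lower bound. A multiple of a scaling function of scale [j] whose value at [x0]
    is of order [2^(j/2)] gives a bump [f] in the ball, of height [a r^j], supported
    within [O(2^-j)] of [x0]; [f] is tested against [0] by Le Cam's method. Without
    privacy the chi-square divergence of the [m n] observations is of order
    [m n (a r^j)^2 2^-j]. With privacy, replacing the observations of a server one
    at a time, each replacement being visible with probability [O(a r^j 2^-j)] only,
    changes the probability of every set of transcripts by a factor
    [1 + O(n eps a r^j 2^-j)], so that the chi-square divergence of [m] transcripts
    is of order [m (n eps a r^j 2^-j)^2]. One takes the smallest [j] that keeps
    either quantity bounded.

    Upper bound. Let [kappa] be the reproducing kernel at [x0] of the scaling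
    functions of scale [J]. Each server sends the sum of [T(Y_i) kappa(X_i)] over its
    sample plus Laplace noise, where [T] is the bounded function for which
    [E T(a + xi) = c sin(omega a)], [xi] being standard normal and [omega] small;
    the aggregate estimates [sin(omega f(x0))], hence [f(x0)]. As the server's sum is
    bounded, clipping the noisy sum at a high enough level costs almost nothing, and
    makes all random variables bounded. Since [kappa] integrates polynomials of
    degree less than [A] to their values at [x0], the bias is [O(r^J)] provided that
    [sin(omega f)] is within [O(r^J)] of such a polynomial at distance [O(2^-J)] of
    [x0]; this follows by telescoping over the partial sums of the wavelet series. *)

(** * Functions with bounded derivatives *)

(** Truncating the Gaussian responses at a level growing with the sample would cost a logarithm; the
    bounded [T], of fixed frequency, keeps the sensitivity of a server's sum of the order of the
    kernel. The price is that a nonlinear function of [f] is estimated, and [f] need not be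
    differentiable. Hence the telescoping: the increment of the sine at level [l] is smooth at scale
    [2^-l] and of size [r^l], and because [nu < A] the Taylor errors of the increments are dominated
    by the finest levels. In the private lower bound the delicate point is the passage from factors
    [1 + x] on events to the chi-square bound [1 + x^2]. Multiplying the factors over the servers
    would force [x] to be of order [1/m]; the quadratic bound allows [m^(-1/2)]. The additive errors
    caused by [delta] add up to the order of [m n delta]. Closeness of laws is always expressed by
    inequalities between expectations of functions with values in [[0,1]], a form which passes
    through products and kernels without densities. *)

Section smooth.
Context {R : realType}.
Implicit Types (U V : R -> R) (M : R) (s : nat).

(** One constant bounds all derivatives up to order [s]. They are given existentially, one witness
    per order, so that closure under products and compositions goes by induction on [s] without
    formulas for iterated derivatives. *)
Fixpoint smooth s M U : Prop :=
  (forall x, `|U x| <= M) /\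
  if s is s'.+1 then
    exists U', (forall x, is_derive x (1 : R) U (U' x)) /\ smooth s' M U'
  else True.

Lemma smooth_bound s M U x : smooth s M U -> `|U x| <= M.
Proof. by case: s => [|s] []. Qed.

Lemma smooth_ge0 s M U : smooth s M U -> 0 <= M.
Proof. by move/(smooth_bound 0); exact: le_trans. Qed.

Lemma smooth_le s M M' U : smooth s M U -> M <= M' -> smooth s M' U.
Proof.
elim: s U => [|s IH] U /= [UM].
  by move=> _ MM'; split=> // x; exact: le_trans (UM x) MM'.
move=> [U' [dU sU']] MM'; split; first by move=> x; exact: le_trans (UM x) MM'.
by exists U'; split => //; exact: IH.
Qed.

Lemma smoothW s M U : smooth s.+1 M U -> smooth s M U.
Proof.
elim: s U => [|s IH] U; first by case.
move=> [UM [U' [dU sU']]]; split => //.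
by exists U'; split => //; exact: IH.
Qed.

Lemma smooth_cst s (c : R) : smooth s `|c| (fun=> c).
Proof.
elim: s c => [|s IH] c //=; split => //.
exists (fun=> 0); split; first by move=> x; exact: is_derive_cst.
by apply: smooth_le (IH 0) _; rewrite normr0.
Qed.

Lemma smoothD s M M' U V : smooth s M U -> smooth s M' V ->
  smooth s (M + M') (fun x => U x + V x).
Proof.
elim: s U V => [|s IH] U V [UM sU] [VM sV].
  by split=> // x; apply: (le_trans (ler_normD _ _)); exact: lerD.
split; first by move=> x; apply: (le_trans (ler_normD _ _)); exact: lerD.
case: sU sV => [U' [dU sU]] [V' [dV sV]].
exists (fun x => U' x + V' x); split; last exact: IH.
by move=> x; exact: is_deriveD.
Qed.

Lemma smoothZ s M (c : R) U : smooth s M U ->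
  smooth s (`|c| * M) (fun x => c * U x).
Proof.
elim: s U => [|s IH] U [UM sU].
  by split=> // x; rewrite normrM ler_wpM2l.
split; first by move=> x; rewrite normrM ler_wpM2l.
case: sU => [U' [dU sU]].
exists (fun x => c * U' x); split; last exact: IH.
by move=> x; have := is_deriveZ c (dU x).
Qed.

Lemma smooth_sum s (I : Type) (r : seq I) (P : pred I) (B : I -> R)
    (U : I -> R -> R) : (forall i, P i -> smooth s (B i) (U i)) ->
  smooth s (\sum_(i <- r | P i) B i) (fun x => \sum_(i <- r | P i) U i x).
Proof.
move=> sU; elim: r => [|i r IH].
  rewrite big_nil (_ : (fun x => _) = fun=> 0).
    by have := smooth_cst s 0; rewrite normr0.
  by apply/funext => x; rewrite big_nil.
rewrite big_cons (_ : (fun x => _) = fun x =>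
    if P i then U i x + \sum_(i <- r | P i) U i x
    else \sum_(i <- r | P i) U i x).
  by case: ifPn => // Pi; apply: smoothD => //; exact: sU.
by apply/funext => x; rewrite big_cons.
Qed.

Lemma smooth_affine s M K (a b : R) U : `|a| <= K -> 1 <= K -> smooth s M U ->
  smooth s (K ^+ s * M) (fun x => U (a * x + b)).
Proof.
move=> aK K1; elim: s U => [|s IH] U sU.
  by case: sU => UM _; rewrite expr0 mul1r.
have M0 := smooth_ge0 sU.
case: sU => UM [U' [dU sU]]; split.
  by move=> x; rewrite (le_trans (UM _))// ler_peMl// exprn_ege1.
exists (fun x => a * U' (a * x + b)); split.
  move=> x.
  have h : is_derive x 1 (fun x => a * x + b) a.
    have := is_deriveD (is_deriveZ a (is_derive_id x (1 : R)))
                       (is_derive_cst b x (1 : R)).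
    by move=> H; apply: (is_derive_eq H); rewrite addr0 /GRing.scale/= mulr1.
  by have := is_derive1_comp (dU _) h; rewrite mulrC.
apply: smooth_le (smoothZ a (IH _ sU)) _.
by rewrite exprS -mulrA ler_wpM2r// mulr_ge0// exprn_ge0// (le_trans ler01).
Qed.

(** Each differentiation splits the product into two terms, whence the power of 2. *)
Lemma smoothM s M M' U V : smooth s M U -> smooth s M' V ->
  smooth s (2 ^+ s * (M * M')) (fun x => U x * V x).
Proof.
elim: s U V => [|s IH] U V sU sV.
  case: sU sV => UM _ [VM _]; split=> // x.
  by rewrite expr0 mul1r normrM ler_pM.
have M0 := smooth_ge0 sU; have M'0 := smooth_ge0 sV.
have sU' := smoothW sU; have sV' := smoothW sV.
case: sU sV => UM [U' [dU sU]] [VM [V' [dV sV]]]; split.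
  move=> x; rewrite normrM (le_trans (ler_pM _ _ (UM x) (VM x)))//.
  by rewrite ler_peMl ?mulr_ge0// exprn_ege1// ler1n.
exists (fun x => U x * V' x + U' x * V x); split.
  by move=> x; have := is_deriveM (dU x) (dV x); rewrite /GRing.scale/= (mulrC (V x)).
apply: smooth_le (smoothD (IH _ _ sU' sV) (IH _ _ sU sV')) _.
by rewrite exprS; lra.
Qed.

Fixpoint trig_bound s M : R :=
  if s is s'.+1 then 1 + 2 ^+ s' * (trig_bound s' M * M) else 1.

(** Sine and cosine go together because each is, up to sign, the derivative of the other;
    [trig_bound] unfolds [(sin U)' = cos U * U']. *)
Lemma smooth_trig s M U : smooth s M U ->
  smooth s (trig_bound s M) (fun x => sin (U x)) /\
  smooth s (trig_bound s M) (fun x => cos (U x)).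
Proof.
elim: s U => [|s IH] U sU.
  by split; split=> // x; rewrite ler_norml ?sin_geN1 ?sin_le1 ?cos_geN1 ?cos_le1.
have M0 := smooth_ge0 sU.
have [sS sC] := IH _ (smoothW sU).
have b0 : 0 <= trig_bound s M by exact: smooth_ge0 sS.
have c0 : 0 <= 2 ^+ s * (trig_bound s M * M).
  by rewrite !mulr_ge0// exprn_ge0.
case: sU => UM [U' [dU sU]]; split; split.
- move=> x /=; apply: (@le_trans _ _ 1); last by rewrite lerDl.
  by rewrite ler_norml sin_geN1 sin_le1.
- exists (fun x => cos (U x) * U' x); split.
    by move=> x; exact: is_derive1_comp.
  by apply: smooth_le (smoothM sC sU) _; rewrite /= lerDr.
- move=> x /=; apply: (@le_trans _ _ 1); last by rewrite lerDl.
  by rewrite ler_norml cos_geN1 cos_le1.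
- exists (fun x => - 1 * (sin (U x) * U' x)); split.
    move=> x; have := is_derive1_comp (is_derive_cos _) (dU x).
    by rewrite mulN1r mulNr.
  apply: smooth_le (smoothZ (-1) (smoothM sS sU)) _.
  by rewrite /= normrN1 mul1r lerDr.
Qed.

Lemma sin_lipschitz (a b : R) : `|sin a - sin b| <= `|a - b|.
Proof.
wlog ab : a b / b <= a.
  by move=> h; have [/h|/ltW/h] := leP b a; rewrite // distrC (distrC b).
have c : {within `[b, a], continuous (@sin R)}.
  by apply: continuous_subspaceT => y; exact: continuous_sin.
have [y _ ->] := @MVT_segment _ sin cos b a ab (fun y _ => is_derive_sin y) c.
by rewrite normrM ler_piMl// ler_norml cos_geN1 cos_le1.
Qed.

Lemma normr_sin_le (x : R) : `|sin x| <= `|x|.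
Proof. by have := sin_lipschitz x 0; rewrite sin0 !subr0. Qed.

Lemma normr_cos_sub1_le (x : R) : `|cos x - 1| <= `|x|.
Proof.
wlog x0 : x / 0 <= x.
  move=> h; have [|x0] := leP 0 x; first exact: h.
  by rewrite -cosN -(normrN x) h// oppr_ge0 ltW.
have c : {within `[0, x], continuous (@cos R)}.
  by apply: continuous_subspaceT => y; exact: continuous_cos.
have [y _] := @MVT_segment _ cos (fun x => - sin x) 0 x x0
  (fun y _ => is_derive_cos y) c.
rewrite cos0 subr0 => ->; rewrite normrM ler_piMl// normrN.
by rewrite ler_norml sin_geN1 sin_le1.
Qed.

Definition small_trig_bound s M : R :=
  if s is s'.+1 then M + 2 ^+ s' * (trig_bound s' M * M) else M.

(** What matters is that the bound is linear in [e]: a derivative brings out a factor [e], and the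
    functions themselves are small because [sin] and [cos - 1] are Lipschitz and vanish at 0. *)
Lemma smooth_small_trig s M U e : smooth s M U -> 0 <= e <= 1 ->
  smooth s (e * small_trig_bound s M) (fun x => sin (e * U x)) /\
  smooth s (e * small_trig_bound s M) (fun x => cos (e * U x) - 1).
Proof.
case: s => [|s] sU /andP[e0 e1].
  case: sU => UM _; split; split=> // x.
    by rewrite (le_trans (normr_sin_le _))// normrM ger0_norm// ler_wpM2l.
  by rewrite (le_trans (normr_cos_sub1_le _))// normrM ger0_norm// ler_wpM2l.
have M0 := smooth_ge0 sU.
have t0 : 0 <= trig_bound s M.
  exact: smooth_ge0 (smooth_trig (smoothW sU)).1.
have c0 : 0 <= 2 ^+ s * (trig_bound s M * M) by rewrite !mulr_ge0// exprn_ge0.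
have seU : smooth s M (fun x => e * U x).
  apply: smooth_le (smoothZ e (smoothW sU)) _.
  by rewrite ger0_norm// ler_piMl.
have [sS sC] := smooth_trig seU.
case: sU => UM [U' [dU sU]].
have de (x : R) : is_derive x (1 : R) (fun x => e * U x) (e * U' x).
  by have := is_deriveZ e (dU x).
split; split.
- move=> x; rewrite (le_trans (normr_sin_le _))// normrM ger0_norm//.
  by rewrite ler_wpM2l// (le_trans (UM x))// lerDl.
- exists (fun x => e * (cos (e * U x) * U' x)); split.
    by move=> x; have := is_derive1_comp (is_derive_sin _) (de x); rewrite mulrCA.
  apply: smooth_le (smoothZ e (smoothM sC sU)) _.
  by rewrite ger0_norm// ler_wpM2l// lerDr.
- move=> x; rewrite (le_trans (normr_cos_sub1_le _))// normrM ger0_norm//.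
  by rewrite ler_wpM2l// (le_trans (UM x))// lerDl.
- exists (fun x => - e * (sin (e * U x) * U' x)); split.
    move=> x; have := is_deriveB (is_derive1_comp (is_derive_cos _) (de x))
       (is_derive_cst (1 : R) x (1 : R)).
    by rewrite subr0 mulNr mulrCA -!mulNr.
  apply: smooth_le (smoothZ (- e) (smoothM sS sU)) _.
  by rewrite normrN ger0_norm// ler_wpM2l// lerDr.
Qed.

Lemma is_derive_continuous U U' : (forall x, is_derive x (1 : R) U (U' x)) ->
  continuous U.
Proof. by move=> dU x; apply/differentiable_continuous/derivable1_diffP. Qed.

(** The polynomial of [U'] is integrated with initial value [U 0], and the mean value theorem
    controls the remainder. The factorial of Taylor's formula is lost, which only affects
    constants. *)
Lemma smooth_taylor s M U : smooth s M U ->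
  exists p : {poly R}, (size p <= s)%N /\
    forall y, `|U y - p.[y]| <= M * `|y| ^+ s.
Proof.
elim: s U => [|s IH] U sU.
  exists 0; rewrite size_poly0; split=> // y.
  by rewrite horner0 subr0 expr0 mulr1; case: sU.
have M0 := smooth_ge0 sU.
case: sU => _ [U' [dU /IH[p [sp Up]]]].
pose q := \poly_(i < s.+1) (if i is i'.+1 then p`_i' / i'.+1%:R else U 0).
have dq : q^`() = p.
  apply/polyP => i; rewrite coef_deriv coef_poly ltnS /=.
  case: ltnP => ip; last by rewrite mul0rn nth_default// (leq_trans sp).
by rewrite -[LHS]mulr_natr divfK// pnatr_eq0.
exists q; split; first exact: size_poly.
have q0 : q.[0] = U 0 by rewrite horner_coef0 coef_poly.
have dW (x : R) : is_derive x (1 : R) (fun y => U y - q.[y]) (U' x - p.[x]).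
  have := is_deriveB (dU x) (is_derive_poly q x).
  by rewrite dq.
have cW := is_derive_continuous dW.
have W0 : U 0 - q.[0] = 0 by rewrite q0 subrr.
move=> y; rewrite exprSr mulrA.
have bnd c : `|c| <= `|y| -> `|U' c - p.[c]| <= M * `|y| ^+ s.
  by move=> cy; rewrite (le_trans (Up c))// ler_wpM2l// lerXn2r// nnegrE.
have [y0|y0] := leP 0 y.
  have [c] := @MVT_segment _ _ _ 0 y y0 (fun x _ => dW x)
    (continuous_subspaceT cW).
  rewrite in_itv/= => /andP[c0 cy]; rewrite W0 !subr0 => ->.
  by rewrite normrM ler_wpM2r// bnd// !ger0_norm.
have [c] := @MVT_segment _ _ _ y 0 (ltW y0) (fun x _ => dW x)
    (continuous_subspaceT cW).
rewrite in_itv/= => /andP[c0 cy]; rewrite W0 !sub0r => /eqP.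
rewrite eqr_oppLR mulrN opprK => /eqP ->.
by rewrite normrM ler_wpM2r// bnd// !ler0_norm ?lerN2// ltW.
Qed.

End smooth.

(** * Expectations of bounded functions *)

Section expectation.
Context {R : realType}.

Section one.
Context d (T : measurableType d).
Implicit Types (P : probability T R) (f g : T -> R).

Definition Ex P f : R := \int[P]_x f x.

(** Under a probability these functions are integrable, so that expectations can be handled without
    finiteness conditions. *)
Definition bm f := measurable_fun setT f /\ exists M, forall x, `|f x| <= M.

Definition test f := measurable_fun setT f /\ forall x, 0 <= f x <= 1.

Lemma test_bm f : test f -> bm f.
Proof.
move=> [mf f01]; split=> //; exists 1 => x.
by have /andP[f0 f1] := f01 x; rewrite ger0_norm.
Qed.

Lemma bm_integrable P f : bm f -> P.-integrable setT (EFin \o f).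
Proof.
move=> [mf [M fM]]; apply: measurable_bounded_integrable => //.
  by apply: (le_lt_trans (probability_le1 P measurableT)); rewrite ltry.
exists M; split; first exact: num_real.
by move=> x Mx y _ /=; rewrite (le_trans (fM y))// ltW.
Qed.

Lemma bm_cst (c : R) : bm (fun=> c).
Proof. by split; [exact: measurable_cst | exists `|c|]. Qed.

Lemma bmD f g : bm f -> bm g -> bm (fun x => f x + g x).
Proof.
move=> [mf [M fM]] [mg [N gN]]; split; first exact: measurable_funD.
by exists (M + N) => x; rewrite (le_trans (ler_normD _ _))// lerD.
Qed.

Lemma bmM f g : bm f -> bm g -> bm (fun x => f x * g x).
Proof.
move=> [mf [M fM]] [mg [N gN]]; split; first exact: measurable_funM.
by exists (M * N) => x; rewrite normrM ler_pM.
Qed.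

Lemma bmZ (c : R) f : bm f -> bm (fun x => c * f x).
Proof. by move=> bf; apply: bmM => //; exact: bm_cst. Qed.

Lemma bmB f g : bm f -> bm g -> bm (fun x => f x - g x).
Proof.
move=> bf bg; have := bmD bf (bmZ (-1) bg).
by congr bm; apply/funext => x; rewrite mulN1r.
Qed.

Lemma bmX f n : bm f -> bm (fun x => f x ^+ n).
Proof.
move=> bf; elim: n => [|n IH]; first exact: bm_cst.
have := bmM bf IH; congr bm; by apply/funext => x; rewrite exprS.
Qed.

Lemma bm_sum (I : Type) (r : seq I) (F : I -> T -> R) :
  (forall i, bm (F i)) -> bm (fun x => \sum_(i <- r) F i x).
Proof.
move=> bF; elim: r => [|i r IH].
  by have := bm_cst 0; congr bm; apply/funext => x; rewrite big_nil.
by have := bmD (bF i) IH; congr bm; apply/funext => x; rewrite big_cons.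
Qed.

Lemma Ex_cst P (c : R) : Ex P (fun=> c) = c.
Proof.
rewrite /Ex Rintegral_cst//.
transitivity (c * fine (1%E : \bar R)); last by rewrite mulr1.
by congr (_ * fine _); exact: probability_setT.
Qed.

Lemma ExD P f g : bm f -> bm g -> Ex P (fun x => f x + g x) = Ex P f + Ex P g.
Proof. by move=> bf bg; rewrite /Ex RintegralD//; exact: bm_integrable. Qed.

Lemma ExZ P (c : R) f : bm f -> Ex P (fun x => c * f x) = c * Ex P f.
Proof. by move=> bf; rewrite /Ex RintegralZl//; exact: bm_integrable. Qed.

Lemma ExB P f g : bm f -> bm g -> Ex P (fun x => f x - g x) = Ex P f - Ex P g.
Proof. by move=> bf bg; rewrite /Ex RintegralB//; exact: bm_integrable. Qed.

Lemma le_Ex P f g : bm f -> bm g -> (forall x, f x <= g x) -> Ex P f <= Ex P g.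
Proof. by move=> bf bg fg; apply: le_Rintegral => //; exact: bm_integrable. Qed.

Lemma Ex_ge0 P f : (forall x, 0 <= f x) -> 0 <= Ex P f.
Proof. by move=> f0; apply: Rintegral_ge0 => x _. Qed.

Lemma le_Ex_cst P f (c : R) : bm f -> (forall x, f x <= c) -> Ex P f <= c.
Proof.
by move=> bf fc; rewrite -(Ex_cst P c); apply: le_Ex => //; exact: bm_cst.
Qed.

Lemma norm_Ex_le P f g : bm f -> bm g -> (forall x, `|f x| <= g x) ->
  `|Ex P f| <= Ex P g.
Proof.
move=> bf bg fg; rewrite ler_norml; apply/andP; split.
  rewrite -mulN1r -ExZ//; apply: le_Ex => // [|x]; first exact: bmZ.
  by rewrite mulN1r; have := fg x; rewrite ler_norml => /andP[].
by apply: le_Ex => // x; rewrite (le_trans (ler_norm _)).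
Qed.

Lemma Ex_sum P (I : Type) (r : seq I) (F : I -> T -> R) :
  (forall i, bm (F i)) ->
  Ex P (fun x => \sum_(i <- r) F i x) = \sum_(i <- r) Ex P (F i).
Proof.
move=> bF; elim: r => [|i r IH].
  rewrite big_nil -[RHS](Ex_cst P).
  by congr Ex; apply/funext => x; rewrite big_nil.
rewrite big_cons -IH -ExD//; last exact: bm_sum.
by congr Ex; apply/funext => x; rewrite big_cons.
Qed.

Lemma Ex_test P f : test f -> 0 <= Ex P f <= 1.
Proof.
move=> tf; apply/andP; split; first by apply: Ex_ge0 => x; case/andP: (tf.2 x).
by apply: le_Ex_cst => [|x]; [exact: test_bm | case/andP: (tf.2 x)].
Qed.

Lemma test_sqr f : test f -> test (fun x => f x ^+ 2).
Proof.
move=> [mf f01]; split; first exact: measurable_funX.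
by move=> x; have /andP[f0 f1] := f01 x; rewrite exprn_ge0//= exprn_ile1.
Qed.

Lemma test_onem f : test f -> test (fun x => 1 - f x).
Proof.
move=> [mf f01]; split; first by apply: measurable_funB => //; exact: measurable_cst.
by move=> x; have /andP[f0 f1] := f01 x; rewrite subr_ge0 f1 lerBlDr lerDl.
Qed.

Lemma Ex_variance P f : bm f ->
  Ex P (fun x => (f x - Ex P f) ^+ 2) = Ex P (fun x => f x ^+ 2) - Ex P f ^+ 2.
Proof.
move=> bf; set e := Ex P f.
transitivity (Ex P (fun x => f x ^+ 2 + (e ^+ 2 - 2 * e * f x))).
  by congr Ex; apply/funext => x; ring.
have b1 := bmZ (2 * e) bf; have b2 := bm_cst (e ^+ 2).
rewrite (ExD _ (bmX 2 bf) (bmB b2 b1)) (ExB _ b2 b1) Ex_cst ExZ// -/e; ring.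
Qed.

Lemma Ex_sqr_le P f : bm f -> Ex P f ^+ 2 <= Ex P (fun x => f x ^+ 2).
Proof.
move=> bf; rewrite -subr_ge0 -Ex_variance//.
by apply: Ex_ge0 => x; exact: sqr_ge0.
Qed.

Lemma Ex_indic P (A : set T) : measurable A -> Ex P (\1_A : T -> R) = fine (P A).
Proof. by move=> mA; rewrite /Ex /Rintegral integral_indic// setIT. Qed.

Lemma test_indic (A : set T) : measurable A -> test (\1_A : T -> R).
Proof.
move=> mA; split; first exact: measurable_indic.
by move=> x; rewrite indicE; case: (_ \in _); rewrite /= ?lexx ?ler01.
Qed.

End one.

Section composition.
Context d1 d2 (T1 : measurableType d1) (T2 : measurableType d2).

Lemma bm_comp (f : T2 -> R) (g : T1 -> T2) :
  measurable_fun setT g -> bm f -> bm (f \o g).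
Proof.
move=> mg [mf [M fM]]; split; first exact: measurableT_comp.
by exists M => x; exact: fM.
Qed.

Lemma test_comp (f : T2 -> R) (g : T1 -> T2) :
  measurable_fun setT g -> test f -> test (f \o g).
Proof.
by move=> mg [mf f01]; split; [exact: measurableT_comp | move=> x; exact: f01].
Qed.

Lemma Ex_distribution (P : probability T1 R) (X : {mfun T1 >-> T2})
    (f : T2 -> R) : bm f -> Ex (distribution P X) f = Ex P (f \o X).
Proof.
move=> bf; rewrite /Ex /Rintegral integral_distribution//.
  by apply/measurable_EFinP; case: bf.
apply: (@bm_integrable _ _ P (f \o X)).
by apply: bm_comp => //; exact: measurable_funPT.
Qed.

End composition.

Section fubini.
Context d1 d2 (T1 : measurableType d1) (T2 : measurableType d2).
Variables (P : probability T1 R) (Q : probability T2 R).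
Implicit Type f : T1 * T2 -> R.

Lemma bm_pair1 f x : bm f -> bm (fun y => f (x, y)).
Proof. by move=> bf; apply: (bm_comp (f := f) (g := pair x)) => //. Qed.

Lemma test_pair1 f x : test f -> test (fun y => f (x, y)).
Proof. by move=> tf; apply: (test_comp (f := f) (g := pair x)) => //. Qed.

Lemma bm_Ex_pair f : bm f -> bm (fun x => Ex Q (fun y => f (x, y))).
Proof.
move=> bf; have [mf [M fM]] := bf; split; last first.
  exists M => x; rewrite -(Ex_cst Q M).
  by apply: norm_Ex_le => //; [exact: bm_pair1 | exact: bm_cst].
have iF : (P \x Q)%E.-integrable setT (EFin \o f) by exact: bm_integrable.
apply: (measurableT_comp (fine_measurable measurableT)).
exact: (measurable_fubini_F iF).
Qed.

Lemma Ex_prod f : bm f ->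
  Ex (P \x Q)%E f = Ex P (fun x => Ex Q (fun y => f (x, y))).
Proof.
move=> bf.
have iF : (P \x Q)%E.-integrable setT (EFin \o f) by exact: bm_integrable.
rewrite /Ex /Rintegral -(integral12_prod_meas1 iF); congr fine.
apply: eq_integral => x _; rewrite /fubini_F/= fineK//.
apply: integrable_fin_num => //.
exact: (@bm_integrable _ _ Q (fun y => f (x, y)) (bm_pair1 x bf)).
Qed.

End fubini.

Section tuples.
Context d (T : measurableType d).

Lemma Ex_product_law m (P : 'I_m.+1 -> probability T R)
    (f : m.+1.-tuple T -> R) : bm f ->
  Ex (product_law P) f =
  Ex (P ord0) (fun x => Ex (product_law (fun i => P (lift ord0 i)))
    (fun t => f (cons_pair (x, t)))).
Proof.
move=> bf; rewrite /= Ex_distribution// Ex_prod//.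
by apply: bm_comp => //; exact: measurable_cons_pair.
Qed.

End tuples.

(* The density-free form of the bound [k] on [1 + chi^2(P | Q)], up to [e]. *)
Definition chi2_le d (T : measurableType d) (k e : R) (P Q : probability T R) :=
  forall f, test f -> Ex P f <= Num.sqrt (k * Ex Q (fun x => f x ^+ 2)) + e.

Lemma test_sqrt d (T : measurableType d) (f : T -> R) :
  test f -> test (fun x => Num.sqrt (f x)).
Proof.
move=> [mf f01]; split.
  by apply: (measurableT_comp _ mf); apply: continuous_measurable_fun; exact: sqrt_continuous.
move=> x; have /andP[f0 f1] := f01 x; rewrite sqrtr_ge0/=.
by rewrite -sqrtr1 ler_wsqrtr.
Qed.

Lemma test_Ex_pair d1 d2 (T1 : measurableType d1) (T2 : measurableType d2)
    (P : probability T1 R) (Q : probability T2 R) (f : T1 * T2 -> R) : test f ->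
  test (fun x => Ex Q (fun y => f (x, y))).
Proof.
move=> tf; split; last by move=> x; apply: Ex_test; exact: test_pair1.
by have [] := bm_Ex_pair P Q (test_bm tf).
Qed.

(** The inner bound is applied to each slice. The square root of the slice's second moment under
    [Q'] is again a test; the outer bound applies to it, and its square restores the second moment
    under the product. *)
Lemma chi2_prod d1 d2 (T1 : measurableType d1) (T2 : measurableType d2)
    (P Q : probability T1 R) (P' Q' : probability T2 R) k e k' e' :
  0 <= k -> 0 <= k' -> chi2_le k e P Q -> chi2_le k' e' P' Q' ->
  chi2_le (k * k') (Num.sqrt k' * e + e') (P \x P')%E (Q \x Q')%E.
Proof.
move=> k0 k'0 PQ PQ' f tf; rewrite !Ex_prod; [|exact/test_bm/test_sqr|exact/test_bm].
have tf2 := test_sqr tf.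
pose g x := Ex Q' (fun y => f (x, y) ^+ 2).
have tg : test g by exact: (test_Ex_pair P _ tf2).
have tsg := test_sqrt tg.
have g0 x : 0 <= g x by case/andP: (tg.2 x).
apply: (@le_trans _ _ (Ex P (fun x => Num.sqrt k' * Num.sqrt (g x) + e'))).
  apply: le_Ex.
  - by apply/test_bm/(test_Ex_pair P).
  - by apply: bmD; [apply: bmZ; exact: test_bm | exact: bm_cst].
  - by move=> x; rewrite -sqrtrM//; apply: PQ'; exact: test_pair1.
rewrite ExD ?ExZ ?Ex_cst//; last 3 first.
- exact: test_bm.
- by apply: bmZ; exact: test_bm.
- exact: bm_cst.
rewrite addrA lerD2r.
apply: (le_trans (ler_wpM2l (sqrtr_ge0 _) (PQ _ tsg))).
rewrite mulrDr lerD2r -sqrtrM// mulrCA mulrA.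
by under eq_fun do rewrite sqr_sqrtr//.
Qed.

Lemma chi2_distribution d1 d2 (T1 : measurableType d1) (T2 : measurableType d2)
    (P Q : probability T1 R) (X : {mfun T1 >-> T2}) k e : chi2_le k e P Q ->
  chi2_le k e (distribution P X) (distribution Q X).
Proof.
move=> PQ f tf; rewrite !Ex_distribution; [|exact/test_bm/test_sqr|exact/test_bm].
by apply: (PQ (f \o X)); apply: test_comp => //; exact: measurable_funPT.
Qed.

(** The step from [m] to [m.+1] factors adds [e * sqrt k ^ m] to the error; the sum of these terms
    is replaced by [m] times a common bound. *)
Lemma chi2_product_law d (T : measurableType d) k e m
    (P Q : 'I_m -> probability T R) :
  1 <= k -> 0 <= e -> (forall j, chi2_le k e (P j) (Q j)) ->
  chi2_le (k ^+ m) (m%:R * e * Num.sqrt k ^+ m) (product_law P) (product_law Q).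
Proof.
move=> k1 e0; have k0 : 0 <= k by exact: le_trans ler01 k1.
have s1 : 1 <= Num.sqrt k by rewrite -[leLHS]sqrtr1 ler_wsqrtr.
have sX n : Num.sqrt (k ^+ n) = Num.sqrt k ^+ n.
  elim: n => [|n IH]; first by rewrite !expr0 sqrtr1.
  by rewrite !exprS sqrtrM// IH.
elim: m P Q => [|m IH] P Q PQ.
  move=> f tf; rewrite expr0 mul1r !mul0r addr0.
  rewrite (_ : product_law P = product_law Q)//.
  set D := product_law _; have /andP[E0 _] := Ex_test D tf.
  rewrite -[leLHS](ger0_norm E0) -sqrtr_sqr ler_wsqrtr//.
  by apply: Ex_sqr_le; exact: test_bm.
have := chi2_distribution (@cons_pair _ T m)
  (chi2_prod k0 (exprn_ge0 m k0) (PQ ord0)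
    (IH _ _ (fun j => PQ (lift ord0 j)))).
rewrite -exprS sX => H f tf; apply: (le_trans (H f tf)).
rewrite lerD2l [in leRHS]mulrSr mulrDl mul1r mulrDl (exprS _ m) addrC.
rewrite lerD//.
  by rewrite ler_wpM2l ?mulr_ge0// ler_peMl// exprn_ge0// sqrtr_ge0.
by rewrite mulrC ler_wpM2l// ler_peMl// exprn_ge0// sqrtr_ge0.
Qed.

Lemma count_le_floor (y : R) n :
  \sum_(k < n) (k.+1%:R <= y)%R%:R <= Num.max y 0 :> R /\
  (y <= n%:R -> y <= \sum_(k < n) (k.+1%:R <= y)%R%:R + 1).
Proof.
have full m : m%:R <= y -> \sum_(k < m) (k.+1%:R <= y)%R%:R = m%:R :> R.
  move=> my; transitivity (\sum_(k < m) (1 : R)).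
    apply: eq_bigr => k _.
    by rewrite (le_trans _ my)// ler_nat.
  by rewrite sumr_const card_ord.
elim: n => [|n [IH1 IH2]].
  rewrite big_ord0; split; first by rewrite le_max lexx orbT.
  by move=> y0; rewrite add0r (le_trans y0).
split.
  rewrite big_ord_recr/=; case: (boolP (n.+1%:R <= y)) => ny; last by rewrite addr0.
  rewrite full; last by rewrite (le_trans _ ny)// ler_nat.
  by rewrite le_max natr1 ny.
move=> yn; have [yn'|yn'] := leP y n%:R.
  rewrite big_ord_recr/= (le_trans (IH2 yn'))// lerD2r lerDl.
  by case: (_ <= y).
rewrite big_ord_recr/= full//; last exact: ltW.
rewrite (le_trans yn)// -natr1 lerD2r lerDl; by case: (_ <= y).
Qed.

(** Layer-cake approximation by the average of the indicators of level sets. It carries statements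
    about sets, such as privacy, over to tests. *)
Lemma test_layers d (T : measurableType d) (f : T -> R) (n : nat) : test f ->
  exists A : nat -> set T, (forall k, measurable (A k)) /\
  forall x, n.+1%:R^-1 * (\sum_(k < n.+1) (\1_(A k) x : R)) <= f x /\
    f x <= n.+1%:R^-1 * (\sum_(k < n.+1) (\1_(A k) x : R)) + n.+1%:R^-1.
Proof.
move=> [mf f01].
exists (fun k => [set x | k.+1%:R <= n.+1%:R * f x]); split.
  move=> k; have mg : measurable_fun setT (fun x => n.+1%:R * f x).
    by apply: measurable_funM => //; exact: measurable_cst.
  rewrite -[X in measurable X]setTI.
  have := mg measurableT `[k.+1%:R, +oo[%classic (measurable_itv _).
  congr (measurable (_ `&` _)); apply/seteqP.
  by split => x /=; rewrite in_itv/= andbT.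
move=> x; have /andP[f0 f1] := f01 x.
have n0 : 0 < n.+1%:R :> R by rewrite ltr0n.
have [] := count_le_floor (n.+1%:R * f x) n.+1.
rewrite max_l ?mulr_ge0 ?(ltW n0)//.
have -> : \sum_(k < n.+1) ((k.+1%:R <= n.+1%:R * f x)%R%:R : R) =
   \sum_(k < n.+1) \1_[set x0 | k.+1%:R <= n.+1%:R * f x0] x.
  by apply: eq_bigr => k _; rewrite indicE mem_setE.
move=> h1 h2; split.
  by rewrite ler_pdivrMl.
rewrite -[X in _ + X]mulr1 -mulrDr ler_pdivlMl//; apply: h2.
by rewrite ler_piMr// ltW.
Qed.

Lemma le_add_invn (a b : R) : (forall n : nat, a <= b + n.+1%:R^-1) -> a <= b.
Proof.
move=> h; apply/ler_addgt0Pr => e e0.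
have [n ne] : exists n : nat, n.+1%:R^-1 < e.
  have [n] := ltr_add_invr (y := 0) (x := e) e0.
  by rewrite add0r => ne; exists n.
by rewrite (le_trans (h n))// lerD2l ltW.
Qed.

Lemma le_Ex_sets d (T : measurableType d) (P Q : probability T R) k e :
  0 <= k ->
  (forall A : set T, measurable A -> Ex P (\1_A : T -> R) <= k * Ex Q (\1_A : T -> R) + e) ->
  forall f, test f -> Ex P f <= k * Ex Q f + e.
Proof.
move=> k0 h f tf; apply: le_add_invn => n.
have [A [mA fA]] := test_layers n tf.
have n0 : 0 < n.+1%:R :> R by rewrite ltr0n.
pose g x : R := \sum_(i < n.+1) \1_(A i) x.
have bA (i : 'I_n.+1) : bm (\1_(A i) : T -> R) by exact/test_bm/test_indic.
have bg : bm g by exact: bm_sum.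
have bng := bmZ n.+1%:R^-1 bg.
have bf := test_bm tf.
apply: (@le_trans _ _ (n.+1%:R^-1 * Ex P g + n.+1%:R^-1)).
  rewrite -ExZ// -[X in _ + X](Ex_cst P) -ExD//; last exact: bm_cst.
  apply: le_Ex => //; first by apply: bmD => //; exact: bm_cst.
  by move=> x; have [] := fA x.
rewrite lerD2r.
apply: (@le_trans _ _ (k * (n.+1%:R^-1 * Ex Q g) + e)); last first.
  rewrite lerD2r ler_wpM2l// -ExZ//; apply: le_Ex => // x.
  by have [] := fA x.
rewrite ler_pdivrMl// mulrDr mulrCA mulVKf ?gt_eqF//.
rewrite !Ex_sum// mulr_sumr.
have -> : n.+1%:R * e = \sum_(i < n.+1) e.
  by rewrite sumr_const card_ord mulr_natl.
by rewrite -big_split/=; apply: ler_sum => i _; exact: h.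
Qed.
End expectation.

(** * Private transcripts *)

Section privacy.
Context {R : realType}.

Section kernel_expectation.
Context d1 d2 (S : measurableType d1) (T : measurableType d2).
Variables (P : probability S R) (K : R.-pker S ~> T).

(** An alias of [K z] that can be given the structure of a probability, so that [Ex] applies. *)
Definition kernel_at (z : S) : set T -> \bar R := K z.

HB.instance Definition _ z := Measure.on (kernel_at z).

Let kernel_at_setT z : kernel_at z setT = 1%E.
Proof. exact: prob_kernel. Qed.

HB.instance Definition _ z :=
  Measure_isProbability.Build _ _ R (kernel_at z) (kernel_at_setT z).

Lemma measurable_Ex_kernel f : test f ->
  measurable_fun setT (fun z => Ex (kernel_at z) f).
Proof.
move=> [mf f01]; apply: (measurableT_comp (fine_measurable measurableT)).
apply: (measurable_fun_integral_kernel (l := K)).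
- by move=> U mU; exact: measurable_kernel.
- by move=> z; rewrite lee_fin; case/andP: (f01 z).
- exact/measurable_EFinP.
Qed.

Lemma test_Ex_kernel f : test f -> test (fun z => Ex (kernel_at z) f).
Proof.
move=> tf; split; first exact: measurable_Ex_kernel.
by move=> z; exact: Ex_test.
Qed.

(** On indicators this is the definition of [output_law]; level sets extend it to tests with an
    error at most [1 / (n + 1)], for every [n]. *)
Lemma Ex_output_law f : test f ->
  Ex (output_law P K) f = Ex P (fun z => Ex (kernel_at z) f).
Proof.
move=> tf.
have indicE (A : set T) : measurable A ->
    Ex (output_law P K) (\1_A : T -> R) =
    Ex P (fun z => Ex (kernel_at z) (\1_A : T -> R)).
  move=> mA; rewrite Ex_indic//.
  transitivity (fine (\int[P]_z (Ex (kernel_at z) (\1_A : T -> R))%:E)) => //.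
  congr fine; apply: eq_integral => z _; rewrite Ex_indic// fineK//.
  exact: (fin_num_measure (kernel_at z)).
have key n : `|Ex (output_law P K) f - Ex P (fun z => Ex (kernel_at z) f)| <=
    n.+1%:R^-1.
  have [A [mA fA]] := test_layers n tf.
  pose g x : R := \sum_(i < n.+1) \1_(A i) x.
  have bA (i : 'I_n.+1) : bm (\1_(A i) : T -> R) by exact/test_bm/test_indic.
  have bK (i : 'I_n.+1) : bm (fun z => Ex (kernel_at z) (\1_(A i) : T -> R)).
    by apply/test_bm/test_Ex_kernel/test_indic.
  have bg : bm g by exact: bm_sum.
  have bng := bmZ n.+1%:R^-1 bg.
  have bf := test_bm tf.
  have lo (Q : probability T R) : n.+1%:R^-1 * Ex Q g <= Ex Q f.
    by rewrite -ExZ//; apply: le_Ex => // x; have [] := fA x.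
  have hi (Q : probability T R) : Ex Q f <= n.+1%:R^-1 * Ex Q g + n.+1%:R^-1.
    rewrite -ExZ// -[X in _ + X](Ex_cst Q) -ExD//; last exact: bm_cst.
    apply: le_Ex => //; first by apply: bmD => //; exact: bm_cst.
    by move=> x; have [] := fA x.
  have gE : Ex (output_law P K) g = Ex P (fun z => Ex (kernel_at z) g).
    rewrite /g Ex_sum// (eq_bigr _ (fun (i : 'I_n.+1) _ => indicE _ (mA i))).
    by rewrite -Ex_sum//; congr Ex; apply/funext => z; rewrite Ex_sum.
  have bKg : bm (fun z => Ex (kernel_at z) g).
    rewrite (_ : (fun z => _) = fun z =>
        \sum_(i < n.+1) Ex (kernel_at z) (\1_(A i) : T -> R)).
      exact: bm_sum.
    by apply/funext => z; rewrite Ex_sum.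
  have bKf := test_bm (test_Ex_kernel tf).
  have lo' : n.+1%:R^-1 * Ex P (fun z => Ex (kernel_at z) g) <=
      Ex P (fun z => Ex (kernel_at z) f).
    by rewrite -ExZ//; apply: le_Ex => //; exact: bmZ.
  have hi' : Ex P (fun z => Ex (kernel_at z) f) <=
      n.+1%:R^-1 * Ex P (fun z => Ex (kernel_at z) g) + n.+1%:R^-1.
    rewrite -ExZ// -[X in _ + X](Ex_cst P) -ExD//; last 2 first.
    - exact: bmZ.
    - exact: bm_cst.
    by apply: le_Ex => //; apply: bmD; [exact: bmZ|exact: bm_cst].
  have := lo (output_law P K); have := hi (output_law P K).
  rewrite gE ler_norml; move: lo' hi'.
  set a := Ex P _; set b := Ex P _; set c := Ex _ _; set v := _^-1; lra.
apply/eqP; rewrite -subr_eq0 -normr_le0; apply: le_add_invn => n.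
by rewrite add0r.
Qed.

End kernel_expectation.

(** Data processing: a test performed after the kernel is, on average, a test performed before it,
    and Jensen's inequality compares the squares. *)
Lemma chi2_output_law d1 d2 (S : measurableType d1) (T : measurableType d2)
    (P Q : probability S R) (K : R.-pker S ~> T) k e : 0 <= k -> chi2_le k e P Q ->
  chi2_le k e (output_law P K) (output_law Q K).
Proof.
move=> k0 PQ f tf; rewrite !Ex_output_law//; last exact: test_sqr.
have tg := test_Ex_kernel K tf.
apply: (le_trans (PQ _ tg)); rewrite lerD2r ler_wsqrtr// ler_wpM2l//.
apply: le_Ex.
- exact/test_bm/test_sqr.
- exact/test_bm/test_Ex_kernel/test_sqr.
- by move=> x; apply: Ex_sqr_le; exact: test_bm.
Qed.

Definition tv_le d (T : measurableType d) (p : R) (P Q : probability T R) :=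
  forall f, test f -> Ex P f <= Ex Q f + p.

Lemma tv_le_sym d (T : measurableType d) p (P Q : probability T R) :
  tv_le p P Q -> tv_le p Q P.
Proof.
move=> PQ f tf; have := PQ _ (test_onem tf).
rewrite !ExB ?Ex_cst; try exact: bm_cst; try exact: test_bm; lra.
Qed.

(* [H] takes its values in an interval of length [(a - a^-1) E_Q H + O(de)]
   around [E_Q H]. *)
Lemma tv_dp_step d (T : measurableType d) (P Q : probability T R) p a de H :
  0 <= p -> 1 <= a -> 0 <= de -> tv_le p P Q -> test H ->
  (forall z z', H z <= a * H z' + de) ->
  Ex P H <= (1 + p * (a - a^-1)) * Ex Q H + 2 * p * de.
Proof.
move=> p0 a1 de0 PQ tH Hdp.
have a0 : 0 < a by exact: lt_le_trans ltr01 a1.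
have ai1 : a^-1 <= 1 by rewrite invf_le1.
have ai0 : 0 < a^-1 by rewrite invr_gt0.
have bH := test_bm tH.
set v := Ex Q H; have /andP[v0 v1] : 0 <= v <= 1 by exact: Ex_test.
pose U := a * v + de; pose L := a^-1 * (v - de).
have HU z : H z <= U.
  rewrite /U -(Ex_cst Q (H z)) -(Ex_cst Q de) -ExZ// -ExD//; last 2 first.
  - exact: bmZ.
  - exact: bm_cst.
  by apply: le_Ex => //; [exact: bm_cst | apply: bmD; [exact: bmZ|exact: bm_cst]].
have LH z : L <= H z.
  rewrite /L ler_pdivrMl// lerBlDr; apply: le_Ex_cst => //.
have UL : U - L = (a - a^-1) * v + (1 + a^-1) * de by rewrite /U /L; ring.
have UL0 : 0 <= U - L.
  by rewrite UL addr_ge0// mulr_ge0// ?subr_ge0 ?(le_trans ai1)// addr_ge0// ltW.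
suff key : Ex P H <= v + p * (U - L).
  apply: (le_trans key); rewrite UL.
  have : p * (a^-1 * de) <= p * de.
    by rewrite ler_wpM2l// ler_piMl.
  lra.
have [UL0'|ULn0] := eqVneq (U - L) 0.
  rewrite UL0' mulr0 addr0.
  have HL z : H z = L.
    by apply/eqP; rewrite eq_le LH andbT (le_trans (HU z))//; move: UL0'; lra.
  by rewrite /v (_ : H = fun=> L) ?Ex_cst//; apply/funext.
have ULp : 0 < U - L by rewrite lt_def ULn0.
pose psi z := (U - L)^-1 * (H z - L).
have bHL : bm (fun z => H z - L) by apply: bmB => //; exact: bm_cst.
have tpsi : test psi.
  split; first by have [] := bmZ (U - L)^-1 bHL.
  move=> z; rewrite /psi; apply/andP; split.
    by rewrite mulr_ge0 ?invr_ge0// subr_ge0.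
  by rewrite ler_pdivrMl// mulr1 lerD2r.
have := PQ _ tpsi; rewrite /psi.
rewrite !ExZ// !ExB ?Ex_cst -/v//; try exact: bm_cst.
rewrite ler_pdivrMl// mulrDr mulVKf//; lra.
Qed.

Definition agree_off n (T : Type) (i : 'I_n) (z z' : n.-tuple T) :=
  forall j, j != i -> tnth z j = tnth z' j.

(** The first coordinate is switched by [tv_dp_step], applied to the average of [G] over the other
    coordinates under [Q]; these are switched by induction with the first one frozen. Freezing and
    averaging both preserve the privacy inequality, which is why it is assumed of a function [G] and
    not of a mechanism. *)
Lemma hybrid_dp d (T : measurableType d) (P Q : probability T R) p a de n
    (G : n.-tuple T -> R) :
  0 <= p -> 1 <= a -> 0 <= de -> tv_le p P Q -> test G ->
  (forall i z z', agree_off i z z' -> G z <= a * G z' + de) ->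
  Ex (product_law (fun _ : 'I_n => P)) G <=
    (1 + p * (a - a^-1)) ^+ n * Ex (product_law (fun _ : 'I_n => Q)) G +
    n%:R * (2 * p * de) * (1 + p * (a - a^-1)) ^+ n.
Proof.
move=> p0 a1 de0 PQ; set k := 1 + _.
have ai1 : a^-1 <= 1 by rewrite invf_le1 ?(lt_le_trans ltr01 a1).
have k1 : 1 <= k by rewrite /k lerDl mulr_ge0// subr_ge0 (le_trans ai1).
have k0 : 0 <= k by exact: le_trans k1.
elim: n G => [|n IH] G tG Gdp.
  by rewrite expr0 mul1r !mul0r addr0.
have tGc : test (G \o @cons_pair _ T n).
  by apply: test_comp => //; exact: measurable_cons_pair.
rewrite !Ex_product_law; [|exact: test_bm..].
pose Pn := product_law (fun _ : 'I_n => P).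
pose Qn := product_law (fun _ : 'I_n => Q).
rewrite -/Pn -/Qn.
pose H x := Ex Qn (fun t => G (cons_pair (x, t))).
have tH : test H by exact: (test_Ex_pair P _ tGc).
set sl := n%:R * (2 * p * de) * k ^+ n.
have IH' x : Ex Pn (fun t => G (cons_pair (x, t))) <= k ^+ n * H x + sl.
  apply: IH; first exact: (test_pair1 x tGc).
  move=> i z z' zz'; apply: (Gdp (lift ord0 i)) => j.
  have [->//|j0] := eqVneq j ord0.
  by case: (unliftP ord0 j) j0 => [j' ->|-> /eqP//] _ ji; rewrite !tnthS;
    apply: zz'; apply: contraNneq ji => ->.
have bH := test_bm tH.
apply: (@le_trans _ _ (k ^+ n * Ex P H + sl)).
  rewrite -ExZ// -[X in _ + X](Ex_cst P) -ExD//; last 2 first.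
  - exact: bmZ.
  - exact: bm_cst.
  apply: le_Ex => //.
  - exact/test_bm/(test_Ex_pair P _ tGc).
  - by apply: bmD; [exact: bmZ|exact: bm_cst].
have Hdp : Ex P H <= k * Ex Q H + 2 * p * de.
  apply: tv_dp_step => // x x'.
  rewrite /H -ExZ; last exact/test_bm/(test_pair1 x' tGc).
  rewrite -[X in _ <= _ + X](Ex_cst Qn) -ExD; last 2 first.
  - exact/bmZ/test_bm/(test_pair1 x' tGc).
  - exact: bm_cst.
  apply: le_Ex.
  - exact/test_bm/(test_pair1 x tGc).
  - apply: bmD; last exact: bm_cst.
    exact/bmZ/test_bm/(test_pair1 x' tGc).
  - move=> t; apply: (Gdp ord0) => j j0.
    by case: (unliftP ord0 j) j0 => [j' ->|-> /eqP//] _; rewrite !tnthS.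
apply: (@le_trans _ _ (k ^+ n * (k * Ex Q H + 2 * p * de) + sl)).
  by rewrite lerD2r ler_wpM2l// exprn_ge0.
have c0 : 0 <= 2 * p * de by rewrite !mulr_ge0.
have kn0 : 0 <= k ^+ n by exact: exprn_ge0.
have h : n.+1%:R * (2 * p * de) * k ^+ n <= n.+1%:R * (2 * p * de) * k ^+ n.+1.
  by rewrite ler_wpM2l ?mulr_ge0// exprS ler_peMl.
rewrite mulrDr mulrA -exprSr -addrA lerD2l (le_trans _ h)//.
by rewrite /sl -natr1; lra.
Qed.

(** Here the closeness becomes quadratic. With [c] the mean of [f] under [Q], the two inequalities
    applied to the positive and negative parts of [f - c] give [E_P f <= c + (k - 1) D + 2 e], where
    [D = E_Q |f - c|]. Since [D ^+ 2] is at most the variance of [f] under [Q], the Cauchy-Schwarz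
    inequality in the plane yields the factor [1 + (k - 1) ^+ 2]. *)
Lemma chi2_of_sets d (T : measurableType d) (P Q : probability T R) k e :
  1 <= k -> 0 <= e ->
  (forall A : set T, measurable A ->
    Ex P (\1_A : T -> R) <= k * Ex Q (\1_A : T -> R) + e /\
    Ex Q (\1_A : T -> R) <= k * Ex P (\1_A : T -> R) + e) ->
  chi2_le (1 + (k - 1) ^+ 2) (2 * e) P Q.
Proof.
move=> k1 e0 h f tf.
have k0 : 0 <= k by exact: le_trans k1.
have hPQ := le_Ex_sets k0 (fun A mA => (h A mA).1).
have hQP := le_Ex_sets k0 (fun A mA => (h A mA).2).
have bf := test_bm tf.
set c := Ex Q f; have /andP[c0 c1] : 0 <= c <= 1 by exact: Ex_test.
pose fp x := Num.max (f x - c) 0; pose fm x := Num.max (c - f x) 0.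
have [mf f01] := tf.
have tfp : test fp.
  split.
    apply: measurable_maxr; last exact: measurable_cst.
    by apply: measurable_funB => //; exact: measurable_cst.
  move=> x; have /andP[f0 f1] := f01 x.
  by rewrite /fp le_max lexx orbT/= ge_max ler01 andbT; move: c0 f1; lra.
have tfm : test fm.
  split.
    apply: measurable_maxr; last exact: measurable_cst.
    by apply: measurable_funB => //; exact: measurable_cst.
  move=> x; have /andP[f0 f1] := f01 x.
  by rewrite /fm le_max lexx orbT/= ge_max ler01 andbT; move: c1 f0; lra.
have bfp := test_bm tfp; have bfm := test_bm tfm.
have fE (M : probability T R) : Ex M f = c + Ex M fp - Ex M fm.
  rewrite -[X in X + _ - _](Ex_cst M c) -ExD// -?ExB//; try exact: bm_cst; last first.
    by apply: bmD => //; exact: bm_cst.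
  congr Ex; apply/funext => x; rewrite /fp /fm.
  by case: (leP 0 (f x - c)) => h1; case: (leP 0 (c - f x)) => h2; lra.
have E1 := fE P; have E0 := fE Q; rewrite -/c in E0.
pose D := Ex Q fp + Ex Q fm.
have D2 : c ^+ 2 + D ^+ 2 <= Ex Q (fun x => f x ^+ 2).
  rewrite -lerBrDl -Ex_variance//.
  rewrite /D -ExD//.
  apply: (le_trans (Ex_sqr_le _ (bmD bfp bfm))).
  apply: le_Ex; first exact/bmX/bmD.
    by apply: bmX; apply: bmB => //; exact: bm_cst.
  move=> x; rewrite -/c -[leRHS]real_normK ?num_real// (_ : fp x + fm x = `|f x - c|)//.
  rewrite /fp /fm -(opprB (f x) c); have [u0|u0] := leP 0 (f x - c).
    by rewrite max_r ?oppr_le0// addr0 ger0_norm.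
  by rewrite max_l ?oppr_ge0 ?(ltW u0)// add0r ltr0_norm.
have Hp := hPQ _ tfp; have Hm := hQP _ tfm.
have Qm0 : 0 <= Ex Q fm by case/andP: (Ex_test Q tfm).
have Qp0 : 0 <= Ex Q fp by case/andP: (Ex_test Q tfp).
(* The bound on [Ex Q fm] by [Ex P fm] is inverted without dividing by [k]: either [Ex P fm] exceeds
   [Ex Q fm], or [(k - 1) * Ex P fm] can be replaced by [(k - 1) * Ex Q fm]. *)
have Hm' : Ex Q fm - (k - 1) * Ex Q fm - e <= Ex P fm.
  have [le|gt] := leP (Ex P fm) (Ex Q fm).
    have : (k - 1) * Ex P fm <= (k - 1) * Ex Q fm.
      by rewrite ler_wpM2l// subr_ge0.
    lra.
  have : 0 <= (k - 1) * Ex Q fm by rewrite mulr_ge0// subr_ge0.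
  lra.
have D0 : 0 <= D by rewrite addr_ge0.
have step : Ex P f <= c + (k - 1) * D + 2 * e.
  by rewrite /D; move: E0; lra.
apply: (le_trans step); rewrite lerD2r.
set y := k - 1 in step *; have y0 : 0 <= y by rewrite subr_ge0.
have q0 : 0 <= c + y * D by rewrite addr_ge0// mulr_ge0.
rewrite -[leLHS](ger0_norm q0) -sqrtr_sqr ler_wsqrtr//.
apply: (@le_trans _ _ ((1 + y ^+ 2) * (c ^+ 2 + D ^+ 2))).
  by have := sqr_ge0 (c * y - D); rewrite !expr2; lra.
by rewrite ler_wpM2l// addr_ge0// sqr_ge0.
Qed.

End privacy.

(** * Translations and densities in Lebesgue integrals *)

Section integration.
Context {R : realType}.
Local Notation mu := (@lebesgue_measure R).
Local Open Scope ereal_scope.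

Lemma lebesgue_measure_shift (a : R) (A : set (measurableTypeR R)) :
  measurable A -> mu ((fun x => x + a)%R @^-1` A) = mu A.
Proof.
move=> mA; apply/esym.
have ms : measurable_fun setT
    ((fun x => x + a)%R : measurableTypeR R -> measurableTypeR R).
  by apply: measurable_funD => //; exact: measurable_cst.
apply: (@lebesgue_measure_unique _
  (pushforward mu ((fun x => x + a)%R : measurableTypeR R -> measurableTypeR R))) => //.
move=> _ [[x y] _ <-] /=; rewrite /pushforward.
rewrite (_ : _ @^-1` _ = `]x - a, y - a]%classic)%R; last first.
  by apply/seteqP; split => z /=; rewrite !in_itv/= ltrBlDr lerBrDr.
rewrite !lebesgue_measure_itv/= !lte_fin ltrD2r.
by case: ifP => // _; rewrite -!EFinD; congr EFin; ring.
Qed.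

Lemma ge0_integral_shift (a : R) (g : R -> \bar R) :
  measurable_fun setT (g : measurableTypeR R -> \bar R) -> (forall x, 0 <= g x) ->
  \int[mu]_x g (x + a)%R = \int[mu]_x g x.
Proof.
move=> mg g0.
have ms : measurable_fun setT
    ((fun x => x + a)%R : measurableTypeR R -> measurableTypeR R).
  by apply: measurable_funD => //; exact: measurable_cst.
transitivity (\int[pushforward mu ((fun x => x + a)%R : measurableTypeR R -> measurableTypeR R)]_x g x).
  by rewrite ge0_integral_pushforward.
apply: eq_measure_integral => A mA _; rewrite /pushforward.
exact: lebesgue_measure_shift.
Qed.

Import HBNNSimple.

Section density.
Context d (T : measurableType d) (m n : {measure set T -> \bar R}) (r : T -> R).
Hypothesis mr : measurable_fun setT r.
Hypothesis r0 : forall x, (0 <= r x)%R.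
Hypothesis nE : forall A, measurable A -> n A = \int[m]_(x in A) (r x)%:E.

(** Expectations under the normal and exponential laws become Lebesgue integrals, in which a shift
    can be moved onto the density. *)
Lemma ge0_integral_density (f : T -> \bar R) :
  measurable_fun setT f -> (forall x, 0 <= f x) ->
  \int[n]_x f x = \int[m]_x (f x * (r x)%:E).
Proof.
move=> mf f0.
have mrE : measurable_fun setT (EFin \o r) by exact/measurable_EFinP.
pose f_ := nnsfun_approx measurableT mf.
have f_cvg x : (f_ k x)%:E @[k --> \oo] --> f x by exact: cvg_nnsfun_approx.
have nd x : {homo (fun k => (f_ k x)%:E) : a b / (a <= b)%N >-> a <= b}.
  by move=> a b ab; rewrite lee_fin; exact/lefP/nd_nnsfun_approx.
have step k : \int[n]_x (f_ k x)%:E = \int[m]_x ((f_ k x)%:E * (r x)%:E).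
  under [LHS]eq_integral do rewrite fimfunE -fsumEFin//.
  rewrite [LHS]ge0_integral_fsum//; last 2 first.
  - by move=> y; exact/measurable_EFinP/measurableT_comp.
  - by move=> y x _; rewrite EFinM nnfun_muleindic_ge0.
  under [RHS]eq_integral.
    move=> x _; rewrite fimfunE -fsumEFin// ge0_mule_fsuml; last first.
      by move=> y; rewrite EFinM nnfun_muleindic_ge0.
    over.
  rewrite [RHS]ge0_integral_fsum//; last 2 first.
  - move=> y; apply: emeasurable_funM => //.
    by apply/measurable_EFinP/measurableT_comp.
  - move=> y x _; rewrite mule_ge0 ?lee_fin//.
    by have := nnfun_muleindic_ge0 (f_ k) y x; rewrite -EFinM lee_fin.
  apply: eq_fsbigr => y _.
  have mA : measurable (f_ k @^-1` [set y]) by [].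
  have rint : \int[m]_x ((\1_(f_ k @^-1` [set y]) x)%:E * (r x)%:E) =
      n (f_ k @^-1` [set y]).
    rewrite nE// [RHS]integral_mkcond; apply: eq_integral => x _.
    rewrite patchE indicE; case: ifPn => _; by rewrite ?mul1e ?mul0e.
  have [y0|y0] := leP 0%R y.
    under eq_integral do rewrite EFinM.
    under [RHS]eq_integral do rewrite EFinM -muleA.
    have mi : measurable_fun setT (fun x => (\1_(f_ k @^-1` [set y]) x)%:E : \bar R).
      exact/measurable_EFinP.
    rewrite [LHS](ge0_integralZl _ measurableT mi) ?lee_fin//.
    rewrite [RHS](ge0_integralZl _ measurableT (emeasurable_funM mi mrE)) ?lee_fin//.
      by rewrite rint integral_indic// setIT.
    by move=> x _; rewrite mule_ge0 ?lee_fin.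
  transitivity (0 : \bar R); [|apply/esym]; apply: integral0_eq => x _;
    by rewrite preimage_nnfun0// indic0 mulr0 ?mul0e.
transitivity (limn (fun k => \int[n]_x (f_ k x)%:E)).
  rewrite -monotone_convergence//=.
  - by apply: eq_integral => x _; apply/esym/cvg_lim.
  - by move=> k; exact/measurable_EFinP/measurable_funTS.
  - by move=> k x _; rewrite lee_fin.
rewrite (_ : (fun k => _) = (fun k => \int[m]_x ((f_ k x)%:E * (r x)%:E))); last first.
  by apply/funext => k; exact: step.
rewrite -monotone_convergence//=.
- apply: eq_integral => x _; apply/cvg_lim => //.
  by apply: cvgeZr => //.
- by move=> k; apply: emeasurable_funM => //; exact/measurable_EFinP/measurable_funTS.
- by move=> k x _; rewrite mule_ge0 ?lee_fin.
- by move=> x _ a b ab; apply: lee_wpmul2r; rewrite ?lee_fin//; exact/lefP/nd_nnsfun_approx.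
Qed.

End density.
End integration.

(** * The regression model *)

Section model.
Context {R : realType}.
Local Notation mu := (@lebesgue_measure R).
Local Notation N01 := (normal_prob (0 : R) (1 : R)).
Local Notation U01 := (uniform_prob (@ltr01 R)).

(** The Cauchy-Schwarz inequality in linearized form: for fixed [l] the hypothesis can be proved
    pointwise and integrated. The optimal choice is [l = x / a]; if [a = 0], a large [l] gives a
    contradiction. *)
Lemma amgm_sqrt (x a b : R) : 0 <= a -> 0 <= b ->
  (forall l, 0 < l -> 2 * x <= l * a + l^-1 * b) -> x <= Num.sqrt (a * b).
Proof.
move=> a0 b0 h; have [x0|x0] := leP x 0; first by rewrite (le_trans x0)// sqrtr_ge0.
rewrite -[leLHS](ger0_norm (ltW x0)) -sqrtr_sqr ler_wsqrtr//.
have [a_eq0|a_neq0] := eqVneq a 0.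
  have bx0 : 0 < b + x by rewrite ltr_wpDl.
  have := h ((b + x) / x) (divr_gt0 bx0 x0).
  rewrite a_eq0 mulr0 add0r invf_div mulrAC ler_pdivlMr//.
  by move=> H; exfalso; nra.
have {a_neq0} a_gt0 : 0 < a by rewrite lt_def a_neq0.
have := h (x / a) (divr_gt0 x0 a_gt0).
rewrite divfK ?gt_eqF// invf_div -lerBlDl (_ : 2 * x - x = x); last by ring.
by rewrite mulrAC ler_pdivlMr// expr2.
Qed.

Lemma normal_pdf1E (m x : R) :
  normal_pdf m 1 x = normal_peak 1 * expR (- (x - m) ^+ 2 / 2).
Proof. by rewrite normal_pdfE ?oner_eq0// /normal_fun expr1n. Qed.

Lemma measurable_addl (a : R) : measurable_fun setT
  ((fun y => a + y) : measurableTypeR R -> measurableTypeR R).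
Proof. by apply: measurable_funD => //; exact: measurable_cst. Qed.

Lemma Ex_EFin d (T : measurableType d) (P : probability T R) f : bm f ->
  (Ex P f)%:E = (\int[P]_x (f x)%:E)%E.
Proof.
move=> bf; rewrite /Ex /Rintegral fineK//.
by apply: integrable_fin_num => //; exact: (bm_integrable P bf).
Qed.

(** The chi-square bound for a shifted Gaussian, in the form required by [amgm_sqrt]. If [n0], [n1],
    [n2] are the densities centred at [0], [a], [2 a], then [n1^2 / n0 = exp(a^2) n2], whose
    integral is [exp(a^2)]. *)
Lemma Ex_normal_shift (f : measurableTypeR R -> R) (a l : R) : test f -> 0 < l ->
  2 * Ex N01 (fun y => f (a + y)) <=
  l * Ex N01 (fun y => f y ^+ 2) + l^-1 * expR (a ^+ 2).
Proof.
move=> tf l0; have [mf f01] := tf.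
have f0 x : 0 <= f x by case/andP: (f01 x).
have tfa : test (fun y => f (a + y)) by exact: (test_comp (measurable_addl a) tf).
have tf2 := test_sqr tf.
have mpdf m : measurable_fun setT (normal_pdf m 1 : measurableTypeR R -> R).
  exact: measurable_normal_pdf.
have pdf0 m x : 0 <= normal_pdf m 1 x :> R by exact: normal_pdf_ge0.
rewrite -lee_fin EFinD !EFinM !Ex_EFin; [|exact: test_bm..].
rewrite !(@ge0_integral_density _ _ _ mu N01 (normal_pdf 0 1))//; first last.
- by move=> x; rewrite lee_fin.
- by apply/measurable_EFinP; case: tfa.
- by move=> x; rewrite lee_fin sqr_ge0.
- by apply/measurable_EFinP; case: tf2.
have -> : (\int[mu]_x ((f (a + x))%:E * (normal_pdf 0 1 x)%:E) =
           \int[mu]_x ((f x)%:E * (normal_pdf a 1 x)%:E))%E.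
  rewrite -[RHS](ge0_integral_shift a); last 2 first.
  - by apply: emeasurable_funM; exact/measurable_EFinP.
  - by move=> x; rewrite mule_ge0 ?lee_fin.
  apply: eq_integral => x _; rewrite (addrC x a); congr (_ * _%:E)%E.
  by rewrite !normal_pdf1E (_ : a + x - a = x - 0)//; ring.
have mpE m : measurable_fun setT (EFin \o (normal_pdf m 1 : measurableTypeR R -> R)).
  exact/measurable_EFinP.
have mfE : measurable_fun setT (EFin \o f) by exact/measurable_EFinP.
have mf2E : measurable_fun setT (EFin \o (fun y => f y ^+ 2)).
  by apply/measurable_EFinP; case: tf2.
have p0E m x : (0 <= (EFin \o (normal_pdf m 1 : measurableTypeR R -> R)) x)%E.
  by rewrite lee_fin.
have c0 : (0 <= (l^-1 * expR (a ^+ 2))%:E)%E.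
  by rewrite lee_fin mulr_ge0 ?expR_ge0// invr_ge0 ltW.
have l0E : (0 <= l%:E)%E by rewrite lee_fin ltW.
have two0 : (0 <= (2 : R)%:E)%E by rewrite lee_fin.
have m1 := emeasurable_funM mfE (mpE a); have m2 := emeasurable_funM mf2E (mpE 0).
have h1 x : (0 <= (f x)%:E * (normal_pdf a 1 x)%:E)%E by rewrite mule_ge0 ?lee_fin.
have h2 x : (0 <= (f x ^+ 2)%:E * (normal_pdf 0 1 x)%:E)%E.
  by rewrite mule_ge0 ?lee_fin ?sqr_ge0.
have -> : (l^-1%:E * (expR (a ^+ 2))%:E =
    \int[mu]_x ((l^-1 * expR (a ^+ 2))%:E * (normal_pdf (2 * a) 1 x)%:E))%E.
  rewrite (ge0_integralZl _ measurableT (mpE (2 * a)) (fun x _ => p0E (2 * a) x) c0).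
  by rewrite integral_normal_pdf mule1 EFinM.
rewrite -(ge0_integralZl _ measurableT m1 (fun x _ => h1 x) two0).
rewrite -(ge0_integralZl _ measurableT m2 (fun x _ => h2 x) l0E).
have m3 := measurable_funeM l%:E m2.
have m4 := measurable_funeM (l^-1 * expR (a ^+ 2))%:E (mpE (2 * a)).
have h3 x : (0 <= l%:E * ((f x ^+ 2)%:E * (normal_pdf 0 1 x)%:E))%E.
  by rewrite mule_ge0.
have h4 x : (0 <= (l^-1 * expR (a ^+ 2))%:E * (normal_pdf (2 * a) 1 x)%:E)%E.
  by rewrite mule_ge0// lee_fin.
rewrite -(ge0_integralD _ measurableT (fun x _ => h3 x) m3 (fun x _ => h4 x) m4).
apply: ge0_le_integral => //.
- by move=> x _; exact: (mule_ge0 two0 (h1 x)).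
- exact: (measurable_funeM _ m1).
- exact: (emeasurable_funD m3 m4).
move=> x _; rewrite -!EFinM -EFinD lee_fin.
set n0 := normal_pdf 0 1 x; set n1 := normal_pdf a 1 x; set n2 := normal_pdf (2 * a) 1 x.
have nE : n1 ^+ 2 = expR (a ^+ 2) * (n0 * n2).
  rewrite /n0 /n1 /n2 !normal_pdf1E exprMn -expRM_natl mulrACA -expRD.
  rewrite [RHS]mulrCA -expRD -expr2; congr (_ * expR _).
  by rewrite -mulr_natl; field.
(* AM-GM: [2 f n1 <= l f^2 n0 + l^-1 n1^2 / n0] *)
have n00 : 0 < n0 by rewrite /n0 normal_pdf1E mulr_gt0 ?expR_gt0// normal_peak_gt0 ?oner_eq0.
rewrite -subr_ge0.
have -> : l * (f x ^+ 2 * n0) + l^-1 * expR (a ^+ 2) * n2 - 2 * (f x * n1) =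
    (l * n0)^-1 * (l * f x * n0 - n1) ^+ 2.
  rewrite sqrrB nE; field; by rewrite !gt_eqF.
by rewrite mulr_ge0 ?sqr_ge0// invr_ge0 mulr_ge0 ?ltW.
Qed.

Lemma expR_le_1D2x (s : R) : 0 <= s -> s <= 2^-1 -> expR s <= 1 + 2 * s.
Proof.
move=> s0 s1; have := expR_ge1Dx (- s); rewrite expRN => h.
have e0 := expR_gt0 s.
have : (1 - s) * expR s <= 1 by rewrite -ler_pdivlMr// div1r.
nra.
Qed.

Lemma Ex_normal_shift_tv (f : measurableTypeR R -> R) (a : R) : test f ->
  `|a| <= 2^-1 -> Ex N01 (fun y => f (a + y)) <= Ex N01 f + 2 * `|a|.
Proof.
move=> tf a1; have [a0|a_neq0] := eqVneq a 0.
  rewrite a0 normr0 mulr0 addr0 le_eqVlt; apply/orP; left; apply/eqP.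
  by congr Ex; apply/funext => y; rewrite add0r.
pose t : R := `|a|; rewrite -/t in a1 *; have t0 : 0 < t by rewrite normr_gt0.
have t1 : t <= 1 by apply: (le_trans a1); lra.
have [mf f01] := tf.
have bf := test_bm tf.
(* A total variation bound is drawn from the chi-square bound by perturbing the constant test [1/2].
   With [l = 2] the terms of order 0 cancel, and division by [t] leaves the claim. *)
pose g (y : measurableTypeR R) := 2^-1 + 2^-1 * t * f y.
have tg : test g.
  split; first by have [] := bmD (@bm_cst _ _ _ 2^-1) (bmZ (2^-1 * t) bf).
  move=> y; have /andP[fy0 fy1] := f01 y; rewrite /g.
  have : t * f y <= 1 by rewrite mulr_ile1// ltW.
  have : 0 <= t * f y by rewrite mulr_ge0// ltW.
  lra.
have := Ex_normal_shift a tg (ltr0Sn _ 1).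
have bfa : bm (fun y => f (a + y)) by exact: (bm_comp (measurable_addl a) bf).
rewrite /g ExD; [|exact: bm_cst|exact: bmZ].
rewrite Ex_cst ExZ//.
have : Ex N01 (fun y => (2^-1 + 2^-1 * t * f y) ^+ 2) <=
    4^-1 + 2^-1 * t * Ex N01 f + 4^-1 * t ^+ 2.
  pose h (y : measurableTypeR R) := 4^-1 + 4^-1 * t ^+ 2 + 2^-1 * t * f y.
  have bh : bm h by apply: bmD; [exact: bm_cst|exact: bmZ].
  have Eh : Ex N01 h = 4^-1 + 4^-1 * t ^+ 2 + 2^-1 * t * Ex N01 f.
    by rewrite ExD ?Ex_cst ?ExZ//; [exact: bm_cst|exact: bmZ].
  rewrite addrAC -Eh; apply: le_Ex => //.
    exact/bmX/(test_bm tg).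
  move=> y; have /andP[fy0 fy1] := f01 y.
  have : 4^-1 * t ^+ 2 * f y ^+ 2 <= 4^-1 * t ^+ 2.
    apply: ler_piMr; last exact: exprn_ile1.
    by apply: mulr_ge0; [lra | exact: sqr_ge0].
  by rewrite /h sqrrD !exprMn; lra.
have ea : expR (a ^+ 2) <= 1 + 2 * t ^+ 2.
  rewrite -(real_normK (num_real a)) -/t; apply: expR_le_1D2x; first exact: sqr_ge0.
  by rewrite (le_trans _ a1)// expr2; apply: ler_piMl => //; exact: ltW.
move: ea.
set e := expR _; set q := Ex N01 (fun y => _ ^+ 2).
set v := Ex N01 f; set w := Ex N01 (fun y => f (a + y)).
move=> h1 h2 h3; have t2 := sqr_ge0 t.
have : t * w <= t * (v + 2 * t) by lra.
by rewrite ler_pM2l.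
Qed.

Lemma Ex_uniform_ge0 (f : measurableTypeR R -> R) : bm f -> (forall x, 0 <= f x) ->
  Ex U01 f = \int[mu]_(x in unit_interval) f x.
Proof.
move=> bf f0; rewrite /Ex /Rintegral integral_uniform/=.
- by rewrite subr0 invr1 mul1e.
- by apply/measurable_EFinP; case: bf.
- by move=> x; rewrite lee_fin.
Qed.

Lemma unit_intervalP (x : R) : unit_interval x = (0 <= x <= 1) :> Prop.
Proof. by rewrite /unit_interval/= in_itv. Qed.

(** [Ex_uniform_ge0] is for nonnegative functions, whence the addition of the constants [M] and
    [L]. *)
Lemma Ex_uniform_eq (f g : measurableTypeR R -> R) : bm f -> bm g ->
  (forall x, 0 <= x <= 1 -> f x = g x) -> Ex U01 f = Ex U01 g.
Proof.
move=> bf bg fg.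
have pos (h : measurableTypeR R -> R) : bm h -> exists2 M, 0 <= M & forall x, 0 <= h x + M.
  move=> [_ [M hM]]; exists M; first by exact: le_trans (hM point).
  by move=> x; have := hM x; rewrite ler_norml => /andP[]; lra.
have [M M0 fM] := pos f bf; have [L L0 gL] := pos g bg.
have E (h : measurableTypeR R -> R) c : bm h -> Ex U01 (fun x => h x + c) = Ex U01 h + c.
  by move=> bh; rewrite ExD ?Ex_cst//; exact: bm_cst.
apply: (addIr (M + L)); rewrite -!E//.
rewrite !Ex_uniform_ge0.
- by apply: eq_Rintegral => x; rewrite inE unit_intervalP => /fg ->.
- by apply: bmD => //; exact: bm_cst.
- by move=> x; have := gL x; lra.
- by apply: bmD => //; exact: bm_cst.
- by move=> x; have := fM x; lra.
Qed.

(** Privacy constrains a mechanism only on design points in [[0,1]]. Clamping the design points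
    first makes it private on all samples, as [hybrid_dp] requires, and leaves the law of the data
    unchanged. *)
Definition clamp_obs (u : obs R) : obs R := (u.1, Num.max 0 (Num.min 1 u.2)).

Lemma measurable_clamp_obs : measurable_fun setT clamp_obs.
Proof.
apply/measurable_fun_pairP; split; first exact: measurable_fst.
apply: measurable_maxr; first exact: measurable_cst.
by apply: measurable_minr; [exact: measurable_cst | exact: measurable_snd].
Qed.

Section law.
Variable f : {mfun measurableTypeR R >-> measurableTypeR R}.

Lemma Ex_obs_law g : bm g ->
  Ex (obs_law f) g = Ex U01 (fun x => Ex N01 (fun y => g (f x + y, x))).
Proof.
move=> bg; rewrite Ex_distribution// Ex_prod//.
by apply: (bm_comp (g := regression_map f)) => //; exact: measurable_regression_map.
Qed.

Lemma bm_obs_section g : bm g -> bm (fun x => Ex N01 (fun y => g (f x + y, x))).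
Proof.
move=> bg; apply: (bm_Ex_pair U01 N01 (f := g \o regression_map f)).
by apply: bm_comp => //; exact: measurable_regression_map.
Qed.

Lemma Ex_obs_law_clamp g : bm g -> Ex (obs_law f) (g \o clamp_obs) = Ex (obs_law f) g.
Proof.
move=> bg; have bgc := bm_comp measurable_clamp_obs bg.
rewrite (Ex_obs_law bgc) (Ex_obs_law bg); apply: Ex_uniform_eq.
- exact: bm_obs_section.
- exact: bm_obs_section.
- move=> x /andP[x0 x1]; congr Ex; apply/funext => y.
  by rewrite /= /clamp_obs/= min_r// max_r.
Qed.

End law.
End model.

(** * Closeness of observations and of private transcripts *)

Section lower_model.
Context {R : realType}.
Local Notation mu := (@lebesgue_measure R).
Local Notation N01 := (normal_prob (0 : R) (1 : R)).
Local Notation U01 := (uniform_prob (@ltr01 R)).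

Definition map_tuple_fun d (T : measurableType d) (g : T -> T) n
  (t : n.-tuple T) : n.-tuple T := [tuple g (tnth t i) | i < n].

Lemma measurable_map_tuple d (T : measurableType d) (g : T -> T) n :
  measurable_fun setT g -> measurable_fun setT (@map_tuple_fun d T g n).
Proof.
move=> mg; apply/measurable_fun_tnthP => i.
rewrite (_ : _ \o _ = g \o (@tnth n T ^~ i)).
  by apply: measurableT_comp => //; exact: measurable_tnth.
by apply/funext => t /=; rewrite tnth_mktuple.
Qed.

Lemma Ex_product_law_map d (T : measurableType d) (P : probability T R) (g : T -> T)
    n (f : n.-tuple T -> R) : measurable_fun setT g ->
  (forall h, bm h -> Ex P (h \o g) = Ex P h) -> bm f ->
  Ex (product_law (fun _ : 'I_n => P)) (f \o map_tuple_fun g (n := n)) =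
  Ex (product_law (fun _ : 'I_n => P)) f.
Proof.
move=> mg Pg; elim: n f => [|n IH] f bf.
  by congr Ex; apply/funext => t /=; congr f; rewrite [t]tuple0 [LHS]tuple0.
have bfg : bm (f \o map_tuple_fun g (n := n.+1)).
  by apply: bm_comp => //; exact: measurable_map_tuple.
rewrite (Ex_product_law _ bfg) (Ex_product_law _ bf).
have bc : bm (f \o @cons_pair _ T n).
  by apply: bm_comp => //; exact: measurable_cons_pair.
rewrite -[RHS]Pg; last exact: (bm_Ex_pair P _ bc).
congr Ex; apply/funext => x /=.
rewrite -[RHS]IH; last exact: (bm_pair1 (g x) bc).
congr Ex; apply/funext => t /=; congr f; apply: eq_from_tnth => i.
rewrite tnth_mktuple; case: (unliftP ord0 i) => [j ->|->]; last first.
  by rewrite !tnth0.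
by rewrite !tnthS tnth_mktuple.
Qed.

Section dp.
Context d (T : measurableType d) (n : nat) (eps delta : R).
Variable K : R.-pker (n.-tuple (obs R)) ~> T.
Hypothesis Kdp : differentially_private K eps delta.

Definition clamped_output (A : set T) (z : n.-tuple (obs R)) : R :=
  Ex (kernel_at K (map_tuple_fun clamp_obs z)) (\1_A : T -> R).

Lemma test_clamped_output A : measurable A -> test (clamped_output A).
Proof.
move=> mA; exact: (test_comp (measurable_map_tuple (n := n) measurable_clamp_obs)
  (test_Ex_kernel K (test_indic mA))).
Qed.

Lemma clamped_output_dp A i z z' : measurable A -> agree_off i z z' ->
  clamped_output A z <= expR eps * clamped_output A z' + delta.
Proof.
move=> mA zz'.
have inS (t : n.-tuple (obs R)) : in_sample_space (map_tuple_fun clamp_obs t).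
  move=> j; rewrite tnth_mktuple /clamp_obs/=.
  by rewrite le_max lexx/= ge_max ler01 ge_min lexx.
have ham : (hamming (map_tuple_fun clamp_obs z) (map_tuple_fun clamp_obs z') <= 1)%N.
  rewrite /hamming -(cards1 i); apply: subset_leq_card.
  apply/fintype.subsetP => j; rewrite !finset.inE; apply: contraNT => ji.
  by rewrite !tnth_mktuple zz'.
have := Kdp mA (inS z) (inS z') ham.
rewrite /clamped_output !Ex_indic// -lee_fin EFinD EFinM !fineK//;
  exact: (fin_num_measure (kernel_at K _)).
Qed.

Lemma Ex_output_clamped (f : {mfun measurableTypeR R >-> measurableTypeR R}) A :
  measurable A ->
  Ex (output_law (sample_law f n) K) (\1_A : T -> R) =
  Ex (sample_law f n) (clamped_output A).
Proof.
move=> mA; rewrite Ex_output_law; last exact: test_indic.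
rewrite -[LHS](Ex_product_law_map (g := clamp_obs))//.
- exact: measurable_clamp_obs.
- by move=> h bh; exact: Ex_obs_law_clamp.
- exact/test_bm/test_Ex_kernel/test_indic.
Qed.

Lemma private_chi2 (f g : {mfun measurableTypeR R >-> measurableTypeR R}) p :
  0 <= p -> 0 <= eps -> 0 <= delta -> tv_le p (obs_law f) (obs_law g) ->
  let k := (1 + p * (expR eps - (expR eps)^-1)) ^+ n in
  chi2_le (1 + (k - 1) ^+ 2) (2 * (n%:R * (2 * p * delta) * k))
    (output_law (sample_law f n) K) (output_law (sample_law g n) K).
Proof.
move=> p0 e0 d0 fg k.
have e1 : 1 <= expR eps by rewrite -expR0 ler_expR.
have ei1 : (expR eps)^-1 <= 1 by rewrite invf_le1// (lt_le_trans ltr01 e1).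
have k1 : 1 <= k.
  by rewrite exprn_ege1// lerDl mulr_ge0// subr_ge0 (le_trans ei1).
apply: chi2_of_sets => //.
  by rewrite !mulr_ge0// (le_trans ler01).
move=> A mA; rewrite !Ex_output_clamped//.
have tA := test_clamped_output mA.
have Adp i z z' := @clamped_output_dp A i z z' mA.
have h1 := hybrid_dp p0 e1 d0 fg tA Adp.
have h2 := hybrid_dp p0 e1 d0 (tv_le_sym fg) tA Adp.
by split; [exact: h1 | exact: h2].
Qed.

End dp.

Section two_laws.
Variables f f0 : {mfun measurableTypeR R >-> measurableTypeR R}.
Hypothesis bf : bm (f : R -> R).
Hypothesis f00 : forall x, f0 x = 0.

Lemma Ex_obs_law0 (g : obs R -> R) : bm g ->
  Ex (obs_law f0) g = Ex U01 (fun x => Ex N01 (fun y => g (y, x))).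
Proof.
move=> bg; rewrite (Ex_obs_law f0 bg); congr Ex; apply/funext => x; congr Ex.
by apply/funext => y; rewrite f00 add0r.
Qed.

Lemma test_swap (g : obs R -> R) x : test g ->
  test (fun y : measurableTypeR R => g (y, x)).
Proof. by move=> tg; apply: (test_comp (f := g) (g := pair^~ x)). Qed.

(** Given [X = x] the two laws differ by a shift of [f x]. Averaging over the design is what brings
    in the width of a bump, besides its height. *)
Lemma tv_obs_law : (forall x, `|f x| <= 2^-1) ->
  tv_le (2 * Ex U01 (fun x => `|f x|)) (obs_law f) (obs_law f0).
Proof.
move=> f2 g tg; have bg := test_bm tg.
rewrite Ex_obs_law// Ex_obs_law0//.
have bnf : bm (fun x => `|f x|).
  split; first exact: (measurableT_comp (@normr_measurable _ setT) bf.1).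
  by exists 2^-1 => x; rewrite normr_id.
have b0 : bm (fun x => Ex N01 (fun y => g (y, x))).
  have := bm_obs_section f0 bg; congr bm; apply/funext => x; congr Ex.
  by apply/funext => y; rewrite f00 add0r.
rewrite -ExZ// -ExD//; last exact: bmZ.
apply: le_Ex => //; first exact: bm_obs_section.
  by apply: bmD => //; exact: bmZ.
by move=> x; apply: (Ex_normal_shift_tv (f := fun y => g (y, x))) => //; exact: test_swap.
Qed.

Lemma bm_expR_sqr : bm (fun x => expR (f x ^+ 2)).
Proof.
split; first exact: (measurableT_comp (@measurable_expR _) (bmX 2 bf).1).
have [_ [M fM]] := bf; exists (expR (M ^+ 2)) => x.
rewrite ger0_norm ?expR_ge0// ler_expR -(real_normK (num_real (f x))).
by rewrite lerXn2r ?nnegrE// (le_trans _ (fM x)).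
Qed.

Lemma chi2_obs_law k : Ex U01 (fun x => expR (f x ^+ 2)) <= k ->
  chi2_le k 0 (obs_law f) (obs_law f0).
Proof.
move=> Ek g tg; have bg := test_bm tg; have bg2 := test_bm (test_sqr tg).
have k0 : 0 <= k by apply: le_trans Ek; apply: Ex_ge0 => x; exact: expR_ge0.
rewrite addr0 mulrC; apply: amgm_sqrt => //.
  by apply: Ex_ge0 => x; exact: sqr_ge0.
move=> l l0; rewrite Ex_obs_law// Ex_obs_law0//.
apply: (@le_trans _ _ (l * Ex U01 (fun x => Ex N01 (fun y => g (y, x) ^+ 2)) +
    l^-1 * Ex U01 (fun x => expR (f x ^+ 2)))); last first.
  by rewrite lerD2l ler_wpM2l// invr_ge0 ltW.
have b0 : bm (fun x => Ex N01 (fun y => g (y, x) ^+ 2)).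
  have := bm_obs_section f0 bg2; congr bm; apply/funext => x; congr Ex.
  by apply/funext => y; rewrite f00 add0r.
have be := bm_expR_sqr.
have bs := bm_obs_section f bg.
rewrite -!ExZ// -ExD//; [|exact: bmZ..].
apply: le_Ex => //; first exact: bmZ.
  by apply: bmD; exact: bmZ.
by move=> x; apply: (Ex_normal_shift (f := fun y => g (y, x))) => //; exact: test_swap.
Qed.

End two_laws.
End lower_model.

(** * Le Cam's method *)

Section lower.
Context {R : realType}.
Local Notation mu := (@lebesgue_measure R).
Local Notation U01 := (uniform_prob (@ltr01 R)).

Lemma markov_Ex d (T : measurableType d) (P : probability T R) (g : T -> R)
    (B : set T) (c : R) : measurable_fun setT g -> (forall t, 0 <= g t) ->
  measurable B -> 0 <= c -> (forall t, B t -> c <= g t) ->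
  ((c * Ex P (\1_B : T -> R))%:E <= \int[P]_t (g t)%:E)%E.
Proof.
move=> mg g0 mB c0 cg.
have bB := test_bm (test_indic (R := R) mB).
rewrite -ExZ// Ex_EFin; last exact: bmZ.
apply: ge0_le_integral => //.
- by move=> t _; rewrite lee_fin mulr_ge0// indicE; case: (_ \in _).
- by apply/measurable_EFinP; case: (bmZ c bB).
- exact/measurable_EFinP.
- move=> t _; rewrite lee_fin indicE; case: (boolP (t \in B)) => /=.
    by rewrite inE mulr1 => /cg.
  by rewrite mulr0.
Qed.

(** An estimate is off by at least [|f x0| / 2] under [f0] on [B], and under [f] outside [B]. Either
    [f0] gives [B] probability at least [1/16], or [f] gives it at most
    [sqrt (3/16) + 1/4 < 3/4]. *)
Lemma le_cam m (n : 'I_m -> nat) (eps delta : 'I_m -> R)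
    (prot : protocol n eps delta) (x0 k e : R)
    (f f0 : {mfun measurableTypeR R >-> measurableTypeR R}) F :
  F f -> F f0 -> f0 x0 = 0 -> 0 <= k -> k <= 3 -> e <= 4^-1 ->
  chi2_le k e (transcript_law prot f) (transcript_law prot f0) ->
  (((f x0) ^+ 2 / 64)%:E <=
    ereal_sup [set pointwise_risk prot x0 f | f in F])%E.
Proof.
move=> Ff Ff0 f00 k0 k3 e4 chi.
set D := f x0.
pose est := fun t => @estimator R m n eps delta prot t x0.
have mest : measurable_fun setT est by exact: estimator_measurable.
pose B := [set t | `|D| / 2 <= `|est t|].
have mB : measurable B.
  have mn : measurable_fun setT (fun t => `|est t|).
    exact: (measurableT_comp (@normr_measurable _ setT) mest).
  rewrite -[X in measurable X]setTI.
  have := mn measurableT `[`|D| / 2, +oo[%classic (measurable_itv _).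
  congr (measurable (_ `&` _)); apply/seteqP.
  by split => x /=; rewrite in_itv/= andbT.
have msq (c : R) : measurable_fun setT (fun t => `|est t - c| ^+ 2).
  apply: measurable_funX; apply: (measurableT_comp (@normr_measurable _ setT)).
  by apply: measurable_funB => //; exact: measurable_cst.
have D4 : 0 <= D ^+ 2 / 4 by rewrite divr_ge0// sqr_ge0.
have DE : D ^+ 2 / 4 = (`|D| / 2) ^+ 2.
  by rewrite exprMn real_normK ?num_real//; field.
have R0 : (((D ^+ 2 / 4) * Ex (transcript_law prot f0) (\1_B : _ -> R))%:E <=
    pointwise_risk prot x0 f0)%E.
  apply: (markov_Ex _ (msq (f0 x0)) (fun t => sqr_ge0 _) mB D4) => t Bt.
  by rewrite f00 subr0 DE lerXn2r// nnegrE// divr_ge0.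
have R1 : (((D ^+ 2 / 4) * Ex (transcript_law prot f) (\1_(~` B) : _ -> R))%:E <=
    pointwise_risk prot x0 f)%E.
  apply: (markov_Ex _ (msq (f x0)) (fun t => sqr_ge0 _) (measurableC mB) D4) => t Bt.
  rewrite DE lerXn2r// ?nnegrE ?divr_ge0// -/D.
  have /negP := Bt; rewrite -ltNge => h.
  have := ler_normB (est t) (est t - D); rewrite opprB addrCA subrr addr0; lra.
have tB := test_indic (R := R) mB.
have q1 : Ex (transcript_law prot f) (\1_(~` B) : _ -> R) =
    1 - Ex (transcript_law prot f) (\1_B : _ -> R).
  rewrite -[X in X - _](Ex_cst (transcript_law prot f)) -ExB; last 2 first.
  - exact: bm_cst.
  - exact: test_bm.
  congr Ex; apply/funext => t; rewrite !indicE in_setC.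
  by case: (t \in B); rewrite /= ?subrr ?subr0.
have := chi _ tB.
rewrite (_ : (fun t => (\1_B t : R) ^+ 2) = (\1_B : _ -> R)); last first.
  by apply/funext => t; rewrite indicE; case: (t \in B); rewrite ?expr1n ?expr0n.
have /andP[q00 q01] := Ex_test (transcript_law prot f0) tB.
set q0 := Ex (transcript_law prot f0) (\1_B : _ -> R) in R0 q00 q01 *.
set q := Ex (transcript_law prot f) (\1_B : _ -> R) in q1 *.
move=> qle.
have [q16|q16] := leP 16^-1 q0.
  apply: (@le_trans _ _ (pointwise_risk prot x0 f0)); last first.
    by apply: ereal_sup_ubound; exists f0.
  apply: le_trans R0; rewrite lee_fin (_ : _ / 64 = D ^+ 2 / 4 * 16^-1); last by field.
  by rewrite ler_wpM2l.
apply: (@le_trans _ _ (pointwise_risk prot x0 f)); last first.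
  by apply: ereal_sup_ubound; exists f.
apply: le_trans R1; rewrite lee_fin (_ : _ / 64 = D ^+ 2 / 4 * 16^-1); last by field.
rewrite ler_wpM2l// q1.
have : Num.sqrt (k * q0) <= 2^-1.
  rewrite -[leRHS]ger0_norm// -sqrtr_sqr ler_wsqrtr//.
  have : k * q0 <= 3 * q0 by rewrite ler_wpM2r.
  have : (2^-1 : R) ^+ 2 = 4^-1 by field.
  lra.
lra.
Qed.

Lemma expR_leD1 (x y : R) : 0 <= y -> y <= 2^-1 -> x <= expR y -> x <= 2.
Proof.
move=> y0 y1 /le_trans; apply; apply: (le_trans (expR_le_1D2x y0 y1)); lra.
Qed.

Lemma expr1D_le_expR (x : R) n : 0 <= x -> (1 + x) ^+ n <= expR (n%:R * x).
Proof.
move=> x0; rewrite expRM_natl lerXn2r ?nnegrE ?expR_ge0 ?expR_ge1Dx//.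
by rewrite addr_ge0.
Qed.

Section bump.
Variables (x0 h w : R) (f f0 : {mfun measurableTypeR R >-> measurableTypeR R}).
Variable F : set {mfun measurableTypeR R >-> measurableTypeR R}.
Hypotheses (Ff : F f) (Ff0 : F f0) (f00 : forall x, f0 x = 0).
Hypotheses (h0 : 0 <= h) (h2 : h <= 2^-1) (w0 : 0 <= w).
Hypotheses (fh : forall x, `|f x| <= h) (fw : forall x, w < `|x - x0| -> f x = 0).

Let I := (`[x0 - w, x0 + w]%classic : set (measurableTypeR R)).

Let Ex_I : Ex U01 (\1_I : R -> R) <= 2 * w.
Proof.
rewrite Ex_indic//; last exact: measurable_itv.
have muI : mu I = (2 * w)%:E.
  rewrite lebesgue_measure_itv/= lte_fin; case: ifPn => [_|].
    by rewrite -EFinB; congr EFin; ring.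
  by rewrite -leNgt => ww; congr EFin; apply/eqP; rewrite eq_le; apply/andP; split; move: ww w0; lra.
rewrite -lee_fin fineK; last by apply: fin_num_measure; exact: measurable_itv.
rewrite -muI -[X in (_ <= X)%E]mul1e -integral_cst; last exact: measurable_itv.
rewrite /uniform_prob; apply: ge0_le_integral => //.
- exact: measurable_itv.
- by move=> x _; rewrite lee_fin uniform_pdf_ge0.
- by apply/measurable_EFinP/measurable_funTS; exact: measurable_uniform_pdf.
- move=> x _; rewrite lee_fin /uniform_pdf subr0 invr1.
  by case: ifP => // _; exact: ler01.
Qed.

Let out x : x \notin I -> f x = 0.
Proof.
move=> xI; apply: fw; rewrite ltNge; apply: contra xI.
by rewrite ler_distl inE /I/= in_itv/= => /andP[-> ->].
Qed.

Let bf : bm (f : R -> R).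
Proof. by split; [exact: (measurable_funPT f) | exists h]. Qed.

Let bI : bm (\1_I : R -> R).
Proof. by apply/test_bm/test_indic; exact: measurable_itv. Qed.

Lemma Ex_bump_norm : Ex U01 (fun x => `|f x|) <= 2 * h * w.
Proof.
apply: (@le_trans _ _ (Ex U01 (fun x => h * \1_I x))).
  apply: le_Ex.
  - split; first exact: (measurableT_comp (@normr_measurable _ setT) bf.1).
    by exists h => x; rewrite normr_id.
  - exact: bmZ.
  - move=> x; rewrite indicE; case: (boolP (x \in I)) => xI; first by rewrite mulr1.
    by rewrite out// normr0 mulr0.
by rewrite ExZ// (_ : 2 * h * w = h * (2 * w)) ?ler_wpM2l//; ring.
Qed.

Lemma Ex_bump_exp : Ex U01 (fun x => expR (f x ^+ 2)) <= 1 + 4 * h ^+ 2 * w.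
Proof.
apply: (@le_trans _ _ (Ex U01 (fun x => 1 + 2 * h ^+ 2 * \1_I x))).
  apply: le_Ex.
  - exact: bm_expR_sqr.
  - by apply: bmD; [exact: bm_cst | exact: bmZ].
  - move=> x; rewrite indicE; case: (boolP (x \in I)) => xI.
      have fx2 : f x ^+ 2 <= h ^+ 2.
        by rewrite -(real_normK (num_real (f x))) lerXn2r// nnegrE.
      rewrite mulr1; apply: (@le_trans _ _ (1 + 2 * f x ^+ 2)); last first.
        by rewrite lerD2l ler_wpM2l.
      apply: expR_le_1D2x; first exact: sqr_ge0.
      rewrite (le_trans fx2)// expr2 (le_trans _ h2)// ler_piMl// (le_trans h2)//.
      lra.
    by rewrite out// expr0n/= expR0 mulr0 addr0.
rewrite ExD ?Ex_cst ?ExZ//; [|exact: bm_cst|exact: bmZ].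
rewrite lerD2l (_ : 4 * h ^+ 2 * w = 2 * h ^+ 2 * (2 * w)); last by ring.
by rewrite ler_wpM2l// mulr_ge0// sqr_ge0.
Qed.

(** By data processing the chi-square bound for the [m n] observations holds for the transcripts,
    and [(1 + c) ^+ (n * m)] is at most 2. *)
Lemma lower_nonprivate m n (eps delta : 'I_m -> R) :
  m%:R * n%:R * (4 * h ^+ 2 * w) <= 2^-1 ->
  ((f x0 ^+ 2 / 64)%:E <= minimax_risk (fun _ : 'I_m => n) eps delta x0 F)%E.
Proof.
move=> small; apply/ereal_infP => _ [prot ->].
set c := 4 * h ^+ 2 * w in small.
have c0 : 0 <= c by rewrite !mulr_ge0// sqr_ge0.
have chi1 := chi2_obs_law bf f00 Ex_bump_exp; rewrite -/c in chi1.
have c1 : 1 <= 1 + c by rewrite lerDl.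
have chin := chi2_product_law (m := n) c1 (lexx 0) (fun=> chi1).
rewrite mulr0 mul0r in chin.
have c1n : 1 <= (1 + c) ^+ n by rewrite exprn_ege1.
have chim := chi2_product_law (m := m) c1n (lexx 0)
  (fun j => chi2_output_law (mechanism prot j) (le_trans ler01 c1n) chin).
rewrite mulr0 mul0r -exprM in chim.
apply: (le_cam Ff Ff0 (f00 x0) _ _ _ chim) => //.
- by rewrite exprn_ge0// (le_trans ler01 c1).
- apply: (@le_trans _ _ 2); last by rewrite ler_nat.
  apply: (expR_leD1 _ small); first by rewrite !mulr_ge0.
  apply: (le_trans (expr1D_le_expR _ c0)).
  by rewrite ler_expR natrM (mulrC n%:R).
Qed.

(** With [y = n K eps], the probabilities of events of one transcript agree up to a factor
    [k <= 1 + 2 y] and an error due to [delta]. The quadratic gain of [chi2_of_sets] gives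
    [1 + 4 y ^+ 2] per server, and the [m]-th power of this is at most 2. *)
Lemma lower_private m n (eps delta Ceps : R) : 0 < eps <= Ceps -> 0 <= delta ->
  let K := 4 * h * w * (expR Ceps + 1) in
  n%:R * K * eps <= 2^-1 -> m%:R * (n%:R * K * eps) ^+ 2 <= 8^-1 ->
  h * w <= 1 -> m%:R * n%:R * delta <= 512^-1 ->
  ((f x0 ^+ 2 / 64)%:E <= minimax_risk (fun _ : 'I_m => n)
     (fun=> eps) (fun=> delta) x0 F)%E.
Proof.
move=> /andP[e0 eC] d0 K nK mK hw1 md; apply/ereal_infP => _ [prot ->].
pose p := 4 * h * w.
have p0 : 0 <= p by rewrite !mulr_ge0.
have tv : tv_le p (obs_law f) (obs_law f0).
  move=> g tg; have := tv_obs_law bf f00 (fun x => le_trans (fh x) h2) tg.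
  move/le_trans; apply; rewrite lerD2l /p.
  have := Ex_bump_norm; lra.
have chi1 (j : 'I_m) := private_chi2 (@mechanism_dp _ _ _ _ _ prot j) p0 (ltW e0) d0 tv.
cbv zeta in chi1.
set k := (1 + p * (expR eps - (expR eps)^-1)) ^+ n in chi1.
have e1 : 1 <= expR eps by rewrite -expR0 ler_expR ltW.
have ei1 : (expR eps)^-1 <= 1 by rewrite invf_le1// (lt_le_trans ltr01 e1).
(* Convexity gives [exp(eps) - 1 <= eps exp(eps)] and [1 - exp(-eps) <= eps]; this is the only place
   where [eps <= Ceps] enters. *)
have sinh : expR eps - (expR eps)^-1 <= eps * (expR Ceps + 1).
  have h1 := expR_ge1Dx (- eps); rewrite expRN in h1.
  have h3 : (1 - eps) * expR eps <= 1.
    by rewrite -ler_pdivlMr ?expR_gt0// div1r.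
  have h4 : eps * expR eps <= eps * expR Ceps by rewrite ler_pM2l// ler_expR.
  lra.
have sinh0 : 0 <= expR eps - (expR eps)^-1 by rewrite subr_ge0 (le_trans ei1).
set y := n%:R * K * eps in nK mK.
have y0 : 0 <= y.
  by rewrite /y /K !mulr_ge0// ?(ltW e0)// addr_ge0 ?expR_ge0.
have k1 : 1 <= k by rewrite exprn_ege1// lerDl mulr_ge0.
have ky : k <= 1 + 2 * y.
  apply: le_trans (expR_le_1D2x y0 nK).
  apply: (le_trans (expr1D_le_expR _ (mulr_ge0 p0 sinh0))).
  rewrite ler_expR /y -mulrA ler_wpM2l// /K -/p -mulrA ler_wpM2l//.
  by rewrite mulrC.
have k2 : k <= 2 by apply: (le_trans ky); lra.
pose c := (k - 1) ^+ 2.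
have c0 : 0 <= c by exact: sqr_ge0.
have cy : c <= 4 * y ^+ 2.
  rewrite (_ : 4 * y ^+ 2 = (2 * y) ^+ 2); last by ring.
  apply: lerXn2r.
  - by rewrite nnegrE subr_ge0.
  - by rewrite nnegrE mulr_ge0.
  - by move: ky; lra.
pose e := 2 * (n%:R * (2 * p * delta) * k).
have e00 : 0 <= e by rewrite /e !mulr_ge0// (le_trans ler01).
have c1 : 1 <= 1 + c by rewrite lerDl.
have chim := chi2_product_law (m := m) c1 e00 chi1.
have pw : (1 + c) ^+ m <= 2.
  apply: (@expR_leD1 _ (m%:R * c)); first exact: (mulr_ge0 (ler0n R m) c0).
    apply: (@le_trans _ _ (m%:R * (4 * y ^+ 2))); first exact: (ler_wpM2l (ler0n R m) cy).
    by rewrite mulrCA; lra.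
  exact: expr1D_le_expR.
apply: (le_cam Ff Ff0 (f00 x0) _ _ _ chim) => //.
- by rewrite exprn_ge0// addr_ge0.
- by rewrite (le_trans pw)// ler_nat.
- have sq : Num.sqrt (1 + c) ^+ m <= 2.
    apply: le_trans pw; rewrite lerXn2r ?nnegrE ?sqrtr_ge0 ?addr_ge0//.
    rewrite -[leRHS]sqr_sqrtr ?addr_ge0// expr2 ler_peMl ?sqrtr_ge0//.
    by rewrite -[leLHS]sqrtr1 ler_wsqrtr.
  have p4 : p <= 4 by rewrite /p -!mulrA ler_piMr.
  have sq0 : 0 <= Num.sqrt (1 + c) ^+ m by rewrite exprn_ge0// sqrtr_ge0.
  apply: (@le_trans _ _ (m%:R * e * 2)).
    by rewrite ler_wpM2l// mulr_ge0.
  (* The last factor is at most [8 * (4 * 2) = 64], so that [m n delta <= 1/512] leaves an error of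
     at most [1/8], within the [1/4] allowed by [le_cam]. *)
  have -> : m%:R * e * 2 = (m%:R * n%:R * delta) * (8 * (p * k)).
    by rewrite /e; ring.
  apply: (@le_trans _ _ (512^-1 * (8 * (4 * 2)))); last by lra.
  rewrite ler_pM// ?mulr_ge0// ?(le_trans ler01 k1)//.
  by rewrite ler_wpM2l// ler_pM// (le_trans ler01 k1).
Qed.

End bump.
End lower.

(** * Wavelets on the unit interval *)

Section unit_interval_functions.
Context {R : realType}.
Local Notation mu := (@lebesgue_measure R).
Implicit Types f g h : R -> R.

Definition c01 f := {within [set` `[(0 : R), 1]], continuous f}.

Lemma c01_cst (c : R) : c01 (fun=> c).
Proof. by apply: continuous_subspaceT => x; exact: cst_continuous. Qed.

Lemma c01_continuous f : continuous f -> c01 f.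
Proof. exact: continuous_subspaceT. Qed.

Lemma c01D f g : c01 f -> c01 g -> c01 (fun x => f x + g x).
Proof. by move=> cf cg x; apply: cvgD; [exact: cf | exact: cg]. Qed.

Lemma c01M f g : c01 f -> c01 g -> c01 (fun x => f x * g x).
Proof. by move=> cf cg x; apply: cvgM; [exact: cf | exact: cg]. Qed.

Lemma c01Z (c : R) f : c01 f -> c01 (fun x => c * f x).
Proof. by move=> cf; apply: c01M => //; exact: c01_cst. Qed.

Lemma c01B f g : c01 f -> c01 g -> c01 (fun x => f x - g x).
Proof. by move=> cf cg x; apply: cvgB; [exact: cf | exact: cg]. Qed.

Lemma c01_sum (I : Type) (r : seq I) (F : I -> R -> R) :
  (forall i, c01 (F i)) -> c01 (fun x => \sum_(i <- r) F i x).
Proof.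
move=> cF; elim: r => [|i r IH].
  rewrite (_ : (fun x => _) = fun=> 0); first exact: c01_cst.
  by apply/funext => x; rewrite big_nil.
rewrite (_ : (fun x => _) = fun x => F i x + \sum_(i <- r) F i x).
  exact: c01D.
by apply/funext => x; rewrite big_cons.
Qed.

Lemma unit_intervalE (x : R) : (unit_interval x : Prop) = (0 <= x <= 1).
Proof. by rewrite /unit_interval/= in_itv. Qed.

Lemma measurable_unit_interval : measurable (@unit_interval R).
Proof. exact: measurable_itv. Qed.

Lemma mu_unit_interval : mu unit_interval = 1%E.
Proof. by rewrite /unit_interval lebesgue_measure_itv/= lte01 oppr0 adde0. Qed.

Lemma eq_c01 f g : (forall x, 0 <= x <= 1 -> f x = g x) -> c01 f -> c01 g.
Proof.
move=> fg; apply: subspace_eq_continuous => x; rewrite inE/= in_itv/= => /fg.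
by rewrite /from_subspace.
Qed.

Lemma c01_bounded f : c01 f -> exists M, forall x, 0 <= x <= 1 -> `|f x| <= M.
Proof.
move=> cf; have /compact_bounded[M [_ fM]] :=
  continuous_compact cf (@segment_compact R 0 1).
exists (`|M| + 1) => x x01; apply: (fM (`|M| + 1)).
  by rewrite (le_lt_trans (ler_norm M))// ltrDl.
by exists x => //=; rewrite in_itv.
Qed.

Lemma c01_integrable f : c01 f -> mu.-integrable unit_interval (EFin \o f).
Proof.
by move=> cf; apply: continuous_compact_integrable => //; exact: segment_compact.
Qed.

Definition int01 f : R := \int[mu]_(x in unit_interval) f x.

Lemma eq_int01 f g : (forall x, 0 <= x <= 1 -> f x = g x) -> int01 f = int01 g.
Proof. by move=> fg; apply: eq_Rintegral => x; rewrite inE unit_intervalE => /fg. Qed.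

Lemma int01D f g : c01 f -> c01 g -> int01 (fun x => f x + g x) = int01 f + int01 g.
Proof.
move=> cf cg; apply: RintegralD; first exact: measurable_unit_interval.
  exact: c01_integrable.
exact: c01_integrable.
Qed.

Lemma int01Z (c : R) f : c01 f -> int01 (fun x => c * f x) = c * int01 f.
Proof.
move=> cf; apply: RintegralZl; first exact: measurable_unit_interval.
exact: c01_integrable.
Qed.

Lemma int01_cst (c : R) : int01 (fun=> c) = c.
Proof.
rewrite /int01 Rintegral_cst; last exact: measurable_unit_interval.
by rewrite (_ : fine _ = 1) ?mulr1//; exact: (congr1 fine mu_unit_interval).
Qed.

Lemma int01_sum (I : Type) (r : seq I) (F : I -> R -> R) :
  (forall i, c01 (F i)) ->
  int01 (fun x => \sum_(i <- r) F i x) = \sum_(i <- r) int01 (F i).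
Proof.
move=> cF; elim: r => [|i r IH].
  rewrite big_nil -[RHS](int01_cst 0); apply: eq_int01 => x _.
  by rewrite big_nil.
rewrite big_cons -IH -int01D//; last exact: c01_sum.
by apply: eq_int01 => x _; rewrite big_cons.
Qed.

Lemma le_int01 f g : c01 f -> c01 g -> (forall x, 0 <= x <= 1 -> f x <= g x) ->
  int01 f <= int01 g.
Proof.
move=> cf cg fg; apply: le_Rintegral; first exact: measurable_unit_interval.
- exact: c01_integrable.
- exact: c01_integrable.
- by move=> x; rewrite unit_intervalE => /fg.
Qed.

Lemma int01_le_cst f (c : R) : c01 f -> (forall x, 0 <= x <= 1 -> f x <= c) ->
  int01 f <= c.
Proof. by move=> cf fc; rewrite -(int01_cst c); apply: le_int01 => //; exact: c01_cst. Qed.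

Lemma int01_norm_le f (c : R) : c01 f -> (forall x, 0 <= x <= 1 -> `|f x| <= c) ->
  `|int01 f| <= c.
Proof.
move=> cf fc; rewrite ler_norml; apply/andP; split.
  rewrite -(int01_cst (- c)); apply: le_int01 => //; first exact: c01_cst.
  by move=> x /fc; rewrite ler_norml => /andP[].
by apply: int01_le_cst => // x /fc; rewrite ler_norml => /andP[].
Qed.

Lemma inner01E f g : inner01 f g = int01 (fun x => f x * g x).
Proof. by []. Qed.

Lemma inner01C f g : inner01 f g = inner01 g f.
Proof. by apply: eq_int01 => x _; rewrite mulrC. Qed.

Lemma eq_inner01 f f' g g' : (forall x, 0 <= x <= 1 -> f x = f' x) ->
  (forall x, 0 <= x <= 1 -> g x = g' x) -> inner01 f g = inner01 f' g'.
Proof. by move=> ff gg; apply: eq_int01 => x x01; rewrite ff// gg. Qed.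

Lemma inner01Zl (c : R) f g : c01 f -> c01 g ->
  inner01 (fun x => c * f x) g = c * inner01 f g.
Proof.
move=> cf cg; rewrite !inner01E -int01Z; last exact: c01M.
by apply: eq_int01 => x _; rewrite mulrA.
Qed.

Lemma inner01Bl f f' g : c01 f -> c01 f' -> c01 g ->
  inner01 (fun x => f x - f' x) g = inner01 f g - inner01 f' g.
Proof.
move=> cf cf' cg; rewrite !inner01E -[- int01 _]mulN1r -int01Z; last exact: c01M.
rewrite -int01D; last 2 first.
- exact: c01M.
- by apply: c01Z; exact: c01M.
by apply: eq_int01 => x _; ring.
Qed.

Lemma inner01_suml (I : Type) (r : seq I) (F : I -> R -> R) g :
  (forall i, c01 (F i)) -> c01 g ->
  inner01 (fun x => \sum_(i <- r) F i x) g = \sum_(i <- r) inner01 (F i) g.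
Proof.
move=> cF cg; transitivity (int01 (fun x => \sum_(i <- r) F i x * g x)).
  by apply: eq_int01 => x _; rewrite mulr_suml.
by rewrite int01_sum// => i; exact: c01M.
Qed.

Lemma inner01_lin n (a : 'I_n -> R) (F : 'I_n -> R -> R) g :
  (forall i, c01 (F i)) -> c01 g ->
  inner01 (fun x => \sum_(i < n) a i * F i x) g = \sum_(i < n) a i * inner01 (F i) g.
Proof.
move=> cF cg; rewrite inner01_suml//; last by move=> i; exact: c01Z.
by apply: eq_bigr => i _; rewrite inner01Zl.
Qed.

Lemma inner01_ge0 f : 0 <= inner01 f f.
Proof. by apply: Rintegral_ge0 => x _; rewrite -expr2 sqr_ge0. Qed.

Lemma bessel n (F : 'I_n -> R -> R) f : (forall i, c01 (F i)) -> c01 f ->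
  (forall i j, inner01 (F i) (F j) = (i == j)%:R) ->
  \sum_(i < n) inner01 f (F i) ^+ 2 <= inner01 f f.
Proof.
move=> cF cf oF; set a := fun i => inner01 f (F i).
pose g x := \sum_(i < n) a i * F i x.
have cg : c01 g by apply: c01_sum => i; exact: c01Z.
have gF i : inner01 g (F i) = a i.
  rewrite inner01_lin// (bigD1 i)//= oF eqxx mulr1 big1 ?addr0// => j ji.
  by rewrite oF (negbTE ji) mulr0.
have gh h : c01 h -> inner01 g h = \sum_(i < n) a i * inner01 (F i) h.
  by move=> ch; rewrite inner01_lin.
have gf : inner01 g f = \sum_(i < n) a i ^+ 2.
  by rewrite gh//; apply: eq_bigr => i _; rewrite inner01C expr2.
have gg : inner01 g g = \sum_(i < n) a i ^+ 2.
  by rewrite gh//; apply: eq_bigr => i _; rewrite inner01C gF expr2.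
have := inner01_ge0 (fun x => f x - g x).
have cfg : c01 (fun x => f x - g x) by exact: c01B.
rewrite inner01Bl// inner01C [X in _ - X]inner01C !inner01Bl// (inner01C f g).
by rewrite gf gg subrr subr0 subr_ge0.
Qed.

Lemma inner01_unit_le1 f g : c01 f -> c01 g -> inner01 f f = 1 -> inner01 g g = 1 ->
  `|inner01 f g| <= 1.
Proof.
move=> cf cg f1 g1.
have := @bessel 1 (fun=> g) f (fun=> cg) cf.
rewrite big_ord1 f1 => H; rewrite -(ler_pXn2r (n := 2))// ?nnegrE//.
rewrite expr1n real_normK ?num_real//; apply: H => i j.
by rewrite g1 !ord1.
Qed.

End unit_interval_functions.

Section counting.
Context {R : realType}.

Lemma count_near n (a r : R) : 0 <= r ->
  \sum_(k < n) (`|k%:R - a| <= r)%R%:R <= 2 * r + 1 :> R.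
Proof.
move=> r0.
(* The first bound is what makes the induction work: it says that no index below [a - r] is counted,
   so that a new index, being at most [a + r], keeps the count within [2 r + 1]. *)
suff [] : \sum_(k < n) (`|k%:R - a| <= r)%R%:R <= Num.max 0 (n%:R - (a - r)) :> R /\
  \sum_(k < n) (`|k%:R - a| <= r)%R%:R <= 2 * r + 1 :> R by [].
elim: n => [|n [IH1 IH2]].
  by rewrite big_ord0 le_max lexx; split => //; lra.
rewrite big_ord_recr/=; case: (boolP (_ <= r)) => [|_]; last first.
  rewrite addr0; split=> //; rewrite (le_trans IH1)// ge_max le_max lexx/=.
  by rewrite le_max; apply/orP; right; rewrite -natr1; lra.
rewrite ler_distl => /andP[h1 h2].
have h3 : 0 <= n%:R - (a - r) by rewrite subr_ge0.
have h4 : n.+1%:R = n%:R + 1 :> R by rewrite -natr1.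
rewrite max_r// in IH1; rewrite max_r; last by rewrite h4; move: h1; clear; lra.
by rewrite h4 (_ : true%:R = 1)//; split; lra.
Qed.

Lemma sum_near_le n (a r c : R) (F : 'I_n -> R) : 0 <= r -> 0 <= c ->
  (forall k, `|F k| <= c) -> (forall k : 'I_n, r < `|k%:R - a| -> F k = 0) ->
  \sum_(k < n) `|F k| <= (2 * r + 1) * c.
Proof.
move=> r0 c0 Fc F0.
apply: (@le_trans _ _ (\sum_(k < n) (`|k%:R - a| <= r)%R%:R * c)).
  apply: ler_sum => k _; case: (leP `|k%:R - a| r) => h; first by rewrite mul1r.
  by rewrite F0// normr0 mul0r.
by rewrite -mulr_suml ler_wpM2r// count_near.
Qed.

End counting.

Section smooth_functions.
Context {R : realType}.

Lemma is_derive_eq0 (f : R -> R) (B x : R) : (forall x, B < `|x| -> f x = 0) ->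
  B < `|x| -> derive1 f x = 0.
Proof.
move=> f0 Bx; rewrite derive1E (near_eq_derive (g := cst 0)); last first.
  have op : open [set y : R | B < `|y|].
    apply: (open_comp (f := fun y : R => `|y|) (D := [set y | B < y])).
      by move=> y _; exact: norm_continuous.
    exact: open_gt.
  have : \forall y \near x, B < `|y| by exact: (open_nbhs_nbhs (conj op Bx)).
  by apply: filterS => y By; rewrite f0.
by rewrite derive_cst.
Qed.

(** Each derivative vanishes outside the support and is continuous, hence bounded, on a segment
    containing it. *)
Lemma of_class_C_smooth n (f : R -> R) (B : R) : of_class_C n f ->
  (forall x, B < `|x| -> f x = 0) -> exists M, smooth n M f.
Proof.
move=> [df cf] f0.
have fn0 i x : B < `|x| -> derive1n i f x = 0.
  elim: i x => [|i IH] x; first exact: f0.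
  by rewrite derive1nS; exact: is_derive_eq0.
have cn i : (i <= n)%N -> continuous (derive1n i f).
  rewrite leq_eqVlt => /orP[/eqP -> //|ilt] x.
  by apply/differentiable_continuous/derivable1_diffP; exact: df.
have bn i : (i <= n)%N -> exists M, forall x, `|derive1n i f x| <= M.
  move=> ile; have cs : {within `[- B, B], continuous (derive1n i f)}.
    by apply: continuous_subspaceT; exact: cn.
  have /compact_bounded[M [_ fM]] := continuous_compact cs (@segment_compact R (- B) B).
  exists (`|M| + 1) => x; have [xB|xB] := leP `|x| B; last by rewrite fn0// normr0 addr_ge0.
  apply: (fM (`|M| + 1)).
    by rewrite (le_lt_trans (ler_norm M))// ltrDl.
  by exists x => //=; rewrite in_itv/= -ler_norml.
have [M fM] : exists M, forall i, (i <= n)%N -> forall x, `|derive1n i f x| <= M.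
  have H k : (k <= n)%N -> exists M, forall i, (i <= k)%N -> forall x, `|derive1n i f x| <= M.
    elim: k => [_|k IH kn].
      have [M hM] := bn 0%N (leq0n n).
      by exists M => i; rewrite leqn0 => /eqP ->.
    have [M hM] := IH (ltnW kn); have [L hL] := bn _ kn.
    exists (Num.max M L) => i; rewrite leq_eqVlt => /orP[/eqP ->|ik] x.
      by rewrite le_max hL orbT.
    by rewrite le_max hM.
  exact: H.
exists M.
suff H k i : (i + k)%N = n -> smooth k M (derive1n i f) by exact: (H n 0%N).
elim: k i => [|k IH] i ikn.
  by split => // x; apply: fM; rewrite -ikn addn0.
split; first by move=> x; apply: fM; rewrite -ikn leq_addr.
exists (derive1n i.+1 f); split; last by apply: IH; rewrite addSnnS.
move=> x; rewrite derive1nS derive1E; apply: derivableP.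
by apply: df; rewrite -ikn addnS ltnS leq_addr.
Qed.

(** Makes the constants of the finitely many edge functions uniform. *)
Lemma ex_uniform_bound n (Q : nat -> R -> Prop) :
  (forall k M M', Q k M -> M <= M' -> Q k M') ->
  (forall k, (k < n)%N -> exists M, Q k M) ->
  exists M, forall k, (k < n)%N -> Q k M.
Proof.
move=> mon; elim: n => [|n IH] h; first by exists 0.
have [M hM] := IH (fun k kn => h k (ltnW kn)); have [L hL] := h n (ltnSn n).
exists (Num.max M L) => k; rewrite ltnS leq_eqVlt => /orP[/eqP ->|kn].
  by apply: mon hL _; rewrite le_max lexx orbT.
by apply: mon (hM k kn) _; rewrite le_max lexx.
Qed.

End smooth_functions.

(** * Scaling functions as dilates of uniformly smooth profiles *)

Section multiresolution.
Context {R : realType}.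
Implicit Types (w S : nat -> nat -> R -> R).

Definition dilate S (j k : nat) (x : R) : R :=
  Num.sqrt 2 ^+ j * S j k (2 ^+ j * x - k%:R).

(* What the proof uses of a wavelet basis: the scaling functions of scale [j]
   are dilates of profiles [S j k] which are uniformly smooth and supported in
   [-D, D]. Unlike those of [interval_family], the profiles near the edges
   are defined and smooth on the whole line. *)
Record mra (A l0 : nat) w (D M C : R) S : Prop := {
  mra_A : (0 < A)%N ;
  mra_D : 0 <= D ;
  mra_smooth : forall j k, (l0 < j)%N -> (k < 2 ^ j)%N -> smooth A M (S j k) ;
  mra_supp : forall j k y, (l0 < j)%N -> (k < 2 ^ j)%N -> D < `|y| -> S j k y = 0 ;
  mra_ortho : forall j k k', (l0 < j)%N -> (k < 2 ^ j)%N -> (k' < 2 ^ j)%N ->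
    inner01 (dilate S j k) (dilate S j k') = (k == k')%:R ;
  mra_poly : forall j d, (l0 < j)%N -> (d < A)%N -> exists c : nat -> R,
    forall x, 0 <= x <= 1 -> x ^+ d = \sum_(k < 2 ^ j) c k * dilate S j k x ;
  mra_wavelet : forall l k, (l0 <= l)%N -> (k < level_size l0 l)%N ->
    exists c : nat -> R, forall x, 0 <= x <= 1 ->
      w l k x = \sum_(i < 2 ^ l.+1) c i * dilate S l.+1 i x ;
  mra_count : forall l i, (l0 <= l)%N -> (i < 2 ^ l.+1)%N ->
    \sum_(k < level_size l0 l) `|inner01 (w l k) (dilate S l.+1 i)| <= C ;
  mra_ortho_wavelet : forall l l' k k', (l0 <= l)%N -> (l0 <= l')%N ->
    (k < level_size l0 l)%N -> (k' < level_size l0 l')%N ->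
    inner01 (w l k) (w l' k') = ((l == l') && (k == k'))%:R ;
  mra_ortho_scaling : forall j l k k', (l0 < j)%N -> (j <= l)%N ->
    (k < 2 ^ j)%N -> (k' < level_size l0 l)%N ->
    inner01 (dilate S j k) (w l k') = 0 ;
  mra_complete : complete_L2_01 l0 w }.

Lemma dilate_continuous A M S j k : (0 < A)%N -> smooth A M (S j k) ->
  continuous (dilate S j k).
Proof.
case: A => // A _ [_ [S' [dS _]]] x.
have cS := is_derive_continuous dS.
apply: cvgM; first exact: cvg_cst.
apply: (continuous_comp (f := fun x : R => 2 ^+ j * x - k%:R)); last exact: cS.
apply: cvgB; last exact: cvg_cst.
by apply: cvgM; [exact: cvg_cst | exact: cvg_id].
Qed.

Section construction.
Variables (A l0 N : nat) (phi psi : R -> R) (phiL phiR psiL psiR : nat -> R -> R).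
Hypothesis sys : cdv_system A l0 N phi psi phiL phiR psiL psiR.
Hypothesis A0 : (0 < A)%N.

Let N_gt0 := cdv_N_gt0 sys.
Let V := interval_family N phi phiL phiR.
Let W := interval_family N psi psiL psiR.

Let N2j j : (l0 < j)%N -> (N.*2 <= 2 ^ j)%N.
Proof. by move=> lj; rewrite (leq_trans (cdv_scale sys))// leq_exp2l. Qed.

Lemma powR_half j : 2 `^ (j%:R / 2) = Num.sqrt 2 ^+ j :> R.
Proof. by rewrite mulrC powRrM powR12_sqrt// powR_mulrn// sqrtr_ge0. Qed.

Let phi_supp x : N%:R < `|x| -> phi x = 0.
Proof.
move=> Nx; apply: (dp_supp_phi (cdv_pair sys)); apply/negP => /andP[h1 h2].
move: Nx; rewrite ltNge => /negP; apply; rewrite ler_norml h2 andbT.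
by move: h1; lra.
Qed.

Let psi_supp x : N%:R < `|x| -> psi x = 0.
Proof.
move=> Nx; apply: (dp_supp_psi (cdv_pair sys)); apply/negP => /andP[h1 h2].
move: Nx; rewrite ltNge => /negP; apply; rewrite ler_norml h2 andbT.
by move: h1; lra.
Qed.

(** [N] for the support of [phi], plus [3 * N] for the largest shift of [phi] in a recentred edge
    function. *)
Let D : R := 4 * N%:R.

Let phi_smooth : exists M, smooth A M phi.
Proof. exact: (of_class_C_smooth (cdv_smooth_phi sys) phi_supp). Qed.

Let comb_smooth n (c : 'I_n -> R) (t : 'I_n -> R) :
  exists M, smooth A M (fun y => \sum_i c i * phi (y + t i)).
Proof.
have [M sM] := phi_smooth.
exists (\sum_i `|c i| * M); apply: smooth_sum => i _; apply: smoothZ.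
have := smooth_affine (t i) (_ : `|1| <= 1) (lexx 1) sM.
rewrite normr1 lexx expr1n mul1r => /(_ isT).
by congr smooth; apply/funext => y; rewrite mul1r.
Qed.

Let comb_supp n (c : 'I_n -> R) (t : 'I_n -> R) y : (forall i, `|t i| <= 3 * N%:R) ->
  D < `|y| -> \sum_i c i * phi (y + t i) = 0.
Proof.
move=> tN Dy; apply: big1 => i _; rewrite phi_supp ?mulr0//.
have := tN i; have := ler_normB (y + t i) (t i); rewrite addrK /D in Dy *; lra.
Qed.

(** On its half-line an edge function is a combination of translates of [phi]; the same combination
    on the whole line is its smooth extension. The shift by [k] puts it in the form expected by
    [dilate]. *)
Let left_profile k : (k < N)%N -> exists M s, [/\ smooth A M s,
  forall y, D < `|y| -> s y = 0 &
  forall x, 0 <= x -> phiL k x = s (x - k%:R)].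
Proof.
move=> kN; have [c cE] := cdv_edge_left sys kN.
pose t (i : 'I_(N.*2.-1)) : R := k%:R - (i%:R + 1 - N%:R).
have [M sM] := comb_smooth c t.
exists M, (fun y => \sum_i c i * phi (y + t i)); split => //.
  move=> y Dy; apply: comb_supp => // i.
  have h1 : (k%:R : R) <= N%:R by rewrite ler_nat ltnW.
  have h2 : (i%:R : R) + 1 <= 2 * N%:R.
    rewrite natr1 -natrM ler_nat mul2n; apply: (leq_trans (ltn_ord i)).
    exact: leq_pred.
  have h3 : 0 <= (k%:R : R) by [].
  have h4 : 0 <= (i%:R : R) by [].
  have h5 : 1 <= (N%:R : R) by rewrite ler1n.
  by rewrite /t ler_norml; lra.
move=> x x0; rewrite cE//; apply: eq_bigr => i _; congr (_ * phi _).
by rewrite /t; ring.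
Qed.

Let right_profile k : (k < N)%N -> exists M s, [/\ smooth A M s,
  forall y, D < `|y| -> s y = 0 &
  forall x, x <= 0 -> phiR k x = s (x + k.+1%:R)].
Proof.
move=> kN; have [c cE] := cdv_edge_right sys kN.
pose t (i : 'I_(N.*2.-1)) : R := - k.+1%:R - (i%:R - N%:R).
have [M sM] := comb_smooth c t.
exists M, (fun y => \sum_i c i * phi (y + t i)); split => //.
  move=> y Dy; apply: comb_supp => // i.
  have h1 : (k.+1%:R : R) <= N%:R by rewrite ler_nat.
  have h2 : (i%:R : R) <= 2 * N%:R.
    rewrite -natrM ler_nat mul2n; apply: (leq_trans (ltnW (ltn_ord i))).
    exact: leq_pred.
  have h3 : 0 <= (k.+1%:R : R) by [].
  have h4 : 0 <= (i%:R : R) by [].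
  have h5 : 1 <= (N%:R : R) by rewrite ler1n.
  by rewrite /t ler_norml; lra.
move=> x x0; rewrite cE//; apply: eq_bigr => i _; congr (_ * phi _).
by rewrite /t; ring.
Qed.

Let profile_ok (M : R) (s : R -> R) :=
  smooth A M s /\ forall y, D < `|y| -> s y = 0.

Let profiles : exists M, forall j k, (l0 < j)%N -> (k < 2 ^ j)%N ->
  exists s, profile_ok M s /\ forall x, 0 <= x <= 1 ->
    V j k x = Num.sqrt 2 ^+ j * s (2 ^+ j * x - k%:R).
Proof.
case: phi_smooth => M sM.
have [ML hL] : exists M, forall k, (k < N)%N -> exists s, profile_ok M s /\
    forall x, 0 <= x -> phiL k x = s (x - k%:R).
  apply: ex_uniform_bound => [k M1 M2 [s [[s1 s2] s3]] M12|k kN].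
    by exists s; split => //; split => //; exact: smooth_le M12.
  by have [M' [s [s1 s2 s3]]] := left_profile kN; exists M', s.
have [MR hR] : exists M, forall k, (k < N)%N -> exists s, profile_ok M s /\
    forall x, x <= 0 -> phiR k x = s (x + k.+1%:R).
  apply: ex_uniform_bound => [k M1 M2 [s [[s1 s2] s3]] M12|k kN].
    by exists s; split => //; split => //; exact: smooth_le M12.
  by have [M' [s [s1 s2 s3]]] := right_profile kN; exists M', s.
pose M' := Num.max M (Num.max ML MR).
exists M' => j k lj kj; rewrite /V /interval_family powR_half.
have D0 : N%:R <= D by rewrite /D -[leLHS]mul1r ler_wpM2r// ler1n.
case: (boolP (k < N)%N) => kN.
  have [s [[s1 s2] s3]] := hL k kN; exists s; split.
    by split => //; apply: smooth_le s1 _; rewrite /M' !le_max lexx orbT.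
  by move=> x /andP[x0 _]; rewrite s3// mulr_ge0// exprn_ge0.
case: (boolP (k < 2 ^ j - N)%N) => kN2.
  exists phi; split.
    split; first by apply: smooth_le sM _; rewrite /M' le_max lexx.
    by move=> y Dy; apply: phi_supp; exact: le_lt_trans Dy.
  by [].
have k'N : (2 ^ j - k.+1 < N)%N.
  move: kN2 kj (N2j lj) N_gt0; rewrite -leqNgt -addnn.
  by move: (2 ^ j)%N => e; clear; lia.
have [s [[s1 s2] s3]] := hR _ k'N; exists s; split.
  by split => //; apply: smooth_le s1 _; rewrite /M' !le_max lexx !orbT.
move=> x /andP[_ x1]; rewrite s3; last first.
  by rewrite mulr_ge0_le0 ?exprn_ge0// subr_le0.
congr (_ * s _); rewrite -subSn// subSS natrB 1?ltnW// natrX; ring.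
Qed.

(** Of the wavelets only locality is used directly: their smoothness is that of the scaling
    functions of the next scale, in which they are expanded. *)
Let W_local j k x : (l0 < j)%N -> (k < 2 ^ j)%N -> 0 <= x <= 1 ->
  D < `|2 ^+ j * x - k%:R| -> W j k x = 0.
Proof.
move=> lj kj /andP[x0 x1] Dx; rewrite /W /interval_family.
have N1 : 1 <= (N%:R : R) by rewrite ler1n.
have N2 : (N.*2.-1)%:R <= 2 * (N%:R : R).
  by rewrite -natrM ler_nat mul2n leq_pred.
have jx0 : 0 <= 2 ^+ j * x by rewrite mulr_ge0// exprn_ge0.
have jx1 : 2 ^+ j * x <= 2 ^+ j by rewrite ler_piMr// exprn_ge0.
have k0 : 0 <= (k%:R : R) by [].
have kj' : (k%:R : R) <= 2 ^+ j by rewrite -natrX ler_nat ltnW.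
have Dx' : D < 2 ^+ j * x - k%:R \/ 2 ^+ j * x - k%:R < - D.
  by move: Dx; rewrite ltr_normr => /orP[]; [left|right; lra].
case: ifPn => kN.
  have kN' : (k%:R : R) <= N%:R by rewrite ler_nat ltnW.
  have [|_ ->] := @cdv_supp_left _ _ _ _ _ _ _ _ _ _ sys k (2 ^+ j * x) kN.
    by case: Dx'; rewrite /D; lra.
  by rewrite mulr0.
case: ifPn => kN2.
  by rewrite psi_supp ?mulr0//; apply: le_lt_trans Dx; rewrite /D; lra.
have k'N : (2 ^ j - k.+1 < N)%N.
  move: kN2 kj (N2j lj) N_gt0; rewrite -leqNgt -addnn.
  by move: (2 ^ j)%N => e; clear; lia.
have kN3 : 2 ^+ j <= (k%:R : R) + N%:R.
  by rewrite -natrX -natrD ler_nat; move: k'N kj; clear; lia.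
have [|_ ->] := @cdv_supp_right _ _ _ _ _ _ _ _ _ _ sys _ (2 ^+ j * (x - 1)) k'N.
  by rewrite mulrBr mulr1; case: Dx'; rewrite /D; lra.
by rewrite mulr0.
Qed.

Variable w : nat -> nat -> R -> R.
Hypothesis wE : forall l k x, (l0 <= l)%N -> (k < level_size l0 l)%N -> 0 <= x <= 1 ->
  w l k x = if l == l0 then V l0.+1 k x else W l k x.
Hypothesis w_complete : complete_L2_01 l0 w.

Lemma mra_of_cdv : exists D M C S, mra A l0 w D M C S.
Proof.
have [M hM] := profiles.
have D0 : 0 <= D by rewrite /D mulr_ge0.
have [S hS] : exists S : nat -> nat -> R -> R, forall j k, (l0 < j)%N -> (k < 2 ^ j)%N ->
    profile_ok M (S j k) /\ forall x, 0 <= x <= 1 -> V j k x = dilate S j k x.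
  have H (jk : nat * nat) : exists s : R -> R, (l0 < jk.1)%N -> (jk.2 < 2 ^ jk.1)%N ->
      profile_ok M s /\ forall x, 0 <= x <= 1 ->
      V jk.1 jk.2 x = Num.sqrt 2 ^+ jk.1 * s (2 ^+ jk.1 * x - jk.2%:R).
    case: (boolP ((l0 < jk.1)%N && (jk.2 < 2 ^ jk.1)%N)) => [/andP[h1 h2]|h].
      by have [s hs] := hM _ _ h1 h2; exists s.
    by exists (fun=> 0) => h1 h2; rewrite h1 h2 in h.
  have [S hS] := choice H.
  by exists (fun j k => S (j, k)) => j k; exact: hS (j, k).
have sS j k (lj : (l0 < j)%N) (kj : (k < 2 ^ j)%N) := (hS j k lj kj).1.1.
have cS j k (lj : (l0 < j)%N) (kj : (k < 2 ^ j)%N) := dilate_continuous A0 (sS j k lj kj).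
have VE j k (lj : (l0 < j)%N) (kj : (k < 2 ^ j)%N) := (hS j k lj kj).2.
have wavelet l k : (l0 <= l)%N -> (k < level_size l0 l)%N ->
    exists c : nat -> R, forall x, 0 <= x <= 1 ->
      w l k x = \sum_(i < 2 ^ l.+1) c i * dilate S l.+1 i x.
  move=> ll kl; have := kl; rewrite /level_size; case: eqP => [le|/eqP ln] kl'.
    (* The father wavelets, of level [l0], already are the scaling functions of scale [l0.+1]. *)
    exists (fun i => (i == k)%:R) => x x01.
    have kl1 : (k < 2 ^ l.+1)%N by rewrite le.
    have ll1 : (l0 < l.+1)%N by rewrite le.
    rewrite wE// le eqxx -le VE// (bigD1 (Ordinal kl1))//=.
    by rewrite eqxx mul1r big1 ?addr0// => i; rewrite -val_eqE/= => /negbTE ->; rewrite mul0r.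
  have ll' : (l0 < l)%N by rewrite ltn_neqAle eq_sym ln.
  have [c cE] := cdv_nested_W sys ll' kl'.
  exists c => x x01; rewrite wE// (negbTE ln) /W cE//.
  by apply: eq_bigr => i _; rewrite -VE//; exact: leqW.
have cw l k : (l0 <= l)%N -> (k < level_size l0 l)%N -> c01 (w l k).
  move=> ll kl; have [c cE] := wavelet l k ll kl.
  apply: (@eq_c01 _ (fun x => \sum_(i < 2 ^ l.+1) c i * dilate S l.+1 i x)).
    by move=> x /cE.
  by apply: c01_sum => i; apply/c01Z/c01_continuous/cS.
have w_ortho l l' k k' : (l0 <= l)%N -> (l0 <= l')%N ->
    (k < level_size l0 l)%N -> (k' < level_size l0 l')%N ->
    inner01 (w l k) (w l' k') = ((l == l') && (k == k'))%:R.
  move=> ll ll' kl kl'.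
  rewrite (eq_inner01 (fun x x01 => wE ll kl x01) (fun x x01 => wE ll' kl' x01)).
  move: kl kl'; rewrite /level_size.
  case: (eqVneq l l0) => [le|ln]; case: (eqVneq l' l0) => [le'|ln'] kl kl'.
  - by rewrite le le' eqxx/= (cdv_ortho_V sys).
  - rewrite le eq_sym (negbTE ln')/= (cdv_ortho_VW sys)//.
    by rewrite ltn_neqAle eq_sym ln'.
  - rewrite le' (negbTE ln)/= inner01C (cdv_ortho_VW sys)//.
    by rewrite ltn_neqAle eq_sym ln.
  - by rewrite (cdv_ortho_W sys)// ltn_neqAle eq_sym ?ln ?ln'.
have V_ortho j k k' : (l0 < j)%N -> (k < 2 ^ j)%N -> (k' < 2 ^ j)%N ->
    inner01 (dilate S j k) (dilate S j k') = (k == k')%:R.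
  move=> lj kj kj'.
  rewrite -(cdv_ortho_V sys lj kj kj').
  by apply: eq_inner01 => x x01; rewrite -VE.
have le1 l k i : (l0 <= l)%N -> (k < level_size l0 l)%N -> (i < 2 ^ l.+1)%N ->
    `|inner01 (w l k) (dilate S l.+1 i)| <= 1.
  move=> ll kl il; apply: inner01_unit_le1.
  - exact: cw.
  - exact/c01_continuous/cS.
  - by rewrite w_ortho// !eqxx.
  - by rewrite V_ortho// eqxx.
(* At level [l0] all [2 ^ l0.+1] inner products are counted, each being at most 1. At a level
   [l > l0], if the supports of [w l k] and of the scaling function [i] of scale [l.+1] meet, then
   [k] is within [D + D / 2 <= 2 * D] of [i / 2]. *)
exists D, M, (Num.max (2 ^ l0.+1)%:R (2 * (2 * D) + 1)), S.
split => //.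
- by move=> j k y lj kj; exact: (hS j k lj kj).1.2.
- move=> j d lj dA; have [c cE] := cdv_polynomials sys lj (leq_trans dA (cdv_moments_regular sys)).
  exists c => x x01; rewrite cE//; apply: eq_bigr => i _.
  by rewrite -VE.
- move=> l i ll il; rewrite le_max.
  case: (eqVneq l l0) => [le|ln].
    apply/orP; left.
    apply: (@le_trans _ _ (\sum_(k < level_size l0 l) (1 : R))).
      by apply: ler_sum => k _; exact: le1.
    by rewrite sumr_const card_ord /level_size le eqxx.
  apply/orP; right; rewrite -[leRHS]mulr1.
  have ll' : (l0 < l)%N by rewrite ltn_neqAle eq_sym ln.
  apply: (sum_near_le (a := i%:R / 2)) => //.
  - by rewrite mulr_ge0.
  - by move=> k; exact: le1.
  move=> k kD; rewrite /inner01 -[RHS](@int01_cst R 0); apply: eq_int01 => x x01.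
  have kl := ltn_ord k; rewrite {2}/level_size (negbTE ln) in kl.
  rewrite wE// (negbTE ln).
  have [h|h] := leP `|2 ^+ l * x - k%:R| D; last by rewrite W_local// mul0r.
  rewrite /dilate (hS l.+1 i (leqW ll' : (l0 < l.+1)%N) il).1.2 ?mulr0//.
  move: h; rewrite ler_distl => /andP[h1 h2].
  rewrite ltNge; apply/negP; rewrite ler_distl exprS -mulrA => /andP[h3 h4].
  move: kD; rewrite ltNge => /negP; apply; rewrite ler_distl; lra.
- move=> j l k k' lj jl kj kl'.
  have ll : (l0 < l)%N by exact: leq_trans jl.
  rewrite (eq_inner01 (f' := V j k) (g' := W l k')).
  + apply: (cdv_ortho_VW sys) => //.
    by move: kl'; rewrite /level_size gtn_eqF.
  + by move=> x x01; rewrite -VE.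
  + by move=> x x01; rewrite wE ?(ltnW ll)// gtn_eqF.
Qed.

End construction.

Lemma cdv_basis_mra A l0 w : (0 < A)%N -> cdv_basis A l0 w ->
  exists D M C S, mra A l0 w D M C S.
Proof.
move=> A0 [[N [phi [psi [phiL [phiR [psiL [psiR [sys wE]]]]]]]] cw].
by apply: (mra_of_cdv sys A0 _ cw) => l k x ll kl x01; rewrite wE.
Qed.

End multiresolution.

(** * Comparison of sequence norms *)

Section sequence_norms.
Context {R : realType}.
Implicit Types (p : \bar R) (u : nat -> \bar R) (v : nat -> R).
Local Open Scope ereal_scope.

Let counting_gt0 : 0 < (@counting nat R) [set: nat].
Proof. by rewrite /counting; case: ifPn => // /asboolP; move/infinite_nat. Qed.

Let nneseries_finite (u : nat -> \bar R) n : (forall k, 0 <= u k) ->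
  (forall k, (n <= k)%N -> u k = 0) -> \sum_(k <oo) u k = \sum_(k < n) u k.
Proof.
move=> u0 un; rewrite (nneseries_split 0 n (fun k _ => u0 k)).
rewrite add0n big_mkord eseries0 ?adde0// => k nk _; exact: un.
Qed.

(** The norm of exponent [p] is at most that of exponent [s <= p], infinite [p] included. It is used
    with [s = 2] inside a level, where [2 <= p], and with [s = 1] across levels. *)
Lemma seq_norm_le p u v n (s B : R) : (1 <= s)%R -> s%:E <= p -> (0 < B)%R ->
  (forall k, `|u k| <= (v k)%:E) -> (forall k, (n <= k)%N -> v k = 0%R) ->
  (\sum_(k < n) v k `^ s <= B `^ s)%R -> seq_norm p u <= B%:E.
Proof.
move=> s1 sp B0 uv vn sumv.
have s0 : (0 < s)%R by exact: (lt_le_trans ltr01 s1).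
have v0 k : (0 <= v k)%R by rewrite -lee_fin; exact: (le_trans (abse_ge0 _) (uv k)).
have vB k : (v k <= B)%R.
  have [nk|kn] := leqP n k; first by rewrite vn// ltW.
  have h : (v k `^ s <= B `^ s)%R.
    apply: le_trans sumv; rewrite (bigD1 (Ordinal kn))//= lerDl.
    by apply: sumr_ge0 => i _; exact: powR_ge0.
  rewrite leNgt; apply/negP => Bv.
  have := @gt0_ltr_powR R s s0 B (v k); rewrite !nnegrE ltW// v0 => /(_ isT isT Bv).
  by rewrite ltNge h.
rewrite /seq_norm; case: p sp => [p sp|_|//]; last first.
  rewrite unlock counting_gt0; apply/ess_supP; apply: aeW => k.
  by rewrite /= (le_trans (uv k))// lee_fin.
rewrite lee_fin in sp; have p0 : (0 < p)%R by exact: (lt_le_trans s0 sp).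
rewrite Lnorm_counting//.
have -> : B%:E = (B `^ p)%:E `^ p^-1.
  by rewrite poweR_EFin -powRrM mulfV ?gt_eqF// powRr1// ltW.
apply: gt0_ler_poweR; rewrite ?invr_ge0 ?(ltW p0)//.
- by rewrite in_itv/= leey andbT; apply: nneseries_ge0 => k _ _; exact: poweR_ge0.
- by rewrite in_itv/= leey andbT lee_fin powR_ge0.
apply: (@le_trans _ _ (\sum_(k <oo) (v k `^ p)%:E)).
  apply: lee_nneseries => k _; first by move=> _; exact: poweR_ge0.
  rewrite -poweR_EFin; apply: gt0_ler_poweR; rewrite ?(ltW p0)//.
  - by rewrite in_itv/= leey andbT.
  - by rewrite in_itv/= leey andbT lee_fin.
rewrite (@nneseries_finite _ n); last 2 first.
- by move=> k; rewrite lee_fin powR_ge0.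
- by move=> k nk; rewrite vn// powR0// gt_eqF.
rewrite sumEFin lee_fin.
(* No [v k] exceeds [B], so [v^p = v^s v^(p - s)] is at most [v^s B^(p - s)]. *)
have split_exp x : (0 <= x)%R -> (x `^ p = x `^ s * x `^ (p - s))%R.
  move=> x0; rewrite -powRD addrC subrK//.
  by rewrite gt_eqF.
rewrite split_exp ?(ltW B0)//.
apply: (@le_trans _ _ (\sum_(k < n) v k `^ s * B `^ (p - s))%R).
  apply: ler_sum => k _; rewrite split_exp// ler_wpM2l ?powR_ge0//.
  by apply: ge0_ler_powR; rewrite ?nnegrE ?subr_ge0 ?(ltW B0).
by rewrite -mulr_suml ler_wpM2r// powR_ge0.
Qed.

(** For infinite [p] the essential supremum is a supremum, because only the empty set is null for
    the counting measure. *)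
Lemma seq_norm_ge p u k : 1 <= p -> `|u k| <= seq_norm p u.
Proof.
rewrite /seq_norm; case: p => [p p1|_|//]; last first.
  rewrite unlock counting_gt0.
  have [N [mN N0 sN]] := ess_sup_ge (@counting nat R) (abse \o u).
  have NE i : ~ N i.
    move=> Ni; move: N0; rewrite /= counting_dirac => /eqP.
    rewrite gt_eqF//; apply: (@lt_le_trans _ _ (\sum_(0 <= j < i.+1) \d_j N)).
      rewrite big_nat_recr//= diracE mem_set// (lt_le_trans lte01)// leeDr//.
      by apply: sume_ge0 => j _; exact: measure_ge0.
    by apply: nneseries_lim_ge => j _ _; exact: measure_ge0.
  by apply/negP => /negP h; apply: (NE k); apply: sN => /=; exact/negP.
rewrite lee_fin in p1; have p0 : (0 < p)%R by exact: (lt_le_trans ltr01 p1).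
rewrite Lnorm_counting//.
have -> : `|u k| = (`|u k| `^ p) `^ p^-1.
  by rewrite -poweRrM mulfV ?gt_eqF// poweRe1.
apply: gt0_ler_poweR; rewrite ?invr_ge0 ?(ltW p0)//.
- by rewrite in_itv/= leey andbT; exact: poweR_ge0.
- by rewrite in_itv/= leey andbT; apply: nneseries_ge0 => i _ _; exact: poweR_ge0.
apply: (le_trans _ (nneseries_lim_ge (P := xpredT) k.+1 _)) => //.
  rewrite big_nat_recr//= leeDr//; apply: sume_ge0 => i _; exact: poweR_ge0.
by move=> i _ _; exact: poweR_ge0.
Qed.

End sequence_norms.

(** * Functions of a Besov ball *)

Section bumps.
Context {R : realType}.
Local Notation mu := (@lebesgue_measure R).

Lemma int01_local (f : R -> R) (t r c : R) : c01 f -> 0 <= r -> 0 <= c ->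
  (forall x, 0 <= x <= 1 -> `|f x| <= c) ->
  (forall x, 0 <= x <= 1 -> r < `|x - t| -> f x = 0) ->
  `|int01 f| <= 2 * r * c.
Proof.
move=> cf r0 c0 fc fr.
have mU := @measurable_unit_interval R.
have iF := c01_integrable cf.
apply: (le_trans (le_normr_Rintegral mU iF)).
pose I := (`[t - r, t + r]%classic : set (measurableTypeR R)).
have mI : measurable I by exact: measurable_itv.
have muI : mu I = (2 * r)%:E.
  rewrite lebesgue_measure_itv/= lte_fin; case: ifPn => [_|].
    by rewrite -EFinB; congr EFin; ring.
  rewrite -leNgt => h; congr EFin; apply/eqP; rewrite eq_le.
  by apply/andP; split; move: h r0; lra.
have mF : measurable_fun unit_interval (fun x => (`|f x|)%:E).
  apply/measurable_EFinP.
  apply: (measurableT_comp (@normr_measurable _ setT)).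
  by have /integrableP[/measurable_EFinP] := iF.
have le : (\int[mu]_(x in unit_interval) (`|f x|)%:E <= (2 * r * c)%:E)%E.
  apply: (@le_trans _ _ (\int[mu]_(x in unit_interval) (c%:E * (\1_I x)%:E))%E).
    apply: ge0_le_integral => //.
    - by apply: measurable_funeM; apply/measurable_EFinP; exact: measurable_indic.
    - move=> x; rewrite unit_intervalE => x01; rewrite -EFinM lee_fin indicE.
      case: (boolP (x \in I)) => [_|xI]; first by rewrite mulr1; exact: fc.
      rewrite fr ?normr0 ?mulr0// ltNge; apply: contra xI.
      by rewrite ler_distl inE /I/= in_itv.
  rewrite ge0_integralZl//.
    rewrite integral_indic// mulrC EFinM lee_wpmul2l ?lee_fin//.
    by rewrite -muI; apply: le_measure; rewrite ?inE; [exact: measurableI|exact: mI|exact: subIsetl].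
  exact/measurable_EFinP/measurable_indic.
rewrite -lee_fin; apply: le_trans le; rewrite /Rintegral fineK//.
have : mu.-integrable unit_interval (fun x => (`|f x|)%:E).
  apply/integrableP; split => //.
  under eq_integral do rewrite /= normr_id.
  by have /integrableP[_] := iF.
exact: integrable_fin_num.
Qed.

(** As [2 <= p], square sums suffice inside each level, and these are what Bessel's inequality
    provides. *)
Lemma besov_norm_le (l0 n : nat) w (alpha rho : R) (p q : \bar R) (f : R -> R)
    (B : nat -> R) :
  (2%:E <= p)%E -> (1 <= q)%E -> 0 <= rho -> (forall l, 0 <= B l) ->
  (forall l, (n <= l)%N -> B l = 0) ->
  (forall l, (l0 <= l)%N ->
    \sum_(k < level_size l0 l) wcoef w f l k ^+ 2 <= B l ^+ 2) ->
  \sum_(l < n) 2 `^ (l%:R * (alpha + 2^-1 - inv_exponent p)) * B l <= rho ->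
  (besov_norm l0 w alpha p q f <= rho%:E)%E.
Proof.
move=> p2 q1 rho0 B0 Bn fB sumB; apply/lee_addgt0Pr => e e0.
have level l : (l0 <= l)%N -> (seq_norm p (fun k =>
     if (k < level_size l0 l)%N then (wcoef w f l k)%:E else 0%E) <= (B l)%:E)%E.
  (* The bound [B l] may vanish, while [seq_norm_le] asks for a positive one. *)
  move=> ll; apply/lee_addgt0Pr => d d0; rewrite -EFinD.
  apply: (@seq_norm_le _ p _ (fun k => if (k < level_size l0 l)%N then `|wcoef w f l k| else 0)
    (level_size l0 l) 2) => //.
  - by rewrite ler1n.
  - by rewrite ltr_wpDl.
  - by move=> k; case: ifP => _; rewrite ?abse0.
  - by move=> k; rewrite ltnNge => ->.
  - rewrite powR_mulrn ?addr_ge0// ?(ltW d0)//.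
    apply: (@le_trans _ _ (B l ^+ 2)); last first.
      by rewrite lerXn2r ?nnegrE ?addr_ge0// ?(ltW d0)// lerDl ltW.
    apply: le_trans (fB l ll); apply: ler_sum => k _.
    by rewrite ltn_ord powR_mulrn// real_normK ?num_real.
rewrite -EFinD; apply: (@seq_norm_le _ q _
  (fun l => 2 `^ (l%:R * (alpha + 2^-1 - inv_exponent p)) * B l) n 1) => //.
- by rewrite ltr_wpDl.
- move=> l; case: ifPn => ll; last first.
    by rewrite abse0 lee_fin mulr_ge0// powR_ge0.
  rewrite gee0_abs; last by rewrite mule_ge0 ?lee_fin ?powR_ge0// /seq_norm Lnorm_ge0.
  by rewrite EFinM lee_wpmul2l ?lee_fin ?powR_ge0// level.
- by move=> l nl; rewrite Bn// mulr0.
- rewrite powRr1 ?addr_ge0// ?(ltW e0)//; apply: (@le_trans _ _ rho); last by rewrite lerDl ltW.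
  apply: le_trans sumB; apply: ler_sum => l _.
  by rewrite powRr1// mulr_ge0// powR_ge0.
Qed.

Lemma geometric_sum_le (g : R) n : 1 < g -> \sum_(l < n) g ^+ l <= g ^+ n / (g - 1).
Proof.
move=> g1; have h : 0 < g - 1 by rewrite subr_gt0.
rewrite ler_pdivlMr// mulrC -subrX1 lerBlDr lerDl ler01//.
Qed.

Lemma geometric_lt1_le (r : R) n : 0 <= r -> r < 1 -> \sum_(l < n) r ^+ l <= (1 - r)^-1.
Proof.
move=> r0 r1; have h : 0 < 1 - r by rewrite subr_gt0.
rewrite -[leRHS]mul1r ler_pdivlMr// mulrC -opprB mulNr -subrX1 opprB.
by rewrite lerBlDr lerDl exprn_ge0.
Qed.

Lemma powR_sqrt2 (nu : R) : 2 `^ (nu + 2^-1) * 2 `^ (- nu) = Num.sqrt 2 :> R.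
Proof.
rewrite -powRD; last by rewrite pnatr_eq0 implybT.
by rewrite addrC addKr powR12_sqrt.
Qed.

Lemma rate_half (nu : R) l :
  (2 `^ (nu + 2^-1)) ^- l * Num.sqrt 2 ^+ l = (2 `^ (- nu)) ^+ l :> R.
Proof.
by rewrite -(powR_sqrt2 nu) exprMn mulKf// expf_neq0// lt0r_neq0// powR_gt0.
Qed.

Lemma ex_mfun (h : measurableTypeR R -> measurableTypeR R) : measurable_fun setT h ->
  exists f : {mfun measurableTypeR R >-> measurableTypeR R},
    (f : measurableTypeR R -> measurableTypeR R) = h.
Proof.
move=> mh.
pose mixin := isMeasurableFun.Build _ _ (measurableTypeR R) (measurableTypeR R) h mh.
by exists (MeasurableFun.Pack (MeasurableFun.Class mixin)).
Qed.

Section mra_theory.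
Variables (A l0 : nat) (w : nat -> nat -> R -> R) (D M C : R) (S : nat -> nat -> R -> R).
Hypothesis H : mra A l0 w D M C S.
Local Notation Phi := (dilate S).
Local Notation s2 := (Num.sqrt (2 : R)).

Lemma sqrt2_gt0 : 0 < s2.
Proof. by rewrite sqrtr_gt0. Qed.

Lemma sqrt2X j : s2 ^+ j * s2 ^+ j = 2 ^+ j.
Proof. by rewrite -exprMn -expr2 sqr_sqrtr. Qed.

Lemma sqrt2X_gt0 j : 0 < s2 ^+ j.
Proof. by rewrite exprn_gt0// sqrt2_gt0. Qed.

Lemma Phi_continuous j k : (l0 < j)%N -> (k < 2 ^ j)%N -> continuous (Phi j k).
Proof.
by move=> lj kj; apply: dilate_continuous (mra_A H) (mra_smooth H lj kj).
Qed.

Lemma Phi_c01 j k : (l0 < j)%N -> (k < 2 ^ j)%N -> c01 (Phi j k).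
Proof. by move=> lj kj; apply/c01_continuous/Phi_continuous. Qed.

Lemma mra_M_ge0 : 0 <= M.
Proof. exact: (smooth_ge0 (mra_smooth H (ltnSn l0) (expn_gt0 2 _))). Qed.

Lemma Phi_bound j k x : (l0 < j)%N -> (k < 2 ^ j)%N -> `|Phi j k x| <= s2 ^+ j * M.
Proof.
move=> lj kj; rewrite /dilate normrM ger0_norm; last exact: ltW (sqrt2X_gt0 j).
by rewrite ler_wpM2l ?(ltW (sqrt2X_gt0 j))// (smooth_bound _ (mra_smooth H lj kj)).
Qed.

Lemma Phi_local j k x : (l0 < j)%N -> (k < 2 ^ j)%N ->
  D < `|k%:R - 2 ^+ j * x| -> Phi j k x = 0.
Proof.
by move=> lj kj Dx; rewrite /dilate (mra_supp H lj kj) ?mulr0// distrC.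
Qed.

Lemma sum_Phi_le j x : (l0 < j)%N ->
  \sum_(k < 2 ^ j) `|Phi j k x| <= (2 * D + 1) * (s2 ^+ j * M).
Proof.
move=> lj; apply: (sum_near_le (a := 2 ^+ j * x)).
- exact: mra_D H.
- by rewrite mulr_ge0 ?mra_M_ge0// ltW// sqrt2X_gt0.
- by move=> k; exact: Phi_bound.
- by move=> k; exact: Phi_local.
Qed.

Lemma Phi_coef j (f : R -> R) (c : nat -> R) i : (l0 < j)%N -> (i < 2 ^ j)%N ->
  (forall x, 0 <= x <= 1 -> f x = \sum_(k < 2 ^ j) c k * Phi j k x) ->
  c i = inner01 f (Phi j i).
Proof.
move=> lj ij fE.
rewrite (@eq_inner01 _ _ _ _ _ fE (fun x _ => erefl)).
rewrite inner01_lin; [|by move=> k; exact: Phi_c01|exact: Phi_c01].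
rewrite (bigD1 (Ordinal ij))//= (mra_ortho H)// eqxx mulr1 big1 ?addr0// => k ki.
by rewrite (mra_ortho H)// -val_eqE/= in ki *; rewrite (negbTE ki) mulr0.
Qed.

Lemma wavelet_c01 l k : (l0 <= l)%N -> (k < level_size l0 l)%N -> c01 (w l k).
Proof.
move=> ll kl; have [c cE] := mra_wavelet H ll kl.
apply: (@eq_c01 _ (fun x => \sum_(i < 2 ^ l.+1) c i * Phi l.+1 i x)).
  by move=> x /cE.
by apply: c01_sum => i; apply/c01Z/Phi_c01.
Qed.

Lemma Phi_mean j k : (l0 < j)%N -> (k < 2 ^ j)%N ->
  `|int01 (Phi j k)| <= 2 * D * M / s2 ^+ j.
Proof.
move=> lj kj.
have j0 : 0 < 2 ^+ j :> R by rewrite exprn_gt0.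
have := @int01_local (Phi j k) (k%:R / 2 ^+ j) (D / 2 ^+ j) (s2 ^+ j * M)
  (Phi_c01 lj kj).
have -> : 2 * (D / 2 ^+ j) * (s2 ^+ j * M) = 2 * D * M / s2 ^+ j.
  rewrite -sqrt2X; field; exact: lt0r_neq0 (sqrt2X_gt0 j).
apply.
- by rewrite divr_ge0 ?(mra_D H)// ltW.
- by rewrite mulr_ge0 ?mra_M_ge0// ltW// sqrt2X_gt0.
- by move=> x _; exact: Phi_bound.
- move=> x _ h; apply: Phi_local => //.
  rewrite distrC (_ : _ - _ = 2 ^+ j * (x - k%:R / 2 ^+ j)); last first.
    by field; exact: lt0r_neq0.
  by rewrite normrM (ger0_norm (ltW j0)) mulrC -ltr_pdivrMr.
Qed.

Definition peak : R := ((2 * D * M + 1) * (2 * D + 1))^-1.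

Lemma peak_gt0 : 0 < peak.
Proof.
have D0 := mra_D H; have M0 := mra_M_ge0.
by rewrite /peak invr_gt0 mulr_gt0// ltr_wpDl// !mulr_ge0.
Qed.

(* [1] is a combination of the scaling functions of scale [j] with coefficients
   of order [2^(-j/2)], and boundedly many of them do not vanish at [x]. *)
Lemma Phi_peak j x : (l0 < j)%N -> 0 <= x <= 1 ->
  exists2 k, (k < 2 ^ j)%N & s2 ^+ j * peak <= `|Phi j k x|.
Proof.
move=> lj x01; have D0 := mra_D H; have M0 := mra_M_ge0.
apply: contrapT => no.
have small k : (k < 2 ^ j)%N -> `|Phi j k x| <= s2 ^+ j * peak.
  by move=> kj; rewrite leNgt; apply/negP => /ltW h; apply: no; exists k.
have [c cE] := mra_poly H lj (mra_A H).
have c_le (k : 'I_(2 ^ j)) : `|c k| <= 2 * D * M / s2 ^+ j.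
  rewrite (Phi_coef lj (ltn_ord k) cE).
  rewrite (_ : inner01 _ _ = int01 (Phi j k)); first exact: Phi_mean.
  by apply: eq_int01 => y _; rewrite expr0 mul1r.
have s0 := sqrt2X_gt0 j; have pk0 := peak_gt0.
have := cE x x01; rewrite expr0 => E.
have h1 : \sum_(k < 2 ^ j) `|Phi j k x| <= (2 * D + 1) * (s2 ^+ j * peak).
  apply: (sum_near_le (a := 2 ^+ j * x)) => //.
  - by rewrite mulr_ge0// ltW.
  - by move=> k; exact: small.
  - by move=> k; exact: Phi_local.
have : 1 <= 2 * D * M / s2 ^+ j * \sum_(k < 2 ^ j) `|Phi j k x|.
  rewrite -[leLHS]normr1 {1}E (le_trans (ler_norm_sum _ _ _))// mulr_sumr.
  by apply: ler_sum => k _; rewrite normrM ler_wpM2r.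
apply/negP; rewrite -ltNge.
apply: (@le_lt_trans _ _ (2 * D * M / s2 ^+ j * ((2 * D + 1) * (s2 ^+ j * peak)))).
  by rewrite ler_wpM2l// divr_ge0 ?(ltW s0)// !mulr_ge0.
have d1 : 0 < 2 * D * M + 1 by rewrite ltr_wpDl// !mulr_ge0.
have d2 : 0 < 2 * D + 1 by rewrite ltr_wpDl// !mulr_ge0.
rewrite (_ : _ * _ = 2 * D * M / (2 * D * M + 1)); last first.
  by rewrite /peak; field; rewrite !lt0r_neq0.
by rewrite ltr_pdivrMr// mul1r ltrDl.
Qed.

Section besov_bump.
Variables (alpha rho x0 : R) (p q : \bar R).
Hypotheses (p2 : (2%:E <= p)%E) (q1 : (1 <= q)%E) (rho0 : 0 < rho).
Let nu := alpha - inv_exponent p.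
Hypothesis nu0 : 0 < nu.
Hypothesis x01 : 0 <= x0 <= 1.
Let r : R := 2 `^ (- nu).
Let g : R := 2 `^ (nu + 2^-1).

Let g1 : 1 < g.
Proof.
rewrite -(powRr0 (2 : R)) /g /powR pnatr_eq0/= ltr_expR ltr_pM2r ?ln_gt0 ?ltr1n//.
by rewrite addr_gt0.
Qed.

Let r0 : 0 < r. Proof. exact: powR_gt0. Qed.

(** The bump is [e] times one scaling function of scale [j]. It is orthogonal to all wavelets of
    levels [l >= j], and by Bessel the coefficients of each lower level have square sum at most
    [e ^+ 2]. The weights [g ^+ l] are summed up to [g ^+ j / (g - 1)], and [e = b * g ^- j] because
    [g * r] is the square root of 2; this gives [a0]. Division by [M + 1] brings the height below
    [a * r ^+ j]. *)
Lemma besov_bump : exists c a0 W : R, [/\ 0 < c, 0 < a0, 0 <= W &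
  forall j a, (l0 < j)%N -> 0 < a -> a <= a0 ->
  exists f : {mfun measurableTypeR R >-> measurableTypeR R},
  [/\ besov_ball l0 w alpha p q rho f,
   forall x, `|f x| <= a * r ^+ j,
   forall x, W / 2 ^+ j < `|x - x0| -> f x = 0 &
   c * a * r ^+ j <= `|f x0|]].
Proof.
have D0 := mra_D H; have M0 := mra_M_ge0; have pk0 := peak_gt0.
have M1 : 0 < M + 1 by rewrite ltr_wpDl.
have gm1 : 0 < g - 1 by rewrite subr_gt0.
exists (peak / (M + 1)), (rho * (g - 1) * (M + 1)), (2 * D); split.
- by rewrite divr_gt0.
- by rewrite !mulr_gt0.
- by rewrite mulr_ge0.
move=> j a lj a0 aa0.
have [k kj pk] := Phi_peak lj x01.
pose b := a / (M + 1); have b0 : 0 < b by rewrite divr_gt0.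
pose e := b * r ^+ j / s2 ^+ j.
have e0 : 0 < e by rewrite !mulr_gt0 ?invr_gt0 ?exprn_gt0// sqrt2_gt0.
pose f0 : R -> R := fun x => e * Phi j k x.
have cf0 : continuous f0.
  by move=> x; apply: cvgM; [exact: cvg_cst | exact: (Phi_continuous lj kj)].
have mf0 : measurable_fun setT (f0 : measurableTypeR R -> measurableTypeR R).
  exact: continuous_measurable_fun.
have [f fE] := ex_mfun mf0.
have c1f : c01 f0 by exact: c01_continuous.
have eE : e = b * g ^- j.
  rewrite /e -mulrA; congr (_ * _).
  rewrite -(powR_sqrt2 nu) -/g -/r exprMn; field; rewrite !expf_neq0// ?lt0r_neq0//.
  exact: lt_trans ltr01 g1.
exists f; rewrite /besov_ball /= fE; split.
- split; first exact: c1f.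
  pose B l := if (l < j)%N then e else 0.
  apply: (besov_norm_le (n := j) (B := B)) => //; first exact: ltW.
  + by move=> l; rewrite /B; case: ifP => // _; exact: ltW.
  + by move=> l jl; rewrite /B ltnNge jl.
  + move=> l ll; rewrite /B; case: ltnP => lj'; last first.
      rewrite expr0n/= big1// => i _; rewrite /wcoef.
      rewrite (_ : inner01 _ _ = 0) ?expr0n//.
      rewrite inner01Zl; [|exact: Phi_c01|exact: wavelet_c01].
      by rewrite (mra_ortho_scaling H)// mulr0.
    apply: (@le_trans _ _ (inner01 f0 f0)).
      apply: bessel => //.
        by move=> i; exact: wavelet_c01.
      by move=> i i'; rewrite (mra_ortho_wavelet H)// eqxx.
    have cP := Phi_c01 lj kj.
    rewrite {1}/f0 (inner01Zl e cP c1f) inner01C /f0 (inner01Zl e cP cP).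
    by rewrite (mra_ortho H lj kj kj) eqxx mulr1 expr2.
  + rewrite (eq_bigr (fun l : 'I_j => e * g ^+ l)); last first.
      move=> l _; rewrite /B ltn_ord mulrC.
      rewrite (_ : alpha + 2^-1 - inv_exponent p = nu + 2^-1); last by rewrite addrAC.
      by rewrite (mulrC l%:R) powRrM powR_mulrn ?powR_ge0.
    rewrite -mulr_sumr; apply: (le_trans (ler_wpM2l (ltW e0) (geometric_sum_le j g1))).
    have gj0 : g ^+ j != 0 by rewrite expf_neq0// lt0r_neq0// (lt_trans ltr01 g1).
    rewrite eE mulrA divfK//.
    by rewrite ler_pdivrMr// /b ler_pdivrMr.
- move=> x; rewrite /f0 normrM (gtr0_norm e0).
  apply: (le_trans (ler_wpM2l (ltW e0) (Phi_bound x lj kj))).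
  rewrite (_ : e * _ = b * M * r ^+ j); last first.
    by rewrite /e; field; exact: lt0r_neq0 (sqrt2X_gt0 j).
  rewrite ler_wpM2r ?exprn_ge0 ?(ltW r0)// /b mulrAC ler_pdivrMr//.
  by rewrite ler_wpM2l ?(ltW a0)// lerDl.
- move=> x xW; rewrite /f0 (_ : Phi j k x = 0) ?mulr0//.
  apply: Phi_local => //.
  have x0k : `|k%:R - 2 ^+ j * x0| <= D.
    rewrite leNgt; apply/negP => h; move: pk; rewrite Phi_local// normr0.
    by apply/negP; rewrite -ltNge mulr_gt0// sqrt2X_gt0.
  have j0 : 0 < 2 ^+ j :> R by rewrite exprn_gt0.
  rewrite ltr_pdivrMr// in xW.
  have : `|2 ^+ j * x - 2 ^+ j * x0| = `|x - x0| * 2 ^+ j.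
    by rewrite -mulrBr normrM (gtr0_norm j0) mulrC.
  have := ler_distD k%:R (2 ^+ j * x) (2 ^+ j * x0).
  by rewrite (distrC (2 ^+ j * x) k%:R); lra.
- rewrite /f0 normrM (gtr0_norm e0).
  apply: le_trans (ler_wpM2l (ltW e0) pk).
  rewrite le_eqVlt; apply/orP; left; apply/eqP.
  by rewrite /e /b; field; rewrite lt0r_neq0 ?lt0r_neq0 ?sqrt2X_gt0.
Qed.

Lemma besov_ball_zero (f0 : {mfun measurableTypeR R >-> measurableTypeR R}) :
  (forall x, f0 x = 0) -> besov_ball l0 w alpha p q rho f0.
Proof.
move=> f00; split.
  by apply: (@eq_c01 _ (fun=> 0)) => [x _|]; [rewrite f00 | exact: c01_cst].
apply: (besov_norm_le (n := 0) (B := fun=> 0)) => //.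
- exact: ltW.
- move=> l ll; rewrite expr0n/= big1// => i _.
  rewrite /wcoef (_ : inner01 _ _ = 0) ?expr0n//.
  rewrite -[RHS](@int01_cst R 0); apply: eq_int01 => x _.
  by rewrite f00 mul0r.
- by rewrite big_ord0 ltW.
Qed.

End besov_bump.
End mra_theory.
End bumps.

(** * Pointwise convergence of wavelet series *)

Section reconstruction.
Context {R : realType}.
Local Notation mu := (@lebesgue_measure R).

Lemma c01_eps_delta (h : R -> R) x1 e : c01 h -> 0 <= x1 <= 1 -> 0 < e ->
  exists2 d, 0 < d & forall x, 0 <= x <= 1 -> `|x - x1| < d -> `|h x1 - h x| < e.
Proof.
move=> ch x101 e0.
have x1A : [set` `[(0 : R), 1]] x1 by rewrite /= in_itv.
have /cvgrPdist_lt/(_ _ e0) := ch x1.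
have -> : nbhs (x1 : subspace [set` `[(0 : R), 1]]) = within [set` `[(0 : R), 1]] (nbhs x1).
  by rewrite (nbhs_subspace_in x1A).
move=> /nbhs_ballP[d /= d0 dh].
exists d => // x x01 xd; apply: (dh x); last by rewrite /= in_itv.
by rewrite /ball/= distrC.
Qed.

Lemma c01_ae_zero (h : R -> R) : c01 h -> {ae mu, forall x, 0 <= x <= 1 -> h x = 0} ->
  forall x, 0 <= x <= 1 -> h x = 0.
Proof.
move=> ch [Z [mZ Z0 subZ]] x1 x101; apply: contrapT => hx1.
have n1 : 0 < `|h x1| by rewrite normr_gt0; exact/eqP.
have [d d0 hd] := c01_eps_delta ch x101 n1.
pose a := Num.max 0 (x1 - d); pose b := Num.min 1 (x1 + d).
have ab : a < b.
  have /andP[h0 h1] := x101.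
  by rewrite gt_max !lt_min ltr01 /=; apply/andP; split; [|apply/andP; split]; lra.
have subI : `]a, b[%classic `<=` Z.
  move=> x /=; rewrite in_itv/= gt_max lt_min => /andP[/andP[x0 xd] /andP[x1' xd']].
  apply: subZ => /= /(_ _) hx0.
  have x01 : 0 <= x <= 1 by rewrite !ltW.
  have := hd x x01; rewrite hx0// subr0 ltxx ltr_distl xd/= xd'.
  by move=> /(_ isT).
have : (mu (`]a, b[%classic : set (measurableTypeR R)) <= mu Z)%E.
  by apply: le_measure; rewrite ?inE//; exact: measurable_itv.
rewrite Z0 lebesgue_measure_itv/= lte_fin ab -EFinB lee_fin; lra.
Qed.

(** Precomposition with it turns an expansion valid on [[0,1]] into a continuous function on the
    line with the same bound. *)
Definition clamp01 (x : R) : R := Num.max 0 (Num.min 1 x).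

Lemma clamp01_id x : 0 <= x <= 1 -> clamp01 x = x.
Proof. by move=> /andP[x0 x1]; rewrite /clamp01 min_r// max_r. Qed.

Lemma clamp01_continuous : continuous clamp01.
Proof.
move=> x; rewrite /clamp01; apply: continuous_max; first exact: cvg_cst.
by apply: continuous_min; [exact: cvg_cst | exact: cvg_id].
Qed.

Lemma continuous_sumr (I : Type) (s : seq I) (F : I -> R -> R) :
  (forall i, continuous (F i)) -> continuous (fun x => \sum_(i <- s) F i x).
Proof.
move=> cF; elim: s => [|i s IH] x.
  by rewrite (_ : (fun y => _) = cst 0); [exact: cvg_cst | apply/funext => y; rewrite big_nil].
rewrite (_ : (fun y => _) = (fun y => F i y + \sum_(j <- s) F j y)).
  by apply: cvgD; [exact: cF | exact: IH].
by apply/funext => y; rewrite big_cons.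
Qed.

Lemma uniform_limit_continuous_at (G : R -> R) (Gn : nat -> R -> R) (e : nat -> R) :
  (forall n, continuous (Gn n)) -> (forall n x, `|G x - Gn n x| <= e n) ->
  e n @[n --> \oo] --> 0 -> continuous G.
Proof.
move=> cG Ge e0 x; apply/cvgrPdist_lt => eps eps0.
have eps3 : 0 < eps / 3 by rewrite divr_gt0.
have [n en] : exists n, e n < eps / 3.
  move: e0 => /cvgrPdist_lt/(_ _ eps3)[n _ /(_ n (leqnn n))].
  by rewrite sub0r normrN => /(le_lt_trans (ler_norm _)) h; exists n.
have := cG n x => /cvgrPdist_lt/(_ _ eps3); apply: filterS => y xy.
have h1 := Ge n x; have h2 := Ge n y.
have := ler_normD (G x - Gn n x) (Gn n x - Gn n y + (Gn n y - G y)).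
have := ler_normD (Gn n x - Gn n y) (Gn n y - G y).
rewrite (distrC (Gn n y)) (_ : G x - Gn n x + _ = G x - G y); last by ring.
lra.
Qed.

Section ball.
Variables (A l0 : nat) (w : nat -> nat -> R -> R) (D M C : R) (S : nat -> nat -> R -> R).
Hypothesis H : mra A l0 w D M C S.
Local Notation Phi := (dilate S).
Local Notation s2 := (Num.sqrt (2 : R)).
Variables (alpha rho : R) (p q : \bar R).
Hypotheses (p1 : (1 <= p)%E) (q1 : (1 <= q)%E) (rho0 : 0 < rho).
Let nu := alpha - inv_exponent p.
Hypothesis nu0 : 0 < nu.
Let r : R := 2 `^ (- nu).
Let g : R := 2 `^ (nu + 2^-1).

Lemma rate_gt0 : 0 < r. Proof. exact: powR_gt0. Qed.

Lemma rate_lt1 : r < 1.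
Proof.
rewrite -(powRr0 (2 : R)) /r /powR pnatr_eq0/= ltr_expR ltr_pM2r ?ln_gt0 ?ltr1n//.
by rewrite oppr_lt0.
Qed.

Let r0 := rate_gt0.
Let r1 := rate_lt1.

Let g0 : 0 < g. Proof. exact: powR_gt0. Qed.

Variable f : {mfun measurableTypeR R >-> measurableTypeR R}.
Hypothesis fB : besov_ball l0 w alpha p q rho f.

Lemma ball_c01 : c01 f. Proof. by case: fB. Qed.

(** A norm dominates each entry, across levels as well as inside a level. From here on [p] and [q]
    enter the upper bound only through this estimate and [nu]. *)
Lemma ball_coef l k : (l0 <= l)%N -> (k < level_size l0 l)%N ->
  `|wcoef w f l k| <= rho * g ^- l.
Proof.
move=> ll kl; have [_] := fB; rewrite /besov_norm => bn.
have := le_trans (seq_norm_ge _ l q1) bn; rewrite ll.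
set u := fun k => _ => h.
have h1 := @seq_norm_ge R p u k p1.
have gl : 2 `^ (l%:R * (alpha + 2^-1 - inv_exponent p)) = g ^+ l :> R.
  rewrite (_ : alpha + 2^-1 - inv_exponent p = nu + 2^-1); last by rewrite addrAC.
  by rewrite (mulrC l%:R) powRrM powR_mulrn ?powR_ge0.
have gl0 : 0 < g ^+ l by rewrite exprn_gt0.
rewrite gl gee0_abs in h; last by rewrite mule_ge0 ?lee_fin ?(ltW gl0)// /seq_norm Lnorm_ge0.
have : ((g ^+ l)%:E * `|u k| <= rho%:E)%E.
  by apply: le_trans h; rewrite lee_wpmul2l// lee_fin ltW.
by rewrite /u kl -EFinM lee_fin mulrC -ler_pdivlMr.
Qed.

Definition level_part l (x : R) : R :=
  \sum_(k < level_size l0 l) wcoef w f l k * w l k x.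

Lemma level_part_c01 l : (l0 <= l)%N -> c01 (level_part l).
Proof. by move=> ll; apply: c01_sum => k; apply: c01Z; exact: (wavelet_c01 H). Qed.

(** The coefficient of a scaling function collects its inner products with the wavelets of level
    [l]; by [mra_count] their absolute sum is at most [C] at every level. *)
Lemma level_part_expand l : (l0 <= l)%N -> exists b : nat -> R,
  (forall i, (i < 2 ^ l.+1)%N -> `|b i| <= rho * C * g ^- l) /\
  forall x, 0 <= x <= 1 -> level_part l x = \sum_(i < 2 ^ l.+1) b i * Phi l.+1 i x.
Proof.
move=> ll; have lS : (l0 < l.+1)%N by [].
have [c cE] : exists c : nat -> nat -> R, forall k, (k < level_size l0 l)%N ->
    forall x, 0 <= x <= 1 -> w l k x = \sum_(i < 2 ^ l.+1) c k i * Phi l.+1 i x.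
  have X k : exists c : nat -> R, (k < level_size l0 l)%N ->
    forall x, 0 <= x <= 1 -> w l k x = \sum_(i < 2 ^ l.+1) c i * Phi l.+1 i x.
    case: (boolP (k < level_size l0 l)%N) => kl; last by exists (fun=> 0).
    by have [c hc] := mra_wavelet H ll kl; exists c.
  by have [c hc] := choice X; exists c.
pose b i := \sum_(k < level_size l0 l) wcoef w f l k * c k i.
have bE x : 0 <= x <= 1 -> level_part l x = \sum_(i < 2 ^ l.+1) b i * Phi l.+1 i x.
  move=> x01; rewrite /level_part.
  rewrite (eq_bigr (fun k : 'I_(level_size l0 l) =>
    \sum_(i < 2 ^ l.+1) wcoef w f l k * c k i * Phi l.+1 i x)); last first.
    move=> k _; rewrite (cE k)// mulr_sumr.
    by apply: eq_bigr => i _; rewrite mulrA.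
  by rewrite exchange_big/=; apply: eq_bigr => i _; rewrite mulr_suml.
exists b; split => // i il; rewrite (Phi_coef H lS il bE).
rewrite inner01_lin; [|by move=> k; exact: (wavelet_c01 H)|exact: (Phi_c01 H)].
apply: (le_trans (ler_norm_sum _ _ _)).
apply: (@le_trans _ _ (\sum_(k < level_size l0 l)
    rho * g ^- l * `|inner01 (w l k) (Phi l.+1 i)|)).
  by apply: ler_sum => k _; rewrite normrM ler_wpM2r// ball_coef.
have gl0 : 0 <= g ^- l by rewrite invr_ge0 exprn_ge0// ltW.
rewrite -mulr_sumr (mulrAC rho C) ler_wpM2l ?(mra_count H)//.
by rewrite mulr_ge0// ltW.
Qed.

Lemma mra_C_ge0 : 0 <= C.
Proof.
apply: le_trans (mra_count H (leqnn l0) (expn_gt0 2 _)).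
exact: sumr_ge0.
Qed.

Definition level_bound : R := rho * C * ((2 * D + 1) * (s2 * M)).

Lemma level_bound_ge0 : 0 <= level_bound.
Proof.
have D0 := mra_D H; have M0 := mra_M_ge0 H; have C0 := mra_C_ge0.
by rewrite /level_bound !mulr_ge0// ?addr_ge0 ?mulr_ge0// ?ltW// sqrt2_gt0.
Qed.

Lemma expand_le l (b : nat -> R) x : (l0 <= l)%N ->
  (forall i, (i < 2 ^ l.+1)%N -> `|b i| <= rho * C * g ^- l) ->
  `|\sum_(i < 2 ^ l.+1) b i * Phi l.+1 i x| <= level_bound * r ^+ l.
Proof.
move=> ll b_le; have lS : (l0 < l.+1)%N by [].
apply: (le_trans (ler_norm_sum _ _ _)).
apply: (@le_trans _ _ (\sum_(i < 2 ^ l.+1) rho * C * g ^- l * `|Phi l.+1 i x|)).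
  by apply: ler_sum => i _; rewrite normrM ler_wpM2r// b_le.
have gl0 : 0 <= g ^- l by rewrite invr_ge0 exprn_ge0// ltW.
have c0 : 0 <= rho * C * g ^- l by rewrite !mulr_ge0 ?mra_C_ge0// ltW.
rewrite -mulr_sumr; apply: (le_trans (ler_wpM2l c0 (sum_Phi_le H x lS))).
rewrite /level_bound -(rate_half nu) exprS le_eqVlt; apply/orP; left; apply/eqP; ring.
Qed.

Let expansion : exists b : nat -> nat -> R, forall l, (l0 <= l)%N ->
  (forall i, (i < 2 ^ l.+1)%N -> `|b l i| <= rho * C * g ^- l) /\
  forall x, 0 <= x <= 1 ->
    level_part l x = \sum_(i < 2 ^ l.+1) b l i * Phi l.+1 i x.
Proof.
have X l : exists b : nat -> R, (l0 <= l)%N ->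
  (forall i, (i < 2 ^ l.+1)%N -> `|b i| <= rho * C * g ^- l) /\
  forall x, 0 <= x <= 1 ->
    level_part l x = \sum_(i < 2 ^ l.+1) b i * Phi l.+1 i x.
  case: (boolP (l0 <= l)%N) => ll; last by exists (fun=> 0).
  by have [b hb] := level_part_expand ll; exists b.
by have [b hb] := choice X; exists b.
Qed.

Definition partial_sum n (x : R) : R :=
  \sum_(l < n) (if (l0 <= l)%N then level_part l x else 0).

Lemma partial_sum_c01 n : c01 (partial_sum n).
Proof.
apply: c01_sum => l; case: (boolP (l0 <= l)%N) => ll; last exact: c01_cst.
exact: level_part_c01.
Qed.

Lemma partial_sum_coef n l k : (l0 <= l)%N -> (l < n)%N -> (k < level_size l0 l)%N ->
  inner01 (partial_sum n) (w l k) = wcoef w f l k.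
Proof.
move=> ll ln kl; have cw := wavelet_c01 H ll kl.
rewrite /partial_sum inner01_suml//; last first.
  move=> i; case: (boolP (l0 <= i)%N) => li; last exact: c01_cst.
  exact: level_part_c01.
have lev (i : nat) : (l0 <= i)%N -> inner01 (level_part i) (w l k) =
    \sum_(j < level_size l0 i) wcoef w f i j * ((i == l) && (j == k :> nat))%:R.
  move=> li; rewrite inner01_lin//; last by move=> j; exact: (wavelet_c01 H).
  by apply: eq_bigr => j _; rewrite (mra_ortho_wavelet H).
rewrite (bigD1 (Ordinal ln))//= ll lev// [X in _ + X]big1 => [|i]; last first.
  rewrite -val_eqE/= => il; case: (boolP (l0 <= i)%N) => li; last first.
    rewrite -[RHS](@int01_cst R 0); apply: eq_int01 => x _; exact: mul0r.
  by rewrite lev// big1// => j _; rewrite (negbTE il) mulr0.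
rewrite addr0 eqxx/= (bigD1 (Ordinal kl))//= eqxx mulr1 big1 ?addr0// => j.
by rewrite -val_eqE/= => /negbTE ->; rewrite mulr0.
Qed.

Definition series_bound : R := level_bound / (1 - r).

Lemma series_bound_ge0 : 0 <= series_bound.
Proof. by rewrite divr_ge0 ?level_bound_ge0// subr_ge0 ltW. Qed.

(** The series converges uniformly to a continuous function with the same wavelet coefficients as
    [f]. By completeness the difference vanishes almost everywhere, and by continuity everywhere on
    [[0,1]], so that the tail of the series bounds the error. *)
Lemma ball_reconstruct n x : 0 <= x <= 1 ->
  `|f x - partial_sum n x| <= series_bound * r ^+ n.
Proof.
have [b hb] := expansion.
pose v l (x : R) := if (l0 <= l)%N then \sum_(i < 2 ^ l.+1) b l i * Phi l.+1 i (clamp01 x) else 0.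
have v_le l y : `|v l y| <= level_bound * r ^+ l.
  rewrite /v; case: ifPn => ll; first by apply: expand_le => //; exact: (hb l ll).1.
  by rewrite normr0 mulr_ge0 ?level_bound_ge0// exprn_ge0// ltW.
have cv l : continuous (v l).
  rewrite /v; case: (boolP (l0 <= l)%N) => ll; last exact: cst_continuous.
  move=> y; apply: (continuous_comp (f := clamp01)
      (g := fun z => \sum_(i < 2 ^ l.+1) b l i * Phi l.+1 i z)).
    exact: clamp01_continuous.
  apply: continuous_sumr => i z; apply: cvgM; first exact: cvg_cst.
  by apply: (Phi_continuous H).
pose G n y := \sum_(l < n) v l y.
have cG m : continuous (G m).
  by apply: continuous_sumr => i; exact: cv.
have GS m y : 0 <= y <= 1 -> G m y = partial_sum m y.
  move=> y01; apply: eq_bigr => l _; rewrite /v; case: ifPn => // ll.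
  by rewrite clamp01_id// (hb l ll).2.
have r1' : 0 < 1 - r by rewrite subr_gt0.
have tail m k y : `|G (m + k)%N y - G m y| <= series_bound * r ^+ m.
  rewrite /G big_split_ord/= addrAC subrr add0r.
  apply: (le_trans (ler_norm_sum _ _ _)).
  apply: (@le_trans _ _ (\sum_(i < k) level_bound * r ^+ m * r ^+ i)).
    by apply: ler_sum => i _; rewrite -mulrA -exprD; exact: v_le.
  rewrite -mulr_sumr /series_bound [leRHS]mulrAC ler_wpM2l ?geometric_lt1_le// ?(ltW r0)//.
  by rewrite mulr_ge0 ?level_bound_ge0// exprn_ge0// ltW.
pose e m := series_bound * r ^+ m.
have e0 : e n @[n --> \oo] --> 0.
  rewrite -[X in _ --> X](mulr0 series_bound); apply: cvgM; first exact: cvg_cst.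
  by apply: cvg_expr; rewrite ger0_norm// ltW.
have e_ge0 m : 0 <= e m by rewrite mulr_ge0 ?series_bound_ge0// exprn_ge0// ltW.
have cvG y : cvgn (fun m => G m y).
  have cvn : cvgn [normed series (fun l => v l y)].
    apply: (series_le_cvg (v_ := geometric level_bound r)).
    - by move=> l; exact: normr_ge0.
    - by move=> l; rewrite /geometric/= mulr_ge0 ?level_bound_ge0// exprn_ge0// ltW.
    - by move=> l; exact: v_le.
    - by apply: is_cvg_geometric_series; rewrite ger0_norm// ltW.
  have := normed_cvg cvn; rewrite (_ : series _ = (fun m => G m y))//.
  by apply/funext => m; rewrite /series/= big_mkord.
pose Ginf (y : R) : R := limn (fun m => G m y).
have Gtail m y : `|Ginf y - G m y| <= e m.
  have : (fun k => `|G (m + k)%N y - G m y|) k @[k --> \oo] --> `|Ginf y - G m y|.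
    apply: cvg_norm; apply: cvgB; last exact: cvg_cst.
    have : (G k y @[k --> \oo]) --> Ginf y by exact: (cvG y).
    rewrite -(cvg_shiftn m) /= => h; move: h; apply: cvg_trans.
    by apply: near_eq_cvg; near=> k; rewrite addnC.
  move=> h; rewrite -(cvg_lim _ h)//; apply: limr_le.
    by apply/cvg_ex; eexists; exact: h.
  by near=> k; exact: tail.
have cGinf : continuous Ginf := uniform_limit_continuous_at cG Gtail e0.
pose h : R -> R := fun y => f y - Ginf y.
have ch : c01 h by apply: c01B; [exact: ball_c01 | exact: c01_continuous].
have cGi : c01 Ginf by exact: c01_continuous.
have coef l k : (l0 <= l)%N -> (k < level_size l0 l)%N -> wcoef w h l k = 0.
  move=> ll kl; have cw := wavelet_c01 H ll kl.
  have [Mw wM] := c01_bounded cw.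
  have Mw0 : 0 <= Mw by apply: le_trans (wM 0 _); rewrite ?normr_ge0// lexx ler01.
  (* The coefficient of [h] is that of [partial_sum m - Ginf], uniformly small on [[0,1]], as soon
     as [m] exceeds [l]. *)
  have bound m : (l < m)%N -> `|wcoef w h l k| <= e m * Mw.
    move=> lm; have := partial_sum_coef ll lm kl; rewrite /wcoef /h => cE.
    rewrite (inner01Bl ball_c01 cGi cw) -cE -(inner01Bl (@partial_sum_c01 m) cGi cw).
    rewrite inner01E; apply: int01_norm_le.
      by apply: c01M => //; apply: c01B => //; exact: partial_sum_c01.
    move=> y y01; rewrite normrM ler_pM// ?wM// -GS// distrC; exact: Gtail.
  apply/eqP; rewrite -normr_le0.
  have lim0 : e m * Mw @[m --> \oo] --> 0.
    by rewrite -[X in _ --> X](mul0r Mw); apply: cvgM => //; exact: cvg_cst.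
  rewrite -(cvg_lim _ lim0)//; apply: limr_ge; first by apply/cvg_ex; exists 0.
  by near=> m; apply: bound; near: m; exact: nbhs_infty_gt.
have h0 : forall y, 0 <= y <= 1 -> h y = 0.
  apply: c01_ae_zero => //.
  apply: (mra_complete H) coef.
    by have /measurable_int := c01_integrable ch; move/measurable_EFinP.
  have := c01_integrable (c01M ch ch).
  by apply: eq_integrable => [|z _]; [exact: measurable_unit_interval | rewrite expr2].
move=> x01; have := h0 x x01; rewrite /h => /eqP; rewrite subr_eq0 => /eqP ->.
by rewrite -GS//; exact: Gtail.
Unshelve. all: by end_near.
Qed.

End ball.
End reconstruction.

(** * Local approximation of the sine of a function of the ball by polynomials *)

Lemma smooth_near_sum {R : realType} A n (a t c M : R) (U : 'I_n -> R -> R) :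
  0 <= t -> 0 <= M -> 0 <= c -> (forall i : 'I_n, smooth A (c * M) (U i)) ->
  smooth A ((2 * t + 1) * (c * M))
    (fun y => \sum_(i < n | `|i%:R - a| <= t) U i y).
Proof.
move=> t0 M0 c0 sU.
apply: smooth_le (smooth_sum _ (fun i _ => sU i)) _.
rewrite big_mkcond/= (eq_bigr (fun i : 'I_n => (`|i%:R - a| <= t)%R%:R * (c * M))).
  by rewrite -mulr_suml ler_wpM2r ?mulr_ge0// count_near.
by move=> i _; case: ifP => _; rewrite ?mul1r ?mul0r.
Qed.

Section smooth_approximation.
Context {R : realType}.
Variables (A l0 : nat) (w : nat -> nat -> R -> R) (D M C : R) (S : nat -> nat -> R -> R).
Hypothesis H : mra A l0 w D M C S.
Local Notation Phi := (dilate S).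
Local Notation s2 := (Num.sqrt (2 : R)).
Variables (alpha rho x0 W : R) (p q : \bar R).
Hypotheses (p1 : (1 <= p)%E) (q1 : (1 <= q)%E) (rho0 : 0 < rho).
Let nu := alpha - inv_exponent p.
Hypotheses (nu0 : 0 < nu) (nuA : nu < A%:R) (W0 : 0 <= W).
Let r : R := 2 `^ (- nu).
Let r0 : 0 < r := rate_gt0 alpha p.
Let r1 : r < 1 := rate_lt1 nu0.

Definition level_smooth : R :=
  (2 * (D + 2 * W) + 1) * (rho * C * s2 * (2 ^+ A * M)).

Lemma level_smooth_ge0 : 0 <= level_smooth.
Proof.
have D0 := mra_D H; have M0 := mra_M_ge0 H; have C0 := mra_C_ge0 H.
have s0 := @sqrt2_gt0 R.
by rewrite /level_smooth mulr_ge0 ?addr_ge0 ?mulr_ge0 ?addr_ge0 ?mulr_ge0 ?exprn_ge0// ltW.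
Qed.

Variable f : {mfun measurableTypeR R >-> measurableTypeR R}.
Hypothesis fB : besov_ball l0 w alpha p q rho f.

Definition part l (x : R) : R := if (l0 <= l)%N then level_part l0 w f l x else 0.

(** Only the scaling functions with [|i - a| <= D + 2 W] are active within [W / 2 ^+ l] of [x0].
    Dropping the others leaves a number of terms bounded independently of [l], hence a uniform bound
    on the whole line. *)
Lemma part_smooth l : exists V, smooth A (level_smooth * r ^+ l) V /\
  forall x, 0 <= x <= 1 -> `|x - x0| <= W / 2 ^+ l -> part l x = V (2 ^+ l * (x - x0)).
Proof.
have M0 := mra_M_ge0 H; have C0 := mra_C_ge0 H; have D0 := mra_D H.
rewrite /part; case: (boolP (l0 <= l)%N) => ll; last first.
  exists (fun=> 0); split => //; apply: smooth_le (smooth_cst A 0) _.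
  by rewrite normr0 mulr_ge0 ?level_smooth_ge0// exprn_ge0// ltW.
have lS : (l0 < l.+1)%N by [].
have [b [b_le bE]] := level_part_expand H p1 q1 rho0 fB ll.
pose a : R := 2 ^+ l.+1 * x0.
pose U (i : 'I_(2 ^ l.+1)) y := b i * s2 ^+ l.+1 * S l.+1 i (2 * y + (a - i%:R)).
exists (fun y => \sum_(i < 2 ^ l.+1 | `|i%:R - a| <= D + 2 * W) U i y); split.
  apply: (@smooth_le _ _ ((2 * (D + 2 * W) + 1) * ((rho * C * (s2 * r ^+ l)) * (2 ^+ A * M)))).
    apply: smooth_near_sum.
    - by rewrite addr_ge0// mulr_ge0.
    - by rewrite mulr_ge0// exprn_ge0.
    - by rewrite !mulr_ge0 ?exprn_ge0// ?ltW ?sqrt2_gt0.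
    move=> i; apply: smooth_le (smoothZ _ (smooth_affine _ _ _ (mra_smooth H lS (ltn_ord i)))) _.
    - by rewrite ger0_norm.
    - by rewrite ler1n.
    rewrite ler_wpM2r ?mulr_ge0 ?exprn_ge0// normrM.
    rewrite (ger0_norm (ltW (@sqrt2X_gt0 R l.+1))).
    apply: (le_trans (ler_wpM2r (ltW (@sqrt2X_gt0 R l.+1)) (b_le _ (ltn_ord i)))).
    rewrite -(rate_half nu l) le_eqVlt; apply/orP; left; apply/eqP.
    by rewrite exprS; ring.
  by rewrite /level_smooth le_eqVlt; apply/orP; left; apply/eqP; ring.
move=> x x01 xW; rewrite bE// (bigID (fun i : 'I__ => `|i%:R - a| <= D + 2 * W))/=.
rewrite [X in _ + X]big1 ?addr0 => [|i]; last first.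
  rewrite -ltNge => iD; rewrite (Phi_local H lS (ltn_ord i)) ?mulr0//.
  have h : `|2 ^+ l.+1 * (x - x0)| <= 2 * W.
    rewrite normrM ger0_norm ?exprn_ge0// exprS -mulrA ler_wpM2l// mulrC.
    by rewrite -ler_pdivlMr// exprn_gt0.
  have := ler_normD (i%:R - 2 ^+ l.+1 * x) (2 ^+ l.+1 * (x - x0)).
  rewrite (_ : _ + _ = i%:R - a); last by rewrite /a; ring.
  lra.
apply: eq_bigr => i _; rewrite /U /dilate -mulrA; congr (_ * (_ * S _ _ _)).
by rewrite /a exprS; ring.
Qed.

Definition sum_smooth : R := level_smooth / (1 - r).

(** Seen at the finer scale [2 ^- n], a part of level [l < n] is composed with a contraction of
    ratio [2 ^+ l / 2 ^+ n], which does not increase its derivatives; the factors [r ^+ l] are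
    summable. *)
Lemma partial_sum_smooth n : exists U, smooth A sum_smooth U /\
  forall x, 0 <= x <= 1 -> `|x - x0| <= W / 2 ^+ n ->
    partial_sum l0 w f n x = U (2 ^+ n * (x - x0)).
Proof.
have [V hV] := choice part_smooth.
exists (fun y => \sum_(l < n) V l ((2 ^+ l / 2 ^+ n) * y + 0)); split.
  apply: (@smooth_le _ _ (\sum_(l < n) level_smooth * r ^+ l)).
    apply: smooth_sum => l _.
    apply: smooth_le (smooth_affine (K := 1) _ _ _ (hV l).1) _ => //.
      rewrite ger0_norm ?divr_ge0 ?exprn_ge0// ler_pdivrMr ?exprn_gt0// mul1r.
      by rewrite ler_eXn2l ?ltr1n// ltnW.
    by rewrite expr1n mul1r.
  by rewrite -mulr_sumr ler_wpM2l ?level_smooth_ge0// geometric_lt1_le ?(ltW r0).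
move=> x x01 xW; apply: eq_bigr => l _.
have l2 : 2 ^+ n != 0 :> R by rewrite expf_neq0// pnatr_eq0.
rewrite addr0 mulrA divfK//.
apply: (hV l).2 => //; apply: (le_trans xW).
rewrite ler_wpM2l// lef_pV2 ?posrE ?exprn_gt0//.
by rewrite ler_eXn2l ?ltr1n// ltnW.
Qed.

Definition increment_smooth : R :=
  2 ^+ A * (trig_bound A sum_smooth * small_trig_bound A level_smooth) *+ 2.

(* With [a] and [b] the partial sum and the increment, [sin (a + b) - sin a] is
   [sin a (cos b - 1) + cos a sin b], which is smooth at scale [2^-l] and of size
   [r^l] because [b] is. *)
Lemma increment_taylor v l : `|v| <= 1 -> exists P : {poly R}, (size P <= A)%N /\
  forall x, 0 <= x <= 1 -> `|x - x0| <= W / 2 ^+ l ->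
    `|sin (v * partial_sum l0 w f l.+1 x) - sin (v * partial_sum l0 w f l x) - P.[x]|
      <= increment_smooth * r ^+ l * (2 ^+ l * `|x - x0|) ^+ A.
Proof.
move=> v1; have [V [sV VE]] := part_smooth l.
have [U [sU UE]] := partial_sum_smooth l.
have rl0 : 0 < r ^+ l by rewrite exprn_gt0.
have rl1 : 0 <= r ^+ l <= 1 by rewrite (ltW rl0) exprn_ile1// ltW.
have svU : smooth A sum_smooth (fun y => v * U y).
  apply: smooth_le (smoothZ v sU) _.
  by rewrite -[leRHS]mul1r ler_wpM2r// (smooth_ge0 sU).
(* The increment, of size [r ^+ l], is normalized to order one; [smooth_small_trig] with
   [e = r ^+ l] then returns the factor [r ^+ l]. *)
have svV : smooth A level_smooth (fun y => (v / r ^+ l) * V y).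
  apply: smooth_le (smoothZ _ sV) _.
  rewrite normrM normfV (gtr0_norm rl0).
  have -> : `|v| / r ^+ l * (level_smooth * r ^+ l) = `|v| * level_smooth.
    by field; rewrite lt0r_neq0.
  by rewrite ler_piMl// level_smooth_ge0.
have [s1 c1] := smooth_trig svU.
have [s3 c3] := smooth_small_trig svV rl1.
have sT := smoothD (smoothM s1 c3) (smoothM c1 s3).
have [P [sP PE]] := smooth_taylor sT.
exists (P \Po ((2 ^+ l) *: ('X - x0%:P))); split.
  apply: leq_trans (size_comp_poly_leq _ _) _.
  have s2 : (size (2 ^+ l *: ('X - x0%:P)) <= 2)%N.
    by rewrite (leq_trans (size_scale_leq _ _))// size_XsubC.
  apply: leq_trans (_ : ((size P).-1 * 1).+1 <= A)%N; last first.
    by rewrite muln1; move: sP (mra_A H); case: (size P).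
  rewrite ltnS leq_mul2l; apply/orP; right.
  by move: s2; case: (size _) => // n; rewrite /= ltnS.
move=> x x01 xW; set y := 2 ^+ l * (x - x0).
have -> : (P \Po (2 ^+ l *: ('X - x0%:P))).[x] = P.[y].
  by rewrite horner_comp hornerZ hornerXsubC.
have := PE y.
have -> : partial_sum l0 w f l.+1 x = partial_sum l0 w f l x + part l x.
  by rewrite /partial_sum big_ord_recr.
rewrite UE// VE// -/y (mulrDr v) sinD.
have -> : r ^+ l * (v / r ^+ l * V y) = v * V y by field; rewrite lt0r_neq0.
move=> h; apply: (le_trans _ (le_trans h _)).
  rewrite le_eqVlt; apply/orP; left; apply/eqP; congr `|_|; ring.
rewrite /y normrM (ger0_norm (exprn_ge0 l (ler0n _ 2))).
rewrite ler_wpM2r ?exprn_ge0 ?mulr_ge0 ?exprn_ge0//.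
by rewrite /increment_smooth le_eqVlt; apply/orP; left; apply/eqP; ring.
Qed.

Lemma increment_smooth_ge0 : 0 <= increment_smooth.
Proof.
have K0 := level_smooth_ge0.
have sK : smooth A level_smooth (fun=> 0).
  by apply: smooth_le (smooth_cst A 0) _; rewrite normr0.
have sT : smooth A sum_smooth (fun=> 0).
  apply: smooth_le (smooth_cst A 0) _.
  by rewrite normr0 divr_ge0// subr_ge0 ltW.
have := smooth_ge0 (smooth_trig sT).1.
have h11 : 0 <= (1 : R) <= 1 by rewrite ler01 lexx.
have := smooth_ge0 (smooth_small_trig sK h11).1.
by rewrite mul1r => h1 h2; rewrite /increment_smooth mulrn_wge0// !mulr_ge0 ?exprn_ge0.
Qed.

Definition ball_bound : R := series_bound D M C alpha rho p.

Lemma ball_bounded x : 0 <= x <= 1 -> `|f x| <= ball_bound.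
Proof.
move=> x01; have := ball_reconstruct H p1 q1 rho0 nu0 fB 0 x01.
by rewrite /ball_bound /partial_sum big_ord0 subr0 expr0 mulr1.
Qed.

Definition approx_bound : R :=
  ball_bound + increment_smooth * W ^+ A / (r * 2 ^+ A - 1).

Lemma sin_approx v J : `|v| <= 1 -> exists Q : {poly R}, (size Q <= A)%N /\
  forall x, 0 <= x <= 1 -> `|x - x0| <= W / 2 ^+ J ->
    `|sin (v * f x) - Q.[x]| <= approx_bound * r ^+ J.
Proof.
move=> v1; have [P hP] := choice (fun l => increment_taylor l v1).
exists (\sum_(l < J) P l); split.
  apply: (leq_trans (size_sum _ _ _)).
  by apply/bigmax_leqP => l _; exact: (hP l).1.
move=> x x01 xW.
(* This is [nu < A]. The Taylor errors at distance [W / 2 ^+ J] form a geometric sum of ratio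
   [r * 2 ^+ A], dominated by its last terms, so that it is of order [r ^+ J]. *)
have r2 : 1 < r * 2 ^+ A.
  rewrite /r -powR_mulrn// -powRD; last by rewrite pnatr_eq0 implybT.
  rewrite /powR pnatr_eq0/= expR_gt1 mulr_gt0 ?ln_gt0 ?ltr1n//.
  by rewrite addrC subr_gt0.
pose u n := sin (v * partial_sum l0 w f n x).
have u0 : u 0%N = 0 by rewrite /u /partial_sum big_ord0 mulr0 sin0.
have uJ : u J = \sum_(l < J) (u l.+1 - u l).
  by rewrite -(big_mkord xpredT (fun l => u l.+1 - u l)) telescope_sumr// u0 subr0.
rewrite horner_sum (_ : _ - _ = (sin (v * f x) - u J) +
  \sum_(l < J) (u l.+1 - u l - (P l).[x])); last first.
  by rewrite sumrB -uJ addrA subrK.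
apply: (le_trans (ler_normD _ _)); rewrite /approx_bound mulrDl; apply: lerD.
  apply: (le_trans (sin_lipschitz _ _)); rewrite -mulrBr normrM.
  have := ball_reconstruct H p1 q1 rho0 nu0 fB J x01; apply: le_trans.
  by rewrite ler_piMl.
apply: (le_trans (ler_norm_sum _ _ _)).
have J2 : 2 ^+ J != 0 :> R by rewrite expf_neq0// pnatr_eq0.
apply: (@le_trans _ _ (\sum_(l < J)
    increment_smooth * (W / 2 ^+ J) ^+ A * (r * 2 ^+ A) ^+ l)).
  apply: ler_sum => l _; apply: (le_trans ((hP l).2 x x01 _)).
    apply: (le_trans xW); rewrite ler_wpM2l// lef_pV2 ?posrE ?exprn_gt0//.
    by rewrite ler_eXn2l ?ltr1n// ltnW.
  have h : (2 ^+ l * `|x - x0|) ^+ A <= (2 ^+ A) ^+ l * (W / 2 ^+ J) ^+ A.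
    rewrite -exprM mulnC exprM -exprMn lerXn2r ?nnegrE ?mulr_ge0 ?exprn_ge0 ?invr_ge0 ?exprn_ge0//.
    by rewrite ler_wpM2l ?exprn_ge0.
  rewrite [(r * _) ^+ l]exprMn -!mulrA ler_wpM2l ?increment_smooth_ge0//.
  rewrite mulrCA ler_wpM2l ?exprn_ge0 ?(ltW r0)//.
  by rewrite (mulrC (_ ^+ A) (_ ^+ l)).
rewrite -mulr_sumr.
have c0 : 0 <= increment_smooth * (W / 2 ^+ J) ^+ A.
  by rewrite mulr_ge0 ?increment_smooth_ge0// exprn_ge0// divr_ge0// exprn_ge0.
apply: (le_trans (ler_wpM2l c0 (geometric_sum_le J r2))).
rewrite le_eqVlt; apply/orP; left; apply/eqP.
rewrite [(_ / 2 ^+ J) ^+ A]exprMn exprVn [(r * _) ^+ J]exprMn -!exprM (mulnC A J).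
by field; rewrite expf_neq0 ?pnatr_eq0// subr_eq0 gt_eqF.
Qed.

End smooth_approximation.

(** * The reproducing kernel at the point of estimation *)

Section kernel.
Context {R : realType}.
Variables (A l0 : nat) (w : nat -> nat -> R -> R) (D M C : R) (S : nat -> nat -> R -> R).
Hypothesis H : mra A l0 w D M C S.
Local Notation Phi := (dilate S).
Local Notation s2 := (Num.sqrt (2 : R)).
Variable x0 : R.
Hypothesis x01 : 0 <= x0 <= 1.

Definition rkernel J (x : R) : R := \sum_(i < 2 ^ J) Phi J i x0 * Phi J i x.

Definition kernel_bound : R := (2 * D + 1) * M ^+ 2.

Lemma kernel_bound_ge0 : 0 <= kernel_bound.
Proof. by rewrite mulr_ge0 ?addr_ge0 ?mulr_ge0 ?exprn_ge0 ?(mra_D H) ?(mra_M_ge0 H). Qed.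

Lemma kernel_continuous J : (l0 < J)%N -> continuous (rkernel J).
Proof.
move=> lJ; apply: continuous_sumr => i x; apply: cvgM; first exact: cvg_cst.
by apply: (Phi_continuous H).
Qed.

Lemma kernel_le J x : (l0 < J)%N -> `|rkernel J x| <= kernel_bound * 2 ^+ J.
Proof.
move=> lJ; have M0 := mra_M_ge0 H; have s0 := ltW (@sqrt2X_gt0 R J).
apply: (le_trans (ler_norm_sum _ _ _)).
apply: (@le_trans _ _ (\sum_(i < 2 ^ J) s2 ^+ J * M * `|Phi J i x|)).
  by apply: ler_sum => i _; rewrite normrM ler_wpM2r// (Phi_bound H).
rewrite -mulr_sumr.
apply: (le_trans (ler_wpM2l (mulr_ge0 s0 M0) (sum_Phi_le H x lJ))).
by rewrite -sqrt2X /kernel_bound le_eqVlt; apply/orP; left; apply/eqP; ring.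
Qed.

Lemma kernel_local J x : (l0 < J)%N -> 2 * D / 2 ^+ J < `|x - x0| -> rkernel J x = 0.
Proof.
move=> lJ xD; apply: big1 => i _.
case: (ltP D `|i%:R - 2 ^+ J * x0|) => [h|h0].
  by rewrite (Phi_local H lJ _ h) ?mul0r.
case: (ltP D `|i%:R - 2 ^+ J * x|) => [h|h1].
  by rewrite (Phi_local H lJ _ h) ?mulr0.
exfalso; move: xD; apply/negP; rewrite -leNgt.
rewrite ler_pdivlMr ?exprn_gt0// -(ger0_norm (exprn_ge0 J (ler0n R 2))) -normrM.
rewrite (_ : _ * _ = (i%:R - 2 ^+ J * x0) - (i%:R - 2 ^+ J * x)); last by ring.
by apply: (le_trans (ler_normB _ _)); lra.
Qed.

Lemma kernel_c01 J : (l0 < J)%N -> c01 (rkernel J).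
Proof. by move=> lJ; apply: c01_continuous; exact: kernel_continuous. Qed.

Lemma poly_c01 (Q : {poly R}) : c01 (fun x => Q.[x]).
Proof. by apply: c01_continuous => x; exact: continuous_horner. Qed.

Lemma kernel_reproduces J (Q : {poly R}) : (l0 < J)%N -> (size Q <= A)%N ->
  int01 (fun x => rkernel J x * Q.[x]) = Q.[x0].
Proof.
move=> lJ sQ.
have [c cE] : exists c : nat -> R, forall x, 0 <= x <= 1 ->
    Q.[x] = \sum_(k < 2 ^ J) c k * Phi J k x.
  have X d : exists c : nat -> R, (d < A)%N -> forall x, 0 <= x <= 1 ->
      x ^+ d = \sum_(k < 2 ^ J) c k * Phi J k x.
    case: (boolP (d < A)%N) => dA; last by exists (fun=> 0).
    by have [c hc] := mra_poly H lJ dA; exists c.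
  have [c hc] := choice X.
  exists (fun k => \sum_(d < size Q) Q`_d * c d k) => x xx.
  rewrite horner_coef (eq_bigr (fun d : 'I_(size Q) =>
    \sum_(k < 2 ^ J) Q`_d * c d k * Phi J k x)); last first.
    move=> d _; rewrite (hc d _ x xx) ?(leq_trans (ltn_ord d))// mulr_sumr.
    by apply: eq_bigr => k _; rewrite mulrA.
  by rewrite exchange_big/=; apply: eq_bigr => k _; rewrite mulr_suml.
rewrite (cE x0 x01) -inner01E inner01_lin; last 2 first.
- by move=> k; apply: (Phi_c01 H).
- exact: poly_c01.
apply: eq_bigr => k _; rewrite mulrC; congr (_ * _).
by rewrite inner01C -(Phi_coef H lJ (ltn_ord k) cE).
Qed.

Lemma kernel_sqr J : (l0 < J)%N ->
  int01 (fun x => rkernel J x ^+ 2) <= 4 * D * kernel_bound ^+ 2 * 2 ^+ J.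
Proof.
move=> lJ; apply: le_trans (ler_norm _) _.
have D0 := mra_D H; have K0 := kernel_bound_ge0.
have J0 : 0 < 2 ^+ J :> R by rewrite exprn_gt0.
apply: le_trans (int01_local (t := x0) (r := 2 * D / 2 ^+ J)
  (c := (kernel_bound * 2 ^+ J) ^+ 2) _ _ _ _ _) _.
- apply: (@eq_c01 _ (fun x => rkernel J x * rkernel J x)); first by move=> x _; rewrite expr2.
  by apply: c01M; exact: kernel_c01.
- by rewrite divr_ge0 ?mulr_ge0// ltW.
- by rewrite exprn_ge0// mulr_ge0// ltW.
- move=> x _; rewrite normrX lerXn2r ?nnegrE ?(mulr_ge0 K0 (ltW J0))//.
  exact: kernel_le.
- by move=> x _ xD; rewrite kernel_local// expr0n.
by rewrite le_eqVlt; apply/orP; left; apply/eqP; field; rewrite lt0r_neq0.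
Qed.

(** As the kernel reproduces [Q], the bias involves [g - Q] only. The kernel has height of order
    [2 ^+ J] on a set of width of order [2 ^- J], so its absolute integral is bounded. *)
Lemma kernel_bias J (g : R -> R) (Q : {poly R}) e : (l0 < J)%N -> (size Q <= A)%N ->
  c01 g -> 0 <= e ->
  (forall x, 0 <= x <= 1 -> `|x - x0| <= 2 * D / 2 ^+ J -> `|g x - Q.[x]| <= e) ->
  `|int01 (fun x => rkernel J x * g x) - g x0| <= (4 * D * kernel_bound + 1) * e.
Proof.
move=> lJ sQ cg e0 ge; have ck := kernel_c01 lJ; have cQ := @poly_c01 Q.
have D0 := mra_D H; have K0 := kernel_bound_ge0.
have J0 : 0 < 2 ^+ J :> R by rewrite exprn_gt0.
have W0 : 0 <= 2 * D / 2 ^+ J by rewrite divr_ge0 ?mulr_ge0// ltW.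
have -> : int01 (fun x => rkernel J x * g x) - g x0 =
    int01 (fun x => rkernel J x * (g x - Q.[x])) - (g x0 - Q.[x0]).
  rewrite -(kernel_reproduces lJ sQ).
  rewrite (@eq_int01 _ (fun x => rkernel J x * (g x - Q.[x]))
    (fun x => rkernel J x * g x + (-1) * (rkernel J x * Q.[x]))); last first.
    by move=> x _; ring.
  rewrite int01D ?int01Z; [ring| | |]; try exact: c01M.
  by apply: c01Z; exact: c01M.
apply: (le_trans (ler_normB _ _)); rewrite mulrDl mul1r; apply: lerD; last first.
  by apply: ge; rewrite ?subrr ?normr0.
apply: le_trans (int01_local (t := x0) (r := 2 * D / 2 ^+ J)
  (c := (kernel_bound * 2 ^+ J) * e) _ _ _ _ _) _ => //.
- by apply: c01M => //; exact: c01B.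
- exact: mulr_ge0 (mulr_ge0 K0 (ltW J0)) e0.
- move=> x xx; case: (leP `|x - x0| (2 * D / 2 ^+ J)) => h; last first.
    by rewrite kernel_local// mul0r normr0; exact: mulr_ge0 (mulr_ge0 K0 (ltW J0)) e0.
  by rewrite normrM ler_pM// ?kernel_le// ge.
- by move=> x _ xD; rewrite kernel_local// mul0r.
by rewrite le_eqVlt; apply/orP; left; apply/eqP; field; rewrite lt0r_neq0.
Qed.

End kernel.

(** * Noisy sums *)

Section independent_sums.
Context {R : realType} d (T : measurableType d).
Variable U : T -> R.
Hypothesis bU : bm U.

Lemma bm_tuple_sum m : bm (fun t : m.-tuple T => \sum_(i < m) U (tnth t i)).
Proof.
apply: bm_sum => i; apply: (bm_comp (f := U) (g := fun t => tnth t i)) => //.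
exact: measurable_tnth.
Qed.

(** The summands may have means up to [beta], as clipping leaves a small bias; these add up linearly
    in [m], the variances separately. *)
Lemma product_law_sum m (P : 'I_m -> probability T R) (beta V : R) : 0 <= beta ->
  (forall j, `|Ex (P j) U| <= beta) -> (forall j, Ex (P j) (fun x => U x ^+ 2) <= V) ->
  `|Ex (product_law P) (fun t => \sum_(i < m) U (tnth t i))| <= m%:R * beta /\
  Ex (product_law P) (fun t => (\sum_(i < m) U (tnth t i)) ^+ 2) <=
    m%:R * V + (m%:R * beta) ^+ 2.
Proof.
move=> b0; elim: m P => [|m IH] P Pb PV.
  rewrite (_ : (fun t => _) = fun=> 0); last by apply/funext => t; rewrite big_ord0.
  rewrite (_ : (fun t => _ ^+ 2) = fun=> 0); last first.
    by apply/funext => t; rewrite big_ord0 expr0n.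
  by rewrite !Ex_cst normr0 !mul0r expr0n addr0.
pose Q := product_law (fun i => P (lift ord0 i)).
have [IH1 IH2] := IH (fun i => P (lift ord0 i)) (fun j => Pb _) (fun j => PV _).
pose B (t : m.-tuple T) := \sum_(i < m) U (tnth t i).
have bB : bm B := bm_tuple_sum m.
have split_sum x (t : m.-tuple T) :
    \sum_(i < m.+1) U (tnth (cons_pair (x, t)) i) = U x + B t.
  rewrite big_ord_recl /=; congr (U _ + _).
  by apply: eq_bigr => i _; rewrite tnthS.
have bS := bm_tuple_sum m.+1.
have V0 : 0 <= V by apply: le_trans (PV ord0); apply: Ex_ge0 => x; exact: sqr_ge0.
set a := Ex (P ord0) U; set b := Ex Q B.
have E1 : Ex (product_law P) (fun t => \sum_(i < m.+1) U (tnth t i)) = a + b.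
  rewrite Ex_product_law//.
  transitivity (Ex (P ord0) (fun x => U x + b)).
    congr Ex; apply/funext => x.
    rewrite -(Ex_cst Q (U x)) -ExD//; last exact: bm_cst.
    by congr Ex; apply/funext => t; exact: split_sum.
  by rewrite ExD ?Ex_cst//; exact: bm_cst.
have E2 : Ex (product_law P) (fun t => (\sum_(i < m.+1) U (tnth t i)) ^+ 2) =
    Ex (P ord0) (fun x => U x ^+ 2) + (2 * b * a + Ex Q (fun t => B t ^+ 2)).
  rewrite Ex_product_law; last exact: bmX.
  transitivity (Ex (P ord0) (fun x => U x ^+ 2 + (2 * b * U x + Ex Q (fun t => B t ^+ 2)))).
    congr Ex; apply/funext => x.
    transitivity (Ex Q (fun t => U x ^+ 2 + (2 * U x * B t + B t ^+ 2))).
      by congr Ex; apply/funext => t; rewrite split_sum; ring.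
    have b2 : bm (fun t => B t ^+ 2) by exact: bmX.
    have b1 : bm (fun t => 2 * U x * B t) by exact: bmZ.
    rewrite ExD; [|exact: bm_cst|exact: bmD].
    by rewrite ExD// Ex_cst ExZ//; congr (_ + (_ + _)); rewrite -/b; ring.
  have c1 : bm (fun x => 2 * b * U x) by exact: bmZ.
  have c2 := @bm_cst _ _ T (Ex Q (fun t => B t ^+ 2)).
  rewrite ExD; [|exact: bmX|exact: bmD].
  by rewrite ExD// Ex_cst ExZ.
have ab : `|a| <= beta := Pb ord0.
have m0 : 0 <= m%:R * beta :> R by rewrite mulr_ge0.
rewrite E1 E2 -natr1; split.
  by apply: (le_trans (ler_normD _ _)); rewrite mulrDl mul1r addrC lerD.
have h1 := PV ord0.
have : b * a <= m%:R * beta * beta.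
  by apply: (le_trans (ler_norm _)); rewrite normrM ler_pM.
have := IH2; rewrite -/Q -/B => h2 h3.
have h4 := sqr_ge0 beta.
rewrite (_ : (m%:R + 1) * V + ((m%:R + 1) * beta) ^+ 2 = m%:R * V + V +
  ((m%:R * beta) ^+ 2 + 2 * (m%:R * beta * beta) + beta ^+ 2)); last by ring.
lra.
Qed.

End independent_sums.

Lemma bm_min {R : realType} d (T : measurableType d) (f : T -> R) (L : R) : 0 <= L ->
  measurable_fun setT f -> bm (fun x => Num.min `|f x| L).
Proof.
move=> L0 mf; split.
  apply: measurable_minr; last exact: measurable_cst.
  exact: (measurableT_comp (@normr_measurable _ setT)).
by exists L => x; rewrite ger0_norm ?le_min ?normr_ge0// ge_min lexx orbT.
Qed.

Section exponential.
Context {R : realType}.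
Local Notation mu := (@lebesgue_measure R).

Definition unit_exponential : probability (measurableTypeR R) R :=
  @exponential_distribution_exponential_prob__canonical__probability_measure_Probability
    R 1 (@ltr01 R).
Local Notation E1 := unit_exponential.

Lemma exponential_pdf1E (x : R) : exponential_pdf (1 : R) x = if 0 <= x then expR (- x) else 0.
Proof.
case: leP => x0; last exact: lt0_exponential_pdf.
by rewrite exponential_pdfE// mul1r mulN1r.
Qed.

Lemma integral_exponential (f : measurableTypeR R -> \bar R) : measurable_fun setT f ->
  (forall x, (0 <= f x)%E) ->
  (\int[E1]_x f x = \int[mu]_x (f x * (exponential_pdf (1 : R) x)%:E))%E.
Proof.
move=> mf f0; apply: ge0_integral_density => //.
  exact: measurable_exponential_pdf.
by move=> x; exact: exponential_pdf_ge0.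
Qed.

(** Moving the exponential density to the right by [c] multiplies it by [exp(c)] on the half-line
    beyond [c] and annihilates it elsewhere. *)
Lemma exponential_shift (c : R) (f : measurableTypeR R -> R) : 0 <= c -> bm f ->
  (forall x, 0 <= f x) -> Ex E1 (fun x => f (c + x)) <= expR c * Ex E1 f.
Proof.
move=> c0 bf f0; have bfc : bm (fun x => f (c + x)) := bm_comp (measurable_addl c) bf.
have mpdf : measurable_fun setT (exponential_pdf (1 : R) : measurableTypeR R -> R).
  exact: measurable_exponential_pdf.
have pdf0 x : 0 <= exponential_pdf (1 : R) x by exact: exponential_pdf_ge0.
have mf : measurable_fun setT (EFin \o f) by apply/measurable_EFinP; case: bf.
have mfc : measurable_fun setT (EFin \o (fun x => f (c + x))).
  by apply/measurable_EFinP; case: bfc.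
rewrite -lee_fin EFinM !Ex_EFin// (integral_exponential mf)//.
rewrite (integral_exponential mfc)/=; last by move=> x; rewrite lee_fin.
have -> : (\int[mu]_x ((f (c + x))%:E * (exponential_pdf 1 x)%:E) =
    \int[mu]_x ((f x)%:E * (exponential_pdf 1 (x - c))%:E))%E.
  rewrite -[RHS](ge0_integral_shift c); last 2 first.
  - apply: emeasurable_funM; apply/measurable_EFinP; first by case: bf.
    apply: (measurableT_comp mpdf); apply: measurable_funB => //; exact: measurable_cst.
  - by move=> x; rewrite mule_ge0 ?lee_fin.
  by apply: eq_integral => x _; rewrite (addrC x c) [in RHS](addrC c x) addrK addrC.
rewrite -ge0_integralZl//; last 2 first.
- by apply: emeasurable_funM; apply/measurable_EFinP => //; case: bf.
- by move=> x _; rewrite mule_ge0 ?lee_fin.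
apply: ge0_le_integral => //.
- by move=> x _; rewrite mule_ge0 ?lee_fin.
- apply: emeasurable_funM; apply/measurable_EFinP; first by case: bf.
  apply: (measurableT_comp mpdf); apply: measurable_funB => //; exact: measurable_cst.
- apply: emeasurable_funM; first exact: measurable_cst.
  by apply: emeasurable_funM; apply/measurable_EFinP => //; case: bf.
move=> x _; rewrite -!EFinM lee_fin mulrCA ler_wpM2l// !exponential_pdf1E.
case: (leP 0 (x - c)) => xc; last by case: ifP; rewrite ?mulr0// mulr_ge0 ?expR_ge0.
rewrite ifT; last by rewrite (le_trans c0)// -subr_ge0.
by rewrite -expRD opprB.
Qed.

Lemma sqr_le_expR (x : R) : 0 <= x -> x ^+ 2 <= 16 * expR (x / 2).
Proof.
move=> x0; have h : x / 4 <= expR (x / 4).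
  by apply: le_trans (expR_ge1Dx _); rewrite lerDr.
have -> : x / 2 = x / 4 + x / 4 by lra.
have x4 : 0 <= x / 4 by rewrite divr_ge0.
have := ler_pM x4 x4 h h; rewrite expRD => h2.
by rewrite (_ : x ^+ 2 = 16 * (x / 4 * (x / 4))); [rewrite ler_wpM2l | field].
Qed.

(** The truncation at [L] only provides boundedness. The integrand is compared with the exponential
    law of rate [1/2]: [x^2 exp(-x) <= 16 exp(-x/2)], which is 32 times that density. *)
Lemma exponential_sqr (L : R) : 0 <= L ->
  Ex E1 (fun x : measurableTypeR R => Num.min `|x| L ^+ 2) <= 32.
Proof.
move=> L0.
have bf : bm (fun x : measurableTypeR R => Num.min `|x| L ^+ 2).
  by apply: bmX; exact: (bm_min (f := id)).
have mpdf : measurable_fun setT (exponential_pdf (2^-1 : R) : measurableTypeR R -> R).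
  exact: measurable_exponential_pdf.
rewrite -lee_fin Ex_EFin// integral_exponential; last 2 first.
- by apply/measurable_EFinP; case: bf.
- by move=> x; rewrite lee_fin sqr_ge0.
apply: (@le_trans _ _ (\int[mu]_x (32%:E * (exponential_pdf (2^-1 : R) x)%:E)))%E; last first.
  rewrite ge0_integralZl//.
  - by rewrite integral_exponential_pdf ?mule1// invr_gt0.
  - exact/measurable_EFinP.
  - by move=> x _; rewrite lee_fin exponential_pdf_ge0.
apply: ge0_le_integral => //.
- by move=> x _; rewrite mule_ge0 ?lee_fin ?sqr_ge0// exponential_pdf_ge0.
- apply: emeasurable_funM; apply/measurable_EFinP; first by case: bf.
  exact: measurable_exponential_pdf.
- by apply: emeasurable_funM; [exact: measurable_cst|exact/measurable_EFinP].
move=> x _; rewrite -!EFinM lee_fin exponential_pdf1E.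
case: (leP 0 x) => x0; last by rewrite mulr0 mulr_ge0// exponential_pdf_ge0.
rewrite exponential_pdfE//.
apply: (@le_trans _ _ (x ^+ 2 * expR (- x))).
  rewrite ler_wpM2r ?expR_ge0// lerXn2r ?nnegrE ?le_min ?normr_ge0//.
  by rewrite ge_min ger0_norm// lexx.
apply: (le_trans (ler_wpM2r (expR_ge0 _) (sqr_le_expR x0))).
rewrite -mulrA -expRD (_ : x / 2 - x = - 2^-1 * x); last by field.
by rewrite mulrA (_ : 32 * 2^-1 = 16)//; lra.
Qed.

End exponential.

Lemma Ex_swap {R : realType} d1 d2 (T1 : measurableType d1) (T2 : measurableType d2)
    (P : probability T1 R) (Q : probability T2 R) (f : T1 * T2 -> R) : bm f ->
  Ex P (fun x => Ex Q (fun y => f (x, y))) = Ex Q (fun y => Ex P (fun x => f (x, y))).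
Proof.
move=> bf; rewrite -Ex_prod//.
have iF : (P \x Q)%E.-integrable setT (EFin \o f) by exact: bm_integrable.
rewrite /Ex /Rintegral -(integral21_prod_meas1 iF); congr fine.
apply: eq_integral => y _; rewrite /fubini_G/= fineK//.
apply: integrable_fin_num => //.
apply: (@bm_integrable _ _ _ P (fun x => f (x, y))).
by apply: (bm_comp (f := f) (g := pair^~ y)).
Qed.

Lemma bm_affine_test {R : realType} d (T : measurableType d) (f : T -> R) : bm f ->
  exists a c g, test g /\ f = fun x => a * g x + c.
Proof.
move=> [mf [M fM]]; pose N := `|M| + 1; have N0 : 0 < N by rewrite ltr_pwDr.
have N2 : 0 < 2 * N by rewrite mulr_gt0.
exists (2 * N), (- N), (fun x => (2 * N)^-1 * f x + 2^-1); split; last first.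
  by apply/funext => x; field; rewrite lt0r_neq0.
split.
  apply: measurable_funD; last exact: measurable_cst.
  by apply: measurable_funM => //; exact: measurable_cst.
move=> x; have h : `|f x| <= N.
  by rewrite (le_trans (fM x))// (le_trans (ler_norm _))// lerDl.
have : `|(2 * N)^-1 * f x| <= 2^-1.
  by rewrite normrM gtr0_norm ?invr_gt0// mulrC ler_pdivrMr// mulrA mulVf ?mul1r.
by rewrite ler_norml => /andP[? ?]; apply/andP; split; lra.
Qed.

Lemma bm_Ex_kernel {R : realType} d1 d2 (S : measurableType d1) (T : measurableType d2)
    (K : R.-pker S ~> T) f : bm f -> bm (fun z => Ex (kernel_at K z) f).
Proof.
move=> /bm_affine_test[a [c [g [tg ->]]]]; have bg := test_bm tg.
have := bmD (bmZ a (test_bm (test_Ex_kernel K tg))) (@bm_cst _ _ S c).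
congr bm; apply/funext => z.
by rewrite ExD ?ExZ ?Ex_cst//; [exact: bmZ | exact: bm_cst].
Qed.

Lemma Ex_output_law_bm {R : realType} d1 d2 (S : measurableType d1) (T : measurableType d2)
    (P : probability S R) (K : R.-pker S ~> T) f : bm f ->
  Ex (output_law P K) f = Ex P (fun z => Ex (kernel_at K z) f).
Proof.
move=> /bm_affine_test[a [c [g [tg ->]]]]; have bg := test_bm tg.
have bK := test_bm (test_Ex_kernel K tg).
have E (Q : probability T R) : Ex Q (fun x => a * g x + c) = a * Ex Q g + c.
  by rewrite ExD ?ExZ ?Ex_cst//; [exact: bmZ | exact: bm_cst].
rewrite E Ex_output_law//.
rewrite [RHS](_ : _ = Ex P (fun z => a * Ex (kernel_at K z) g + c)).
  by rewrite ExD ?ExZ ?Ex_cst//; [exact: bmZ | exact: bm_cst].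
by congr Ex; apply/funext => z; rewrite E.
Qed.

Section clip.
Context {R : realType}.
Implicit Types L s x y : R.

Definition clip L x : R := Num.max (- L) (Num.min L x).

Lemma clip_id L x : `|x| <= L -> clip L x = x.
Proof. by rewrite ler_norml => /andP[x0 x1]; rewrite /clip min_r// max_r. Qed.

Lemma clip_le L x : 0 <= L -> `|clip L x| <= L.
Proof.
move=> L0; rewrite ler_norml /clip le_max lexx/= ge_max ge_min lexx/= andbT; lra.
Qed.

Lemma clip_lipschitz L x y : `|clip L x - clip L y| <= `|x - y|.
Proof.
wlog xy : x y / y <= x.
  by move=> h; have [/h|/ltW/h] := leP y x; rewrite // distrC (distrC y).
have hmin (a : R) : 0 <= Num.min a x - Num.min a y <= x - y.
  by rewrite !minEle; case: (leP a x); case: (leP a y) => h1 h2; apply/andP; split; lra.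
have hmax (a u v : R) : v <= u -> 0 <= Num.max a u - Num.max a v <= u - v.
  move=> uv; rewrite !maxEle.
  by case: (leP a u); case: (leP a v) => h1 h2; apply/andP; split; lra.
have /andP[m0 m1] := hmin L; have := hmax (- L) (Num.min L x) (Num.min L y).
rewrite -subr_ge0 => /(_ m0) /andP[h1 h2].
by rewrite /clip (ger0_norm h1) [leRHS]ger0_norm ?subr_ge0//; exact: le_trans h2 m1.
Qed.

Lemma clip_continuous L : continuous (clip L).
Proof.
move=> x; apply: (@continuous_max _ _ (fun=> - L) (fun z => Num.min L z)); first exact: cvg_cst.
by apply: continuous_min; [exact: cvg_cst | exact: cvg_id].
Qed.

Lemma measurable_clip L : measurable_fun setT (clip L : measurableTypeR R -> measurableTypeR R).
Proof. by apply: continuous_measurable_fun; exact: clip_continuous. Qed.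

Lemma clip_shift L s t : `|s| <= L -> `|clip L (s + t) - s| <= Num.min `|t| (2 * L).
Proof.
move=> sL; have L0 : 0 <= L := le_trans (normr_ge0 s) sL.
rewrite le_min; apply/andP; split.
  by rewrite -{2}(clip_id sL) (le_trans (clip_lipschitz _ _ _))// addrAC subrr add0r.
by rewrite (le_trans (ler_normB _ _))// mulr2n mulrDl mul1r lerD// clip_le.
Qed.

(** If [|t| <= L - |s|] neither term is clipped and the errors vanish. Otherwise the truncated noise
    [m] is at least [L - |s|], so that [2 m] is at most [2 m ^+ 2 / (L - |s|)]: the bias is
    quadratic in the noise. *)
Lemma clip_symmetric L s t : `|s| < L ->
  `|clip L (s + t) + clip L (s - t) - 2 * s| <=
    2 / (L - `|s|) * Num.min `|t| (2 * L) ^+ 2.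
Proof.
move=> sL; set m := Num.min _ _; set g := L - `|s|.
have g0 : 0 < g by rewrite subr_gt0.
have m0 : 0 <= m by rewrite le_min normr_ge0 mulr_ge0// (le_trans (normr_ge0 s))// ltW.
have [tg|tg] := leP `|t| g.
  rewrite !clip_id.
  - by rewrite (_ : _ - _ = 0) ?normr0 ?mulr_ge0 ?exprn_ge0 ?invr_ge0// ?(ltW g0)//; ring.
  - by rewrite (le_trans (ler_normB _ _))// addrC -lerBrDr.
  - by rewrite (le_trans (ler_normD _ _))// addrC -lerBrDr.
have mg : g <= m.
  by rewrite le_min (ltW tg)/= /g; have := normr_ge0 s; lra.
have h1 := clip_shift t (ltW sL); have h2 := clip_shift (- t) (ltW sL).
rewrite normrN in h2; rewrite -/m in h1 h2.
rewrite (_ : _ - 2 * s = (clip L (s + t) - s) + (clip L (s - t) - s)); last by ring.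
apply: (le_trans (ler_normD _ _)); apply: (@le_trans _ _ (2 * m)); first by lra.
by rewrite mulrAC -mulrA ler_wpM2l// ler_pdivlMr// expr2 ler_wpM2l.
Qed.

End clip.

Section noise.
Context {R : realType}.
Local Notation E1 := (@unit_exponential R).
Local Notation RR := (measurableTypeR R * measurableTypeR R)%type.

(** The difference of the two coordinates has the Laplace law. *)
Definition noise : probability RR R := (E1 \x E1)%E.

Lemma bm_clip_noise (L s b : R) : 0 <= L -> bm (fun u : RR => clip L (s + b * (u.1 - u.2))).
Proof.
move=> L0; split; last by exists L => u; exact: clip_le.
apply: (measurableT_comp (measurable_clip L)).
apply: measurable_funD; first exact: measurable_cst.
by apply: measurable_funM; [exact: measurable_cst | exact: measurable_funB].
Qed.

Lemma bm_min_noise (b L : R) : 0 <= L ->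
  bm (fun u : RR => Num.min `|b * (u.1 - u.2)| L ^+ 2).
Proof.
move=> L0; apply: bmX; apply: bm_min => //.
by apply: measurable_funM; [exact: measurable_cst | exact: measurable_funB].
Qed.

(* The exponential law moved to the right by [c] is at most [e^c] times the original
   one; the first exponential absorbs [s > s'], the second one [s < s']. *)
Lemma noise_dp (s s' b : R) (f : measurableTypeR R -> R) : 0 < b -> bm f ->
  (forall x, 0 <= f x) ->
  Ex noise (fun u => f (s + b * (u.1 - u.2))) <=
    expR (`|s - s'| / b) * Ex noise (fun u => f (s' + b * (u.1 - u.2))).
Proof.
move=> b0 bf f0.
have mb (a : R) : measurable_fun setT (fun u : RR => a + b * (u.1 - u.2)).
  apply: measurable_funD; first exact: measurable_cst.
  by apply: measurable_funM; [exact: measurable_cst | exact: measurable_funB].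
have bg a : bm (fun u : RR => f (a + b * (u.1 - u.2))) := bm_comp (mb a) bf.
rewrite !Ex_prod//; set k := `|_| / b; have k0 : 0 <= k by rewrite divr_ge0// ltW.
have bE (a : R) : bm (fun x : measurableTypeR R => Ex E1 (fun y => f (a + b * (x - y)))).
  exact: (bm_Ex_pair E1 E1 (bg a)).
have [ss|ss] := leP s' s.
  have kE : s = s' + b * k by rewrite /k ger0_norm ?subr_ge0//; field; rewrite lt0r_neq0.
  rewrite [leLHS](_ : _ = Ex E1 (fun x => (fun z : measurableTypeR R => Ex E1 (fun y => f (s' + b * (z - y)))) (k + x))).
    by apply: exponential_shift => // x; exact: Ex_ge0.
  congr Ex; apply/funext => x; congr Ex; apply/funext => y /=; congr f.
  by rewrite kE; ring.
have kE : s = s' - b * k by rewrite /k ltr0_norm ?subr_lt0//; field; rewrite lt0r_neq0.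
rewrite -ExZ//; apply: le_Ex => //; first exact: bmZ.
move=> x /=; rewrite [leLHS](_ : _ = Ex E1 (fun y => (fun z : measurableTypeR R => f (s' + b * (x - z))) (k + y))).
  by apply: exponential_shift => //; exact: (bm_pair1 x (bg s')).
by congr Ex; apply/funext => y; congr f; rewrite kE; ring.
Qed.

Lemma noise_sqr (b L : R) : 0 < b -> 0 <= L ->
  Ex noise (fun u => Num.min `|b * (u.1 - u.2)| L ^+ 2) <= 128 * b ^+ 2.
Proof.
move=> b0 L0; pose L' := L / b; have L'0 : 0 <= L' by rewrite divr_ge0// ltW.
have bm1 : bm (fun x : measurableTypeR R => Num.min `|x| L' ^+ 2).
  by apply: bmX; exact: (bm_min (f := id)).
have bf := bm_min_noise b L0.
have b1 : bm (fun u : RR => Num.min `|u.1| L' ^+ 2) := bm_comp measurable_fst bm1.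
have b2 : bm (fun u : RR => Num.min `|u.2| L' ^+ 2) := bm_comp measurable_snd bm1.
apply: (@le_trans _ _ (Ex noise (fun u : RR =>
    2 * b ^+ 2 * (Num.min `|u.1| L' ^+ 2 + Num.min `|u.2| L' ^+ 2)))).
  apply: le_Ex => //; first by apply: bmZ; exact: bmD.
  move=> [x y] /=; set p := Num.min `|x| L'; set q := Num.min `|y| L'.
  have h : Num.min `|b * (x - y)| L <= b * (p + q).
    have bL : b * L' = L by rewrite /L'; field; rewrite lt0r_neq0.
    have p0 : 0 <= p by rewrite le_min normr_ge0.
    have q0 : 0 <= q by rewrite le_min normr_ge0.
    rewrite ge_min; case: (leP `|x| L') => hx.
      case: (leP `|y| L') => hy.
        apply/orP; left; rewrite normrM gtr0_norm// ler_wpM2l// ?(ltW b0)//.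
        by rewrite /p /q !min_l// ler_normB.
      apply/orP; right; rewrite -{1}bL ler_wpM2l ?(ltW b0)//.
      by rewrite /q (min_r (ltW hy)) lerDr.
    apply/orP; right; rewrite -{1}bL ler_wpM2l ?(ltW b0)//.
    by rewrite /p (min_r (ltW hx)) lerDl.
  have m0 : 0 <= Num.min `|b * (x - y)| L by rewrite le_min normr_ge0.
  have h2 := ler_pM m0 m0 h h.
  have h3 : 0 <= b ^+ 2 * (p - q) ^+ 2 by rewrite mulr_ge0 ?sqr_ge0.
  rewrite expr2 (le_trans h2)//.
  rewrite (_ : 2 * b ^+ 2 * (p ^+ 2 + q ^+ 2) =
    b * (p + q) * (b * (p + q)) + b ^+ 2 * (p - q) ^+ 2); last by ring.
  by rewrite lerDl.
rewrite ExZ; last exact: bmD.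
pose e := Ex E1 (fun x : measurableTypeR R => Num.min `|x| L' ^+ 2).
have e1 : Ex noise (fun u : RR => Num.min `|u.1| L' ^+ 2) = e.
  by rewrite Ex_prod//; congr Ex; apply/funext => x /=; exact: Ex_cst.
have e2 : Ex noise (fun u : RR => Num.min `|u.2| L' ^+ 2) = e.
  by rewrite Ex_prod//; exact: (Ex_cst E1 e).
rewrite ExD// e1 e2 (_ : 128 * b ^+ 2 = 2 * b ^+ 2 * (32 + 32)); last by ring.
apply: ler_wpM2l; first by rewrite mulr_ge0 ?sqr_ge0.
by apply: lerD; exact: exponential_sqr.
Qed.

Lemma noise_clip_sqr (L s b : R) : 0 < b -> `|s| <= L ->
  Ex noise (fun u => (clip L (s + b * (u.1 - u.2)) - s) ^+ 2) <= 128 * b ^+ 2.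
Proof.
move=> b0 sL; have L0 : 0 <= L := le_trans (normr_ge0 s) sL.
have L20 : 0 <= 2 * L by rewrite mulr_ge0.
apply: le_trans (noise_sqr b0 L20).
apply: le_Ex.
- by apply: bmX; apply: bmB; [exact: bm_clip_noise | exact: bm_cst].
- exact: bm_min_noise.
move=> u; rewrite -real_normK ?num_real//.
have h := clip_shift (b * (u.1 - u.2)) sL.
by rewrite lerXn2r ?nnegrE ?normr_ge0//; exact: le_trans (normr_ge0 _) h.
Qed.

(* Exchanging the two exponentials changes the sign of the noise, and the clipping
   errors of opposite noises cancel unless the noise exceeds [L - |s|]. *)
Lemma noise_clip_bias (L s b : R) : 0 < b -> `|s| < L ->
  `|Ex noise (fun u => clip L (s + b * (u.1 - u.2))) - s| <= 128 * b ^+ 2 / (L - `|s|).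
Proof.
move=> b0 sL; have L0 : 0 <= L := le_trans (normr_ge0 s) (ltW sL).
have L20 : 0 <= 2 * L by rewrite mulr_ge0.
have g0 : 0 < L - `|s| by rewrite subr_gt0.
have b1 := bm_clip_noise s b L0; have b2 := bm_clip_noise s (- b) L0.
have bc := @bm_cst _ _ RR (2 * s).
have b3 : bm (fun u : RR => clip L (s - b * (u.1 - u.2))).
  by have := b2; congr bm; apply/funext => u; rewrite mulNr.
have sw : Ex noise (fun u => clip L (s + b * (u.1 - u.2))) =
          Ex noise (fun u => clip L (s - b * (u.1 - u.2))).
  rewrite (Ex_prod E1 E1 b1) (Ex_prod E1 E1 b3) (Ex_swap E1 E1 b1).
  congr Ex; apply/funext => y; congr Ex; apply/funext => x /=; congr clip; ring.
have bmin := bm_min_noise b L20.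
set e := Ex noise _.
have eE : 2 * (e - s) = Ex noise (fun u : RR => clip L (s + b * (u.1 - u.2)) +
    clip L (s - b * (u.1 - u.2)) - 2 * s).
  by rewrite ExB ?ExD ?Ex_cst -?sw -/e//; [ring|exact: bmD].
have : `|2 * (e - s)| <= 2 / (L - `|s|) * (128 * b ^+ 2).
  rewrite eE; apply: (@le_trans _ _ (Ex noise (fun u : RR =>
      2 / (L - `|s|) * Num.min `|b * (u.1 - u.2)| (2 * L) ^+ 2))).
    apply: norm_Ex_le; [by apply: bmB => //; exact: bmD|exact: bmZ|].
    by move=> u; exact: clip_symmetric.
  by rewrite ExZ// ler_wpM2l ?noise_sqr// divr_ge0// ltW.
rewrite normrM (ger0_norm (ler0n _ 2)).
rewrite (_ : 2 / (L - `|s|) * _ = 2 * (128 * b ^+ 2 / (L - `|s|))); last by ring.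
by rewrite ler_pM2l.
Qed.

End noise.

Section push_kernel.
Context {R : realType} d1 d2 d3 (X : measurableType d1) (Y : measurableType d2)
  (T : measurableType d3).
Variables (P : probability Y R) (g : X * Y -> T).
Hypothesis mg : measurable_fun setT g.

Let slice x y := g (x, y).

Let measurable_slice x : measurable_fun setT (slice x).
Proof. exact: (measurableT_comp mg (pair1_measurable x)). Qed.

HB.instance Definition _ x := isMeasurableFun.Build _ _ _ _ (slice x) (measurable_slice x).

Let push_kernel x : {measure set T -> \bar R} := distribution P (slice x).

Let measurable_push_kernel U : measurable U -> measurable_fun setT (push_kernel ^~ U).
Proof.
move=> mU.
have mA : measurable (g @^-1` U) by rewrite -[X in measurable X]setTI; exact: mg.
have := measurable_fun_xsection P mA.
by apply: eq_measurable_fun => x _; congr (P _); apply/seteqP; split => y /=;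
  rewrite /xsection/= inE.
Qed.

HB.instance Definition _ := isKernel.Build _ _ X T R push_kernel measurable_push_kernel.

Let push_kernel_setT x : push_kernel x setT = 1%E.
Proof. exact: probability_setT. Qed.

HB.instance Definition _ :=
  Kernel_isProbability.Build _ _ X T R push_kernel push_kernel_setT.

(** A mechanism is obtained as a function of the data and of an independent random [y]; afterwards
    it is used through its expectations only. *)
Lemma ex_push_kernel : exists K : R.-pker X ~> T, forall x f, bm f ->
  Ex (kernel_at K x) f = Ex P (fun y => f (g (x, y))).
Proof.
exists push_kernel => x f bf.
transitivity (Ex (distribution P (slice x)) f) => //.
by rewrite Ex_distribution.
Qed.

End push_kernel.

Lemma second_countable_R {R : realType} : @second_countable R.
Proof.
pose B (q : rat * rat) : set R := `]ratr q.1, ratr q.2[%classic.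
exists (range B); first by apply: (sub_countable (card_image_le B setT)); exact: countableP.
split; first by move=> _ [q _ <-]; exact: interval_open.
move=> x A /nbhs_ballP[e /= e0 eA].
have xe : x - e < x by rewrite ltrBlDr ltrDl.
have ex : x < x + e by rewrite ltrDl.
have [a] := rat_in_itvoo xe.
rewrite in_itv/= => /andP[a1 a2].
have [b] := rat_in_itvoo ex.
rewrite in_itv/= => /andP[b1 b2].
exists (B (a, b)).
  by split; [exists (a, b) | rewrite /B/= in_itv/= a2 b1].
move=> y; rewrite /B/= in_itv/= => /andP[ay yb]; apply: eA.
by rewrite /ball/= distrC ltr_distl (lt_trans a1 ay)/= (lt_trans yb b2).
Qed.

Lemma standard_borel_R {R : realType} : @standard_borel R _ (measurableTypeR R).
Proof.
exists R, id; split.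
- exact: Rhausdorff.
- exact: second_countable_R.
- by exists id.
move=> A; split.
  move=> mA; exists A => //.
  have : (@RGenOpens.G R).-sigma.-measurable A by rewrite -RGenOpens.measurableE.
  apply: (@smallest_sub _ _ _ <<s open >>); first exact: smallest_sigma_algebra.
  move=> _ [x [y ->]]; apply: sub_sigma_algebra; exact: interval_open.
move=> [B sB ->]; rewrite preimage_id; move: sB.
apply: (@smallest_sub _ _ _ measurable); first exact: sigma_algebra_measurable.
exact: open_measurable.
Qed.

Section noisy_sum.
Context {R : realType}.
Local Notation RR := (measurableTypeR R * measurableTypeR R)%type.
Variables (phi : obs R -> R) (tau eps delta : R).
Hypotheses (mphi : measurable_fun setT phi) (phi_le : forall u, `|phi u| <= tau).
Hypotheses (tau0 : 0 < tau) (eps0 : 0 < eps) (delta0 : 0 <= delta).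

Let S n (z : n.-tuple (obs R)) : R := \sum_(i < n) phi (tnth z i).

(** The scale of Laplace noise: the change of one observation moves the sum by at most [2 * tau]. *)
Let b : R := 2 * tau / eps.

Let b0 : 0 < b. Proof. by rewrite divr_gt0// mulr_gt0. Qed.

Let bphi : bm phi. Proof. by split => //; exists tau. Qed.

Let S_le n (z : n.-tuple (obs R)) : `|S z| <= n%:R * tau.
Proof.
apply: (le_trans (ler_norm_sum _ _ _)).
apply: (@le_trans _ _ (\sum_(i < n) tau)); first exact: ler_sum.
by rewrite sumr_const card_ord mulr_natl.
Qed.

Let S_sensitivity n (z z' : n.-tuple (obs R)) : (hamming z z' <= 1)%N ->
  `|S z - S z'| <= 2 * tau.
Proof.
move=> zz; rewrite /S -sumrB.
apply: (le_trans (ler_norm_sum _ _ _)).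
apply: (@le_trans _ _ (\sum_(i < n | tnth z i != tnth z' i) 2 * tau)).
  rewrite [leRHS]big_mkcond/=; apply: ler_sum => i _.
  case: eqVneq => [->|_] /=; first by rewrite subrr normr0.
  by rewrite (le_trans (ler_normB _ _))// mulr2n mulrDl mul1r lerD.
have tau2 : 0 <= 2 * tau by rewrite mulr_ge0// ltW.
rewrite sumr_const; move: zz; rewrite /hamming cardsE.
by case: #|_| => [|[|k]]//=; rewrite ?mulr0n ?mulr1n.
Qed.

Lemma noisy_sum_mechanism n (L : R) : 0 <= L ->
  exists K : R.-pker (n.-tuple (obs R)) ~> measurableTypeR R,
  differentially_private K eps delta /\
  forall z f, bm f -> Ex (kernel_at K z) f =
    Ex noise (fun u => f (clip L (S z + b * (u.1 - u.2)))).
Proof.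
move=> L0.
pose g (v : n.-tuple (obs R) * RR) : measurableTypeR R :=
  clip L (S v.1 + b * (v.2.1 - v.2.2)).
have mg : measurable_fun setT g.
  apply: (measurableT_comp (measurable_clip L)); apply: measurable_funD.
    apply: (measurableT_comp (f := @S n)) => //.
    exact: (bm_tuple_sum bphi n).1.
  apply: measurable_funM; first exact: measurable_cst.
  by apply: measurable_funB; exact: measurableT_comp.
have [K KE] := ex_push_kernel noise mg.
exists K; split => // A z z' mA _ _ zz.
have KA y : K y A = (Ex (kernel_at K y) (\1_A : measurableTypeR R -> R))%:E.
  rewrite Ex_indic// fineK//; exact: (fin_num_measure (kernel_at K y)).
have tA : test (\1_A : measurableTypeR R -> R) := test_indic mA.
rewrite !KA -EFinM -EFinD lee_fin !KE; try exact: test_bm.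
have tC := test_comp (measurable_clip L) tA.
have C0 x : 0 <= (\1_A \o clip L) x :> R by case/andP: (tC.2 x).
apply: le_trans (noise_dp (S z) (S z') b0 (test_bm tC) C0) _.
apply: ler_wpDr => //; apply: ler_wpM2r; first exact: Ex_ge0.
rewrite ler_expR ler_pdivrMr// /b mulrCA mulfV ?lt0r_neq0// mulr1.
exact: S_sensitivity.
Qed.

(** The [m] clipping biases, each at most [b / m], contribute [b ^+ 2]; with twice the noise bound
    [128 * b ^+ 2] of each server this gives 257. *)
Lemma noisy_sum_moments m n : (0 < m)%N -> (0 < n)%N ->
  exists L (K : R.-pker (n.-tuple (obs R)) ~> measurableTypeR R),
  [/\ 0 <= L, differentially_private K eps delta &
  forall f v, Ex (obs_law f) (fun u => phi u ^+ 2) <= v ->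
  Ex (product_law (fun _ : 'I_m => output_law (sample_law f n) K))
    (fun t => (\sum_(j < m) clip L (tnth t j) - (m * n)%:R * Ex (obs_law f) phi) ^+ 2)
  <= m%:R * (257 * b ^+ 2 + 2 * (n%:R * v))].
Proof.
move=> m0 n0; have m0R : 0 < m%:R :> R by rewrite ltr0n.
(* As [|S z| <= n * tau], the gap [L - |S z|] is at least [128 * b * m], and [noise_clip_bias] gives
   a bias of at most [b / m]. *)
pose L := n%:R * tau + 128 * b * m%:R.
have L0 : 0 <= L.
  apply: addr_ge0; apply: mulr_ge0 => //; first exact: ltW.
  by apply: mulr_ge0 => //; exact: ltW.
have Lb : 0 < 128 * b * m%:R by apply: mulr_gt0 => //; exact: mulr_gt0.
have [K [Kdp KE]] := noisy_sum_mechanism n L0.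
exists L, K; split => // f v phiv; set theta := Ex _ phi.
have SL (z : n.-tuple (obs R)) : `|S z| < L.
  by apply: (le_lt_trans (S_le z)); rewrite ltrDl.
pose P := sample_law f n.
have bS : bm (@S n) := bm_tuple_sum bphi n.
have bU0 : bm (fun u => phi u - theta) by apply: bmB => //; exact: bm_cst.
have E0 : Ex (obs_law f) (fun u => phi u - theta) = 0.
  by rewrite ExB ?Ex_cst ?subrr//; exact: bm_cst.
have V0 : Ex (obs_law f) (fun u => (phi u - theta) ^+ 2) <= v.
  by rewrite Ex_variance// lerBlDr (le_trans phiv)// lerDl sqr_ge0.
have Sc (z : n.-tuple (obs R)) : S z - n%:R * theta = \sum_(i < n) (phi (tnth z i) - theta).
  by rewrite sumrB sumr_const card_ord mulr_natl.
have SE : (fun z => S z - n%:R * theta) = fun z => \sum_(i < n) (phi (tnth z i) - theta).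
  by apply/funext => z; rewrite Sc.
have S2E : (fun z => (S z - n%:R * theta) ^+ 2) =
    fun z => (\sum_(i < n) (phi (tnth z i) - theta)) ^+ 2.
  by apply/funext => z; rewrite Sc.
have phi_mean (j : 'I_n) : `|Ex (obs_law f) (fun u => phi u - theta)| <= 0.
  by rewrite E0 normr0.
have [] := product_law_sum bU0 (lexx 0) phi_mean (fun=> V0).
rewrite -/P -SE -S2E mulr0 expr0n/= addr0 normr_le0 => /eqP ES VS.
pose U (t : measurableTypeR R) : R := clip L t - n%:R * theta.
have bU : bm U.
  apply: bmB; last exact: bm_cst.
  by split; [exact: measurable_clip | exists L => x; exact: clip_le].
pose Q := output_law P K.
(* The transcript is already clipped; the estimator clips it again in order to be a bounded function
   on the whole transcript space. *)
have clip_clip x : clip L (clip L x) = clip L x by rewrite clip_id// clip_le.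
have KU z : Ex (kernel_at K z) U = Ex noise (fun u => clip L (S z + b * (u.1 - u.2))) - n%:R * theta.
  rewrite KE// /U -[X in _ - X](Ex_cst noise) -ExB; [|exact: bm_clip_noise|exact: bm_cst].
  by congr Ex; apply/funext => u; rewrite clip_clip.
have bKU : bm (fun z => Ex (kernel_at K z) U) by exact: bm_Ex_kernel.
have bSt : bm (fun z : n.-tuple (obs R) => S z - n%:R * theta).
  by apply: (bmB bS); exact: bm_cst.
have EU : `|Ex Q U| <= b / m%:R.
  rewrite /Q Ex_output_law_bm// -[X in `|X|]subr0 -[X in _ - X]ES -ExB//.
  rewrite -[leRHS](Ex_cst P); apply: norm_Ex_le.
  - exact: bmB.
  - exact: bm_cst.
  - move=> z; rewrite KU opprB addrA subrK.
    have g0 : 128 * b * m%:R <= L - `|S z| by rewrite lerBrDr /L [leRHS]addrC lerD2l S_le.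
    apply: (le_trans (noise_clip_bias b0 (SL z))).
    rewrite ler_pdivrMr; last exact: lt_le_trans Lb g0.
    apply: (@le_trans _ _ (b / m%:R * (128 * b * m%:R))).
      by rewrite le_eqVlt; apply/orP; left; apply/eqP; field; rewrite lt0r_neq0.
    by apply: ler_wpM2l => //; apply: divr_ge0 => //; exact: ltW.
have VU : Ex Q (fun t => U t ^+ 2) <= 256 * b ^+ 2 + 2 * (n%:R * v).
  rewrite /Q Ex_output_law_bm; last exact: bmX.
  apply: (@le_trans _ _ (Ex P (fun z => 256 * b ^+ 2 + 2 * (S z - n%:R * theta) ^+ 2))).
    apply: le_Ex.
    - by apply: bm_Ex_kernel; exact: bmX.
    - by apply: bmD; [exact: bm_cst | apply: bmZ; exact: bmX].
    move=> z; rewrite KE; last exact: bmX.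
    have bN := bm_clip_noise (S z) b L0.
    have bd : bm (fun u : RR => (clip L (S z + b * (u.1 - u.2)) - S z) ^+ 2).
      by apply: bmX; apply: bmB => //; exact: bm_cst.
    apply: (@le_trans _ _ (Ex noise (fun u : RR =>
      2 * (clip L (S z + b * (u.1 - u.2)) - S z) ^+ 2 + 2 * (S z - n%:R * theta) ^+ 2))).
      apply: le_Ex; [|by apply: bmD; [exact: bmZ | exact: bm_cst]|].
        by apply: bmX; apply: bmB; [|exact: bm_cst]; have := bN; congr bm; apply/funext => u; rewrite clip_clip.
      move=> u; rewrite /U clip_clip; set x := clip _ _; set y := n%:R * theta.
      rewrite -subr_ge0 (_ : _ - _ = ((x - S z) - (S z - y)) ^+ 2) ?sqr_ge0//; ring.
    rewrite ExD; [|exact: bmZ|exact: bm_cst].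
    rewrite ExZ// Ex_cst lerD2r.
    have -> : 256 * b ^+ 2 = 2 * (128 * b ^+ 2) by rewrite mulrA -natrM.
    by apply: ler_wpM2l => //; exact: noise_clip_sqr b0 (ltW (SL z)).
  rewrite ExD; [|exact: bm_cst|by apply: bmZ; exact: bmX].
  by rewrite Ex_cst ExZ ?lerD2l ?ler_wpM2l//; exact: bmX.
have bm0 : 0 <= b / m%:R by apply: divr_ge0 => //; exact: ltW.
have [_] := product_law_sum bU (P := fun _ : 'I_m => Q) bm0 (fun=> EU) (fun=> VU).
rewrite (_ : (fun t => _ ^+ 2) = fun t =>
  (\sum_(j < m) clip L (tnth t j) - (m * n)%:R * theta) ^+ 2); last first.
  apply/funext => t; rewrite sumrB sumr_const card_ord natrM -mulrA.
  by rewrite -[_ *+ m]mulr_natl.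
move/le_trans; apply.
have -> : m%:R * (b / m%:R) = b by field; rewrite lt0r_neq0.
have h : b ^+ 2 <= m%:R * b ^+ 2 by rewrite ler_peMl ?sqr_ge0// ler1n.
apply: (le_trans (lerD (lexx _) h)); rewrite -mulrDr.
rewrite le_eqVlt; apply/orP; left; apply/eqP; congr (_ * _).
by move: (b ^+ 2) (n%:R * v) => x y; ring.
Qed.

End noisy_sum.

(** The analysis of [h] is left as a deterministic inequality. With [a = 0] this gives the trivial
    bound on the risk, with [a > 0] the rate. *)
Lemma minimax_risk_le {R : realType} (phi : obs R -> R) (tau eps delta x0 v a e H : R)
    (h : measurableTypeR R -> measurableTypeR R) F m n :
  measurable_fun setT phi -> (forall u, `|phi u| <= tau) ->
  0 < tau -> 0 < eps -> 0 <= delta -> (0 < m)%N -> (0 < n)%N -> 0 <= a ->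
  measurable_fun setT h -> (forall s, `|h s| <= H) ->
  (forall f, F f -> Ex (obs_law f) (fun u => phi u ^+ 2) <= v) ->
  (forall f, F f -> forall s, (h s - f x0) ^+ 2 <=
     a * (s - (m * n)%:R * Ex (obs_law f) phi) ^+ 2 + e) ->
  (minimax_risk (fun _ : 'I_m => n) (fun _ => eps) (fun _ => delta) x0 F <=
   (a * (m%:R * (257 * (2 * tau / eps) ^+ 2 + 2 * (n%:R * v))) + e)%:E)%E.
Proof.
move=> mphi phi_le tau0 eps0 delta0 m0 n0 a0 mh hH Fv Fh.
have [L [K [L0 Kdp KV]]] :=
  noisy_sum_moments mphi phi_le tau0 eps0 delta0 m0 n0.
pose est (t : m.-tuple (measurableTypeR R)) (x : R) : measurableTypeR R :=
  h (\sum_(j < m) clip L (tnth t j)).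
have bclip : bm (clip L : measurableTypeR R -> R).
  by split; [exact: measurable_clip | exists L => x; exact: clip_le].
have bsum := bm_tuple_sum bclip m.
have mest x : measurable_fun setT (fun t => est t x).
  exact: (measurableT_comp mh bsum.1).
pose prot : protocol (fun _ : 'I_m => n) (fun _ => eps) (fun _ => delta) :=
  {| tr_standard_borel := standard_borel_R; mechanism := fun _ => K;
     mechanism_dp := fun _ => Kdp; estimator_measurable := mest |}.
apply: (@le_trans _ _ (ereal_sup [set pointwise_risk prot x0 f | f in F])).
  by apply: ereal_inf_lbound; exists prot.
apply: ge_ereal_sup => _ [f Ff <-].
rewrite /pointwise_risk /=.
set Q := transcript_law prot f.
have best : bm (fun t => est t x0) by split; [exact: mest | exists H => t; exact: hH].
have brisk : bm (fun t => `|est t x0 - f x0| ^+ 2).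
  rewrite (_ : (fun t => _) = fun t => (est t x0 - f x0) ^+ 2).
    by apply: bmX; apply: bmB => //; exact: bm_cst.
  by apply/funext => t; rewrite real_normK ?num_real.
rewrite -Ex_EFin// lee_fin.
set theta := (m * n)%:R * Ex (obs_law f) phi.
have b2 : bm (fun t : m.-tuple (measurableTypeR R) =>
    (\sum_(j < m) clip L (tnth t j) - theta) ^+ 2).
  by apply: bmX; apply: bmB => //; exact: bm_cst.
apply: (@le_trans _ _ (Ex Q (fun t : m.-tuple (measurableTypeR R) =>
    a * (\sum_(j < m) clip L (tnth t j) - theta) ^+ 2 + e))).
  apply: le_Ex => //; first by apply: bmD; [exact: bmZ | exact: bm_cst].
  by move=> t; rewrite real_normK ?num_real//; exact: Fh.
rewrite ExD; [|exact: bmZ|exact: bm_cst].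
rewrite ExZ// Ex_cst lerD2r ler_wpM2l//.
exact: KV (Fv f Ff).
Qed.

(** * Trigonometric estimation *)

Section trigonometric_deconvolution.
Context {R : realType}.
Local Notation N01 := (@normal_prob R 0 1).
Local Notation U01 := (uniform_prob (@ltr01 R)).

Lemma bm_trig (w : R) : bm (fun y : measurableTypeR R => sin (w * y)) /\
  bm (fun y : measurableTypeR R => cos (w * y)).
Proof.
have mw : measurable_fun setT (fun y : measurableTypeR R => w * y).
  by apply: measurable_funM => //; exact: measurable_cst.
split; split.
- apply: (measurableT_comp _ mw); apply: continuous_measurable_fun; exact: continuous_sin.
- by exists 1 => y; rewrite ler_norml sin_geN1 sin_le1.
- apply: (measurableT_comp _ mw); apply: continuous_measurable_fun; exact: continuous_cos.
- by exists 1 => y; rewrite ler_norml cos_geN1 cos_le1.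
Qed.

Lemma tight (P : probability (measurableTypeR R) R) (e : R) : 0 < e ->
  exists k : nat, 1 - e < Ex P (\1_(fun y : measurableTypeR R => `|y| <= k%:R) : measurableTypeR R -> R).
Proof.
move=> e0.
pose A (k : nat) : set (measurableTypeR R) := fun y => `|y| <= k%:R.
have mA k : measurable (A k).
  rewrite (_ : A k = (fun y : measurableTypeR R => `|y|) @^-1` `]-oo, k%:R]%classic); last first.
    by apply/seteqP; split => y /=; rewrite /A/= in_itv.
  by rewrite -[X in measurable X]setTI; apply: normr_measurable => //; exact: measurable_itv.
have cA : P (A k) @[k --> \oo] --> 1%E.
  have -> : 1%E = P (\bigcup_k A k).
    rewrite -(@probability_setT _ _ _ P); congr (P _); apply/esym/seteqP; split => // y _.
    exists (Num.bound `|y|) => //; rewrite /A/= ltW//.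
    exact: archi_boundP.
  apply: nondecreasing_cvg_mu => //; first exact: bigcup_measurable.
  move=> i j ij; apply/subsetPset => y /= h; rewrite /A (le_trans h)//.
  by rewrite ler_nat.
have cA' : fine (P (A k)) @[k --> \oo] --> (1 : R) by apply: fine_cvg; exact: cA.
move: cA' => /cvgrPdist_lt/(_ _ e0)[k _ /(_ k (leqnn k))/=].
rewrite ltr_norml => /andP[_ h]; exists k; rewrite Ex_indic; last exact: mA.
by rewrite ltrBlDr addrC -ltrBlDr.
Qed.

(** The mean is shown to be positive by tightness: with probability above [3/4] one has [|y| <= k],
    where the cosine is at least [1/2], and elsewhere it is at least [-1]. So [3/2 * \1_A - 1] is a
    lower bound of positive mean. *)
Lemma ex_frequency (B : R) : exists w : R, [/\ 0 < w, w <= 1, w * B <= 2^-1 &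
  0 < Ex N01 (fun y : measurableTypeR R => cos (w * y))].
Proof.
have e0 : 0 < 4^-1 :> R by rewrite invr_gt0.
have [k] := tight N01 e0; set a := Ex _ _ => ak.
pose c : R := 2 * (1 + `|B| + k%:R); have c0 : 0 < c by rewrite mulr_gt0// !ltr_pwDl.
pose w := c^-1; have w0 : 0 < w by rewrite invr_gt0.
have wc t : t <= c / 2 -> w * t <= 2^-1.
  move=> tc; rewrite (le_trans (ler_wpM2l (ltW w0) tc))// mulrA mulVf ?mul1r//.
  by rewrite lt0r_neq0.
have c2 : c / 2 = 1 + `|B| + k%:R by rewrite /c mulrC mulKf.
have k0 : 0 <= k%:R :> R by [].
have B0 := normr_ge0 B; have BB := ler_norm B.
exists w; split => //.
- by rewrite invf_le1// /c; lra.
- by apply: wc; rewrite c2; lra.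
pose A : set (measurableTypeR R) := fun y => `|y| <= k%:R.
have mA : measurable A.
  rewrite (_ : A = (fun y : measurableTypeR R => `|y|) @^-1` `]-oo, k%:R]%classic).
    by rewrite -[X in measurable X]setTI; apply: normr_measurable => //; exact: measurable_itv.
  by apply/seteqP; split => y /=; rewrite /A/= in_itv.
have bA : bm (\1_A : measurableTypeR R -> R) by exact/test_bm/test_indic.
apply: (@lt_le_trans _ _ (3 / 2 * a - 1)); first by lra.
have <- : Ex N01 (fun y : measurableTypeR R => 3 / 2 * \1_A y - 1) = 3 / 2 * a - 1.
  by rewrite ExB ?ExZ ?Ex_cst//; [exact: bmZ|exact: bm_cst].
apply: le_Ex; [by apply: bmB; [exact: bmZ|exact: bm_cst]|exact: (bm_trig w).2|].
move=> y; rewrite indicE; case: (boolP (y \in A)) => [|_]; last first.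
  by rewrite mulr0 sub0r cos_geN1.
rewrite inE /A => yk; rewrite mulr1.
have : `|w * y| <= 2^-1.
  by rewrite normrM gtr0_norm//; apply: wc; rewrite c2; lra.
have := normr_cos_sub1_le (w * y); rewrite ler_norml => /andP[h _] h2; lra.
Qed.

End trigonometric_deconvolution.

(** * Unbiased estimation of the sine and its inversion *)

Section estimator.
Context {R : realType}.
Local Notation N01 := (@normal_prob R 0 1).
Local Notation U01 := (uniform_prob (@ltr01 R)).

Lemma Ex_uniform_int01 (g : measurableTypeR R -> R) : bm g -> c01 (g : R -> R) ->
  Ex U01 g = int01 g.
Proof.
move=> bg cg; have [_ [M gM]] := bg.
have bM : bm (fun x => g x + M) by apply: bmD => //; exact: bm_cst.
have M0 x : 0 <= g x + M.
  by have := gM x; rewrite ler_norml => /andP[h _]; lra.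
apply: (@addIr _ M); rewrite -[in LHS](Ex_cst U01 M) -ExD//; last exact: bm_cst.
rewrite Ex_uniform_ge0// -[in RHS](int01_cst M) -int01D//; exact: c01_cst.
Qed.

Definition freq_cos (w : R) : R := Ex N01 (fun y : measurableTypeR R => cos (w * y)).
Definition freq_sin (w : R) : R := Ex N01 (fun y : measurableTypeR R => sin (w * y)).

(* [E (deconv w (a + xi)) = |E exp(i w xi)|^2 sin(w a)] for a standard normal [xi] *)
Definition deconv (w y : R) : R := freq_cos w * sin (w * y) - freq_sin w * cos (w * y).

Definition freq_energy (w : R) : R := freq_cos w ^+ 2 + freq_sin w ^+ 2.

Lemma deconv_mean w a : Ex N01 (fun y : measurableTypeR R => deconv w (a + y)) =
  freq_energy w * sin (w * a).
Proof.
have [bs bc] := bm_trig w.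
rewrite (_ : (fun y => _) = fun y : measurableTypeR R =>
  (freq_cos w * sin (w * a) - freq_sin w * cos (w * a)) * cos (w * y) +
  (freq_cos w * cos (w * a) + freq_sin w * sin (w * a)) * sin (w * y)).
  by rewrite ExD ?ExZ//; [rewrite -/(freq_cos w) -/(freq_sin w) /freq_energy; ring|exact: bmZ|exact: bmZ].
by apply/funext => y; rewrite /deconv mulrDr sinD cosD; ring.
Qed.

Lemma deconv_le w y : `|deconv w y| <= 2.
Proof.
have [bs bc] := bm_trig w.
have h1 : `|freq_cos w| <= 1.
  rewrite -[leRHS](Ex_cst N01); apply: norm_Ex_le => //; first exact: bm_cst.
  by move=> x; rewrite ler_norml cos_geN1 cos_le1.
have h2 : `|freq_sin w| <= 1.
  rewrite -[leRHS](Ex_cst N01); apply: norm_Ex_le => //; first exact: bm_cst.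
  by move=> x; rewrite ler_norml sin_geN1 sin_le1.
rewrite /deconv (le_trans (ler_normB _ _))// -[leRHS](natrD _ 1 1) !normrM.
apply: lerD; apply: mulr_ile1 => //; rewrite ler_norml.
  by rewrite sin_geN1 sin_le1.
by rewrite cos_geN1 cos_le1.
Qed.

Lemma measurable_deconv w :
  measurable_fun setT (deconv w : measurableTypeR R -> measurableTypeR R).
Proof.
have [bs bc] := bm_trig w.
by apply: measurable_funB; [exact: (bmZ (freq_cos w) bs).1|exact: (bmZ (freq_sin w) bc).1].
Qed.

Section localized.
Variables (kappa : measurableTypeR R -> R) (w : R).
Hypotheses (bk : bm kappa) (ck : c01 (kappa : R -> R)).
Variable f : {mfun measurableTypeR R >-> measurableTypeR R}.
Hypothesis cf : c01 (f : R -> R).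

Definition localized (u : obs R) : R := deconv w u.1 * kappa u.2.

Lemma measurable_localized : measurable_fun setT localized.
Proof.
apply: measurable_funM.
  exact: (measurableT_comp (measurable_deconv w) measurable_fst).
exact: (measurableT_comp bk.1 measurable_snd).
Qed.

Lemma bm_localized : bm localized.
Proof.
have [_ [M kM]] := bk; split; first exact: measurable_localized.
by exists (2 * M) => u; rewrite normrM ler_pM// deconv_le.
Qed.

Lemma localized_mean : Ex (obs_law f) localized =
  freq_energy w * int01 (fun x => kappa x * sin (w * f x)).
Proof.
have csf : c01 (fun x => sin (w * f x)).
  have cwf : c01 (fun x => w * f x) by exact: c01Z.
  by move=> x; exact: (cvg_comp _ _ (cwf x) (@continuous_sin R (w * f x))).
have bsf : bm (fun x : measurableTypeR R => sin (w * f x)).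
  exact: (bm_comp (measurable_funPT f) (bm_trig w).1).
rewrite Ex_obs_law; last exact: bm_localized.
rewrite -(@Ex_uniform_int01 (fun x => kappa x * sin (w * f x))); [|exact: bmM|exact: c01M].
rewrite -ExZ; last exact: bmM.
congr Ex; apply/funext => x; rewrite /localized /=.
transitivity (Ex N01 (fun y : measurableTypeR R => kappa x * deconv w (f x + y))).
  by congr Ex; apply/funext => y; rewrite mulrC.
rewrite ExZ; first by rewrite deconv_mean; ring.
split; last by exists 2 => y; exact: deconv_le.
by apply: (measurableT_comp (measurable_deconv w)); exact: measurable_addl.
Qed.

Lemma localized_sqr : Ex (obs_law f) (fun u => localized u ^+ 2) <=
  4 * int01 (fun x => kappa x ^+ 2).
Proof.
have bk2 : bm (fun x => kappa x ^+ 2) by exact: bmX.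
have ck2 : c01 (fun x => kappa x ^+ 2).
  by apply: (@eq_c01 _ (fun x => kappa x * kappa x)) => [x _|]; [rewrite expr2|exact: c01M].
have bks : bm (fun u : obs R => kappa u.2 ^+ 2) := bm_comp measurable_snd bk2.
apply: (@le_trans _ _ (Ex (obs_law f) (fun u => 4 * kappa u.2 ^+ 2))).
  apply: le_Ex; [exact/bmX/bm_localized|exact: bmZ|].
  move=> u; rewrite /localized exprMn ler_wpM2r ?sqr_ge0//.
  rewrite -real_normK ?num_real//.
  have h := deconv_le w u.1.
  by have := ler_pM (normr_ge0 _) (normr_ge0 _) h h; rewrite -expr2 -natrM.
rewrite ExZ// ler_wpM2l// Ex_obs_law// -Ex_uniform_int01//.
rewrite le_eqVlt; apply/orP; left; apply/eqP; congr Ex.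
by apply/funext => x /=; rewrite Ex_cst.
Qed.

End localized.

(** The clipping keeps the argument away from [-1] and [1], where [asin] is not Lipschitz; as
    [omega * f x0] is within [1/2] of 0, its sine is unaffected. *)
Definition arcsine (s : R) : R := asin (clip (sin 2^-1) s).

Let half_lt_pihalf : 2^-1 < pi / 2 :> R.
Proof. by have := @pihalf_ge1 R; lra. Qed.

Let sin_half : 0 < sin (2^-1 : R) < 1.
Proof.
apply/andP; split; first by apply: sin_gt0_pihalf; apply/andP; split; [rewrite invr_gt0 | exact: half_lt_pihalf].
have := @normr_sin_le R 2^-1; rewrite [`|2^-1|]ger0_norm ?invr_ge0//.
by have := ler_norm (sin (2^-1 : R)); lra.
Qed.

Lemma measurable_arcsine :
  measurable_fun setT (arcsine : measurableTypeR R -> measurableTypeR R).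
Proof.
have /andP[s0 s1] := sin_half.
apply: continuous_measurable_fun => x.
apply: (continuous_comp (f := clip (sin 2^-1)) (g := asin)); first exact: clip_continuous.
apply: continuous_asin; have := clip_le x (ltW s0); rewrite ler_norml => /andP[h1 h2].
by apply/andP; split; lra.
Qed.

Lemma arcsine_le s : `|arcsine s| <= 2^-1.
Proof.
have /andP[s0 s1] := sin_half.
have := clip_le s (ltW s0); rewrite ler_norml => /andP[h1 h2].
set v := clip _ s in h1 h2 *.
have v1 : -1 <= v <= 1 by apply/andP; split; lra.
have aI : asin v \in `[- (pi / 2), pi / 2] by rewrite in_itv/= asin_geNpi2//= asin_lepi2.
have sa : sin (asin v) = v by apply: asinK; rewrite in_itv.
have hI (t : R) : `|t| = 2^-1 -> t \in `[- (pi / 2), pi / 2].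
  by move=> t2; rewrite in_itv/= -ler_norml t2 ltW.
have H1 : 2^-1 \in `[- (pi / 2), (pi / 2 : R)] by apply: hI; rewrite ger0_norm.
have H2 : - 2^-1 \in `[- (pi / 2), (pi / 2 : R)] by apply: hI; rewrite normrN ger0_norm.
rewrite /arcsine -/v ler_norml; apply/andP; split; rewrite leNgt; apply/negP => h.
  have : sin (asin v) < sin (- 2^-1) by rewrite ltr_sin.
  by rewrite sa sinN; lra.
have : sin 2^-1 < sin (asin v) by rewrite ltr_sin.
by rewrite sa; lra.
Qed.

(** On [[-1/2, 1/2]] the cosine is at least [1/2], so the sine shrinks distances by a factor of at
    most 2 there. *)
Lemma arcsine_lipschitz s y : `|y| <= 2^-1 -> `|arcsine s - y| <= 2 * `|s - sin y|.
Proof.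
move=> y2; have /andP[s0 s1] := sin_half.
have hc (t : R) : `|t| <= 2^-1 -> 2^-1 <= cos t.
  move=> t2; have := normr_cos_sub1_le t; rewrite ler_norml => /andP[h _]; lra.
have key (a b : R) : `|a| <= 2^-1 -> `|b| <= 2^-1 -> b <= a -> `|a - b| <= 2 * `|sin a - sin b|.
  move=> a2 b2 ba.
  have c : {within `[b, a], continuous (@sin R)}.
    by apply: continuous_subspaceT => z; exact: continuous_sin.
  have [z zI ->] := @MVT_segment _ sin cos b a ba (fun z _ => is_derive_sin z) c.
  have z2 : `|z| <= 2^-1.
    move: zI a2 b2; rewrite in_itv/= !ler_norml => /andP[z1 z2] /andP[a1 a2] /andP[b1 b2].
    by apply/andP; split; lra.
  rewrite normrM mulrA ler_peMl// ger0_norm; last by have := hc z z2; lra.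
  by have := hc z z2; lra.
have key' (a b : R) : `|a| <= 2^-1 -> `|b| <= 2^-1 -> `|a - b| <= 2 * `|sin a - sin b|.
  move=> a2 b2; have [ba|ab] := leP b a; first exact: key.
  by rewrite distrC (distrC (sin a)); apply: key => //; exact: ltW.
apply: (le_trans (key' _ _ (arcsine_le s) y2)); rewrite ler_wpM2l//.
have pi1 := @pihalf_ge1 R; have hp := half_lt_pihalf.
have inI (t : R) : `|t| <= 2^-1 -> t \in `[- (pi / 2), pi / 2].
  by move=> t2; rewrite in_itv/= -ler_norml (le_trans t2)// ltW.
have sin_mono (a b : R) : `|a| <= 2^-1 -> `|b| <= 2^-1 -> a <= b -> sin a <= sin b.
  move=> a2 b2 ab; rewrite leNgt; apply/negP.
  by rewrite ltr_sin ?inI// ltNge ab.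
have half_norm : `|2^-1 : R| <= 2^-1 by rewrite ger0_norm.
have sy : `|sin y| <= sin 2^-1.
  have /andP[y0 y1] : - 2^-1 <= y <= 2^-1 by rewrite -ler_norml.
  by rewrite ler_norml -sinN !sin_mono// normrN.
rewrite /arcsine asinK; first by rewrite -{1}(clip_id sy) clip_lipschitz.
have := clip_le s (ltW s0); rewrite ler_norml in_itv/= => /andP[h1 h2].
by apply/andP; split; lra.
Qed.

End estimator.

(** The three terms are the squared bias, the sampling variance and the variance of the Laplace
    noise. The bound independent of [J] is for regimes in which the rate is not small. *)
Lemma minimax_upper {R : realType} (A l0 : nat) (w : nat -> nat -> R -> R) (D M C : R)
    (S : nat -> nat -> R -> R) (alpha rho x0 : R) (p q : \bar R) :
  mra A l0 w D M C S -> (1 <= p)%E -> (1 <= q)%E -> 0 < rho ->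
  0 < alpha - inv_exponent p -> alpha - inv_exponent p < A%:R -> 0 <= x0 <= 1 ->
  exists2 K : R, 0 < K & forall (m n J : nat) (eps delta : R),
    (0 < m)%N -> (0 < n)%N -> (l0 < J)%N -> 0 < eps -> 0 <= delta ->
    let r := 2 `^ (- (alpha - inv_exponent p)) in
    let risk := minimax_risk (fun _ : 'I_m => n) (fun _ => eps) (fun _ => delta) x0
      (besov_ball l0 w alpha p q rho) in
    (risk <= (K * ((r ^+ J) ^+ 2 + 2 ^+ J / (m * n)%:R +
      (2 ^+ J) ^+ 2 / (m%:R * n%:R ^+ 2 * eps ^+ 2)))%:E)%E /\ (risk <= K%:E)%E.
Proof.
move=> H p1 q1 rho0 nu0 nuA x01.
pose B := ball_bound D M C alpha rho p.
have [v [v0 v1 vB Cv0]] := ex_frequency B.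
pose c := freq_energy v.
have c0 : 0 < c by rewrite /c /freq_energy ltr_pwDl ?sqr_ge0// exprn_gt0.
pose Kk := kernel_bound D M; have Kk0 : 0 <= Kk := kernel_bound_ge0 H.
have D0 := mra_D H.
pose W := 2 * D; have W0 : 0 <= W by rewrite mulr_ge0.
pose Ca := (4 * D * Kk + 1) * approx_bound A D M C alpha rho W p.
pose K1 := 8 / v ^+ 2 * (257 * (4 * (Kk + 1)) ^+ 2 / c ^+ 2).
pose K2 := 8 / v ^+ 2 * (2 * (4 * (4 * D * Kk ^+ 2)) / c ^+ 2).
pose K3 := 8 / v ^+ 2 * Ca ^+ 2.
pose K4 := (2^-1 / v + `|B|) ^+ 2 + 1.
have v80 : 0 <= 8 / v ^+ 2 by apply: divr_ge0 => //; exact: sqr_ge0.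
have K10 : 0 <= K1.
  apply: (mulr_ge0 v80); apply: divr_ge0; last exact: sqr_ge0.
  by apply: mulr_ge0; [exact: ler0n | exact: sqr_ge0].
have K20 : 0 <= K2.
  apply: mulr_ge0 => //; apply: divr_ge0; last exact: sqr_ge0.
  by do 2 apply: mulr_ge0 => //; apply: mulr_ge0; [exact: mulr_ge0 | exact: sqr_ge0].
have K30 : 0 <= K3 by apply: mulr_ge0 => //; exact: sqr_ge0.
have K40 : 0 < K4 by rewrite /K4 ltr_wpDl ?sqr_ge0.
exists (K1 + K2 + K3 + K4); first by rewrite ltr_wpDl ?addr_ge0.
move=> m n J eps delta m0 n0 lJ eps0 delta0 r risk.
have m0R : 0 < m%:R :> R by rewrite ltr0n.
have n0R : 0 < n%:R :> R by rewrite ltr0n.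
have J0 : 0 < 2 ^+ J :> R by rewrite exprn_gt0.
pose kap : measurableTypeR R -> R := rkernel S x0 J.
have ck : c01 (kap : R -> R) by exact: (kernel_c01 H).
have bk : bm kap.
  split; last by exists (Kk * 2 ^+ J) => x; exact: (kernel_le H).
  by apply: continuous_measurable_fun; exact: (kernel_continuous H).
pose phi := localized kap v.
(* The factor 2 bounds [deconv]; adding 1 to [Kk] makes [tau] positive in all cases. *)
pose tau := 2 * ((Kk + 1) * 2 ^+ J).
have tau0 : 0 < tau by rewrite /tau !mulr_gt0// ltr_wpDl.
have phi_le u : `|phi u| <= tau.
  rewrite /phi /localized normrM ler_pM ?deconv_le//.
  by apply: (le_trans (kernel_le H x0 _ lJ)); rewrite ler_wpM2r ?(ltW J0)// lerDl.
have mphi : measurable_fun setT phi by exact: measurable_localized.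
pose V := 4 * (4 * D * Kk ^+ 2 * 2 ^+ J).
pose h (s : measurableTypeR R) : measurableTypeR R :=
  arcsine (s / ((m * n)%:R * c)) / v.
have mh : measurable_fun setT h.
  apply: measurable_funM; last exact: measurable_cst.
  apply: (measurableT_comp (@measurable_arcsine R)).
  by apply: measurable_funM => //; exact: measurable_cst.
have hH s : `|h s| <= 2^-1 / v.
  by rewrite normrM normfV (gtr0_norm v0) ler_pM2r ?invr_gt0// arcsine_le.
have fV f : besov_ball l0 w alpha p q rho f -> Ex (obs_law f) (fun u => phi u ^+ 2) <= V.
  move=> fB; apply: (le_trans (localized_sqr v bk ck f)).
  by rewrite ler_wpM2l//; exact: (kernel_sqr H).
have fBd f : besov_ball l0 w alpha p q rho f -> `|f x0| <= B.
  by move=> fB; exact: (ball_bounded H p1 q1 rho0 nu0 fB).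
split; last first.
  apply: (le_trans (minimax_risk_le (a := 0) (e := (2^-1 / v + `|B|) ^+ 2)
    mphi phi_le tau0 eps0 delta0 m0 n0 (lexx 0) mh hH fV _)).
    move=> f fB s; rewrite mul0r add0r -real_normK ?num_real//.
    rewrite lerXn2r ?nnegrE ?addr_ge0 ?divr_ge0 ?invr_ge0 ?(ltW v0)//.
    by rewrite (le_trans (ler_normB _ _))// lerD// (le_trans (fBd f fB))// ler_norm.
  by rewrite mul0r add0r lee_fin /K4; lra.
pose G := (m * n)%:R * c; have G0 : 0 < G by rewrite mulr_gt0// natrM mulr_gt0.
(* The error splits into the fluctuation [X] and the bias [Y] of the estimate of the sine; [arcsine]
   at most doubles their sum, and [(2 (X + Y))^2 <= 8 X^2 + 8 Y^2]. *)
have fh f : besov_ball l0 w alpha p q rho f -> forall s, (h s - f x0) ^+ 2 <=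
    8 / (v ^+ 2 * G ^+ 2) * (s - (m * n)%:R * Ex (obs_law f) phi) ^+ 2 + K3 * (r ^+ J) ^+ 2.
  move=> fB s; set theta := Ex _ phi.
  have cf : c01 (f : R -> R) := ball_c01 fB.
  pose I := int01 (fun x => kap x * sin (v * f x)).
  have thE : theta = c * I := localized_mean v bk ck cf.
  pose y := v * f x0.
  have y2 : `|y| <= 2^-1.
    rewrite normrM gtr0_norm// (le_trans _ vB)// ler_wpM2l ?(ltW v0)//; exact: fBd.
  have v1' : `|v| <= 1 by rewrite gtr0_norm.
  have bias : `|I - sin y| <= Ca * r ^+ J.
    have [Q [sQ QE]] := sin_approx H x0 p1 q1 rho0 nu0 nuA W0 fB J v1'.
    have e0 : 0 <= approx_bound A D M C alpha rho W p * r ^+ J.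
      apply: le_trans (QE x0 x01 _); first exact: normr_ge0.
      by rewrite subrr normr0 divr_ge0// ltW.
    have csf : c01 (fun x => sin (v * f x)).
      have cwf : c01 (fun x => v * f x) by exact: c01Z.
      by move=> x; exact: (cvg_comp _ _ (cwf x) (@continuous_sin R (v * f x))).
    have := kernel_bias H x01 lJ sQ csf e0 QE.
    by rewrite /Ca mulrA.
  have arc : `|arcsine (s / G) - y| <= 2 * `|s / G - sin y| by exact: arcsine_lipschitz.
  have hE : h s - f x0 = (arcsine (s / G) - y) / v.
    by rewrite /h -/G /y mulrBl mulrAC divff ?mul1r// lt0r_neq0.
  have sE : s / G - sin y = (s - (m * n)%:R * theta) / G + (I - sin y).
    rewrite thE mulrBl [_ * (c * I)]mulrA -/G mulrAC divff ?mul1r ?lt0r_neq0//.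
    by rewrite addrA subrK.
  set X := (s - _) / G in sE; set Y := I - sin y in sE bias.
  have arc2 : (arcsine (s / G) - y) ^+ 2 <= 8 * X ^+ 2 + 8 * Y ^+ 2.
    rewrite -real_normK ?num_real//; apply: (@le_trans _ _ ((2 * `|X + Y|) ^+ 2)).
      by rewrite lerXn2r ?nnegrE ?mulr_ge0// -sE.
    rewrite exprMn real_normK ?num_real//.
    rewrite -subr_ge0 (_ : _ - _ = 4 * (X - Y) ^+ 2); last by ring.
    by rewrite mulr_ge0 ?sqr_ge0.
  have Y2 : Y ^+ 2 <= Ca ^+ 2 * (r ^+ J) ^+ 2.
    rewrite -exprMn -real_normK ?num_real// lerXn2r ?nnegrE//.
    exact: le_trans (normr_ge0 Y) bias.
  have -> : 8 / (v ^+ 2 * G ^+ 2) * (s - (m * n)%:R * theta) ^+ 2 = 8 * X ^+ 2 / v ^+ 2.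
    by rewrite /X; field; rewrite !lt0r_neq0.
  rewrite hE exprMn exprVn /K3.
  have -> : 8 / v ^+ 2 * Ca ^+ 2 * (r ^+ J) ^+ 2 = 8 * (Ca ^+ 2 * (r ^+ J) ^+ 2) / v ^+ 2.
    by rewrite -!mulrA; congr (8 * _); rewrite mulrC -!mulrA.
  rewrite -mulrDl ler_wpM2r ?invr_ge0 ?sqr_ge0//.
  by rewrite (le_trans arc2)// lerD2l ler_wpM2l.
have a0 : 0 <= 8 / (v ^+ 2 * G ^+ 2).
  by apply: divr_ge0 => //; apply: mulr_ge0; exact: sqr_ge0.
apply: (le_trans (minimax_risk_le mphi phi_le tau0 eps0 delta0 m0 n0 a0 mh hH fV fh)).
rewrite lee_fin.
set ra := (r ^+ J) ^+ 2; have ra0 : 0 <= ra by exact: sqr_ge0.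
have -> : 8 / (v ^+ 2 * G ^+ 2) * (m%:R * (257 * (2 * tau / eps) ^+ 2 + 2 * (n%:R * V))) =
    K1 * ((2 ^+ J) ^+ 2 / (m%:R * n%:R ^+ 2 * eps ^+ 2)) + K2 * (2 ^+ J / (m * n)%:R).
  rewrite /K1 /K2 /G /V /tau natrM.
  move: J0 m0R n0R eps0 v0 c0; move: (2 ^+ J) (m%:R) (n%:R) => z m' n' z0 m'0 n'0 e0 v0' c0'.
  by field; rewrite !lt0r_neq0.
set d := _ / (_ * eps ^+ 2); set b := _ / (m * n)%:R.
have d0 : 0 <= d by rewrite divr_ge0 ?mulr_ge0 ?sqr_ge0// ltW.
have b0 : 0 <= b by rewrite divr_ge0// ltW.
have := mulr_ge0 K10 ra0; have := mulr_ge0 K10 b0.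
have := mulr_ge0 K20 ra0; have := mulr_ge0 K20 d0.
have := mulr_ge0 K30 b0; have := mulr_ge0 K30 d0.
have := mulr_ge0 (ltW K40) ra0; have := mulr_ge0 (ltW K40) b0; have := mulr_ge0 (ltW K40) d0.
rewrite !mulrDl !mulrDr; lra.
Qed.

(** * Rates of convergence *)

Section rates.
Context {R : realType}.
Implicit Types (nu T z : R) (j J : nat).

Lemma powR_dyadic nu j : (2 `^ (- nu)) ^+ j = (2 ^+ j) `^ (- nu) :> R.
Proof.
by rewrite -powR_mulrn ?powR_ge0// -powRrM -[in RHS](powR_mulrn j (ler0n R 2)) -powRrM mulrC.
Qed.

Lemma powRN_antitone nu (x y : R) : 0 <= nu -> 0 < x -> x <= y -> y `^ (- nu) <= x `^ (- nu) :> R.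
Proof.
move=> nu0 x0 xy; have y0 := lt_le_trans x0 xy.
rewrite !powRN lef_pV2 ?posrE ?powR_gt0//.
by rewrite ge0_ler_powR ?nnegrE// ltW.
Qed.

Lemma dyadic_gt T : exists j, T < 2 ^+ j.
Proof.
exists (Num.bound `|T|); apply: (le_lt_trans (ler_norm T)).
apply: (lt_trans (archi_boundP (normr_ge0 T))).
by rewrite -natrX ltr_nat ltn_expl.
Qed.

Lemma dyadic_floor l0 T : 2 ^+ l0 <= T -> exists J, [/\ (l0 <= J)%N, 2 ^+ J <= T & T < 2 ^+ J.+1].
Proof.
move=> lT; case: (ex_minnP (dyadic_gt T)) => -[|J] TJ Jmin.
  by have := le_lt_trans lT TJ; rewrite expr0 ltNge exprn_ege1// ler1n.
exists J; split => //.
  have := le_lt_trans lT TJ; rewrite ltr_eXn2l ?ltr1n//.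
by rewrite leNgt; apply/negP => /Jmin; rewrite ltnn.
Qed.

Lemma dyadic_ceil l0 T : exists j, [/\ (l0 < j)%N, T <= 2 ^+ j &
  2 ^+ j <= 2 ^+ l0.+1 :> R \/ 2 ^+ j <= 2 * T].
Proof.
have [lT|lT] := leP (2 ^+ l0.+1) T; last by exists l0.+1; split; [|exact: ltW|left].
have [J [lJ JT TJ]] := dyadic_floor lT.
exists J.+1; split; [exact: (leq_trans lJ)|exact: ltW|right].
by rewrite exprS ler_pM2l.
Qed.

(** The scale is at least [l0.+1], so that for small [T] the height is only bounded below by a
    constant, whence the minimum with 1. *)
Lemma dyadic_lower nu l0 : 0 < nu -> exists2 c : R, 0 < c & forall T, 0 < T ->
  exists j, [/\ (l0 < j)%N, T <= 2 ^+ j &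
    c * Num.min (T `^ (- (2 * nu))) 1 <= ((2 `^ (- nu)) ^+ j) ^+ 2].
Proof.
move=> nu0; have nu2 : 0 <= 2 * nu by rewrite mulr_ge0// ltW.
pose c1 : R := (2 ^+ l0.+1) `^ (- (2 * nu)); pose c2 : R := 2 `^ (- (2 * nu)).
have c10 : 0 < c1 by rewrite powR_gt0// exprn_gt0.
have c20 : 0 < c2 by rewrite powR_gt0.
exists (Num.min c1 c2); first by rewrite lt_min c10.
move=> T T0; have [j [lj Tj hj]] := dyadic_ceil l0 T.
exists j; split => //.
have J0 : 0 < 2 ^+ j :> R by rewrite exprn_gt0.
have -> : ((2 `^ (- nu)) ^+ j) ^+ 2 = (2 ^+ j) `^ (- (2 * nu)).
  by rewrite powR_dyadic -[_ ^+ 2]powR_mulrn ?powR_ge0// -powRrM (mulrC (- nu)) mulrN.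
have m0 : 0 <= Num.min (T `^ (- (2 * nu))) 1 by rewrite le_min powR_ge0 ler01.
have c12 : 0 <= Num.min c1 c2 by rewrite le_min !ltW.
case: hj => hj.
  apply: (@le_trans _ _ (c1 * 1)); last by rewrite mulr1 powRN_antitone.
  by apply: ler_pM => //; rewrite ge_min lexx ?orbT.
apply: (@le_trans _ _ (c2 * T `^ (- (2 * nu)))).
  by apply: ler_pM => //; rewrite ge_min lexx ?orbT.
rewrite -powRM ?(ltW T0)//; apply: powRN_antitone => //.
Qed.

(** [Ta] and [Tb] are the optimal resolutions [2 ^+ J] with the privacy cost alone and with the
    sampling cost alone. *)
Definition two_rates nu Ta Tb : R := Ta `^ (- (2 * nu)) + Tb `^ (- (2 * nu)).

(** The coarser resolution [T = min(Ta, Tb)] is the right one: its squared bias is of the order of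
    the larger rate, and each variance at [2 ^+ J <= T] is at most its own rate. If [T < 2 ^+ l0.+1]
    no scale is available, but then the rate is bounded below. *)
Lemma dyadic_upper nu l0 : 0 < nu -> exists2 C : R, 0 < C & forall Ta Tb, 0 < Ta -> 0 < Tb ->
  1 <= C * two_rates nu Ta Tb \/
  exists J, (l0 < J)%N /\
    ((2 `^ (- nu)) ^+ J) ^+ 2 + 2 ^+ J / Tb `^ (2 * nu + 1) +
      (2 ^+ J) ^+ 2 / Ta `^ (2 * nu + 2) <= C * two_rates nu Ta Tb.
Proof.
move=> nu0; have nu2 : 0 <= 2 * nu by rewrite mulr_ge0// ltW.
pose c1 : R := (2 ^+ l0.+1) `^ (- (2 * nu)); pose c2 : R := 2 `^ (2 * nu).
have c10 : 0 < c1 by rewrite powR_gt0// exprn_gt0.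
have c20 : 0 < c2 by rewrite powR_gt0.
exists (c1^-1 + c2 + 1); first by rewrite ltr_wpDl// addr_ge0 ?invr_ge0// ltW.
move=> Ta Tb Ta0 Tb0.
set ra := Ta `^ (- (2 * nu)); set rb := Tb `^ (- (2 * nu)).
have ra0 : 0 < ra by rewrite powR_gt0.
have rb0 : 0 < rb by rewrite powR_gt0.
pose T := Num.min Ta Tb; have T0 : 0 < T by rewrite lt_min Ta0.
have rT : T `^ (- (2 * nu)) <= two_rates nu Ta Tb.
  rewrite /two_rates -/ra -/rb /T minEle; case: ifP => _.
    by rewrite lerDl ltW.
  by rewrite lerDr ltW.
have s0 : 0 <= two_rates nu Ta Tb by rewrite addr_ge0// ltW.
have [lT|lT] := leP (2 ^+ l0.+1) T; last first.
  left; apply: (@le_trans _ _ (c1^-1 * two_rates nu Ta Tb)).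
    rewrite mulrC ler_pdivlMr// mul1r; apply: le_trans rT.
    exact: powRN_antitone (ltW lT).
  by rewrite ler_wpM2r// -addrA lerDl addr_ge0// ltW.
right; have [J [lJ JT TJ]] := dyadic_floor lT; exists J; split => //.
have J0 : 0 < 2 ^+ J :> R by rewrite exprn_gt0.
have [JTa JTb] : 2 ^+ J <= Ta /\ 2 ^+ J <= Tb.
  by move: JT; rewrite le_min => /andP[].
have e1 : ((2 `^ (- nu)) ^+ J) ^+ 2 <= c2 * two_rates nu Ta Tb.
  have -> : ((2 `^ (- nu)) ^+ J) ^+ 2 = (2 ^+ J) `^ (- (2 * nu)).
    by rewrite powR_dyadic -[_ ^+ 2]powR_mulrn ?powR_ge0// -powRrM (mulrC (- nu)) mulrN.
  apply: (@le_trans _ _ (c2 * T `^ (- (2 * nu)))); last by rewrite ler_wpM2l// ltW.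
  apply: (@le_trans _ _ ((2^-1 * T) `^ (- (2 * nu)))).
    apply: powRN_antitone => //; first by rewrite mulr_gt0// invr_gt0.
    by rewrite mulrC ler_pdivrMr// mulrC -exprS ltW.
  rewrite powRM ?invr_ge0 ?(ltW T0)// ler_wpM2r ?powR_ge0//.
  by rewrite -powR_inv1// -powRrM mulN1r opprK.
have e2 : 2 ^+ J / Tb `^ (2 * nu + 1) <= rb.
  rewrite /rb powRN powRD; last by rewrite (gt_eqF Tb0) implybT.
  rewrite powRr1 ?(ltW Tb0)// invfM mulrCA ler_piMr ?invr_ge0 ?powR_ge0//.
  by rewrite ler_pdivrMr// mul1r.
have e3 : (2 ^+ J) ^+ 2 / Ta `^ (2 * nu + 2) <= ra.
  rewrite /ra powRN powRD; last by rewrite (gt_eqF Ta0) implybT.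
  rewrite powR_mulrn ?(ltW Ta0)// invfM mulrCA ler_piMr ?invr_ge0 ?powR_ge0//.
  rewrite ler_pdivrMr ?exprn_gt0// mul1r lerXn2r ?nnegrE// ltW//.
have c1V : 0 <= c1^-1 * two_rates nu Ta Tb by rewrite mulr_ge0// invr_ge0 ltW.
have sE : ra + rb = two_rates nu Ta Tb by [].
apply: (le_trans (lerD (lerD e1 e2) e3)).
by rewrite -addrA (addrC rb) sE !mulrDl mul1r -addrA lerDr.
Qed.

End rates.

Section dyadic_balance.
Context {R : realType}.
Variables (nu T : R) (j : nat).
Hypotheses (nu0 : 0 < nu) (T0 : 0 < T) (Tj : T <= 2 ^+ j).

Let J0 : 0 < 2 ^+ j :> R. Proof. exact: exprn_gt0. Qed.

(** With [k = 1] this controls the divergence of the observations, with [k = 2] that of the private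
    transcripts. *)
Let balance (k : R) : 0 < k ->
  T `^ (2 * nu + k) * (((2 `^ (- nu)) ^+ j) ^+ 2 / (2 ^+ j) `^ k) <= 1.
Proof.
move=> k0; have k1 : 0 <= 2 * nu + k by rewrite addr_ge0 ?mulr_ge0// ltW.
rewrite powR_dyadic -[_ ^+ 2]powR_mulrn ?powR_ge0// -powRrM (mulrC (- nu)) mulrN.
rewrite -powRN -powRD; last by rewrite (gt_eqF J0) implybT.
rewrite -opprD powRN ler_pdivrMr ?powR_gt0// mul1r.
by rewrite ge0_ler_powR ?nnegrE// ltW.
Qed.

Lemma dyadic_balance1 : T `^ (2 * nu + 1) * (((2 `^ (- nu)) ^+ j) ^+ 2 / 2 ^+ j) <= 1.
Proof. by have := balance ltr01; rewrite powRr1// ltW. Qed.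

Lemma dyadic_balance2 : T `^ (2 * nu + 2) * (((2 `^ (- nu)) ^+ j) / 2 ^+ j) ^+ 2 <= 1.
Proof.
have := balance (ltr0Sn _ 1); rewrite powR_mulrn ?(ltW J0)//.
by rewrite -[X in X <= 1 -> _]mulr1 exprMn exprVn mulr1.
Qed.

End dyadic_balance.

Lemma minimax_lower {R : realType} (A l0 : nat) (w : nat -> nat -> R -> R) (D M C : R)
    (S : nat -> nat -> R -> R) (alpha rho x0 Ceps : R) (p q : \bar R) :
  mra A l0 w D M C S -> (2%:E <= p)%E -> (1 <= q)%E -> 0 < rho ->
  0 < alpha - inv_exponent p -> 0 <= x0 <= 1 ->
  exists2 c : R, 0 < c & forall (m n : nat) (eps delta : R),
    (0 < m)%N -> (0 < n)%N -> 0 < eps <= Ceps -> 0 <= delta ->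
    m%:R * n%:R * delta <= 512^-1 ->
    let nu := alpha - inv_exponent p in
    let risk := minimax_risk (fun _ : 'I_m => n) (fun _ => eps) (fun _ => delta) x0
      (besov_ball l0 w alpha p q rho) in
    forall Ta Tb, 0 < Ta -> 0 < Tb ->
    Ta `^ (2 * nu + 2) = m%:R * n%:R ^+ 2 * eps ^+ 2 -> Tb `^ (2 * nu + 1) = m%:R * n%:R ->
    ((c * Num.min (Ta `^ (- (2 * nu))) 1)%:E <= risk)%E /\
    ((c * Num.min (Tb `^ (- (2 * nu))) 1)%:E <= risk)%E.
Proof.
move=> H p2 q1 rho0 nu0 x01; set nu := alpha - _ in nu0 *.
have [c0 [a0 [W [c00 a00 W0 bump]]]] := besov_bump H p2 q1 rho0 nu0 x01.
have [cL cL0 low] := dyadic_lower l0 nu0.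
pose E := expR Ceps + 1; have E1 : 1 <= E by rewrite lerDr expR_ge0.
(* An amplitude of at most [B^-1] makes [4 * amp * W * E <= 1/4] and [amp <= 1/16], which absorbs
   the constants in the smallness conditions of both lower bounds. *)
pose B := 16 * (W + 1) * E.
have B16 : 16 <= B.
  rewrite /B -mulrA ler_peMr// -[leLHS]mulr1 ler_pM// lerDr//.
have B0 : 0 < B by lra.
pose amp := Num.min a0 B^-1.
have amp0 : 0 < amp by rewrite lt_min a00 invr_gt0.
have ampB : amp <= B^-1 by rewrite ge_min lexx orbT.
have amp16 : amp <= 16^-1.
  by rewrite (le_trans ampB)// lef_pV2 ?posrE.
have ampWE : 4 * amp * W * E <= 4^-1.
  have : 4 * amp * W * E <= 4 * (B^-1 * (W * E)).
    by rewrite -!mulrA ler_wpM2l// ler_wpM2r// mulr_ge0// (le_trans ler01).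
  move/le_trans; apply; rewrite (_ : 4 * _ = 4^-1 * (16 * W * E / B)); last by field; rewrite lt0r_neq0.
  rewrite ler_piMr// ler_pdivrMr// mul1r /B -!mulrA ler_wpM2l// ler_wpM2r ?(le_trans ler01)//.
  by rewrite lerDl.
have ampW : amp * W <= 16^-1.
  have : amp * W <= amp * W * E by rewrite ler_peMr// mulr_ge0// ltW.
  by move: ampWE; rewrite -!mulrA; lra.
exists ((c0 * amp) ^+ 2 / 64 * cL).
  by rewrite mulr_gt0// divr_gt0// exprn_gt0// mulr_gt0.
move=> m n eps delta m0 n0 eps0 delta0 md /= Ta Tb Ta0 Tb0 TaE TbE.
have [f0 f00] : exists f0 : {mfun measurableTypeR R >-> measurableTypeR R}, forall x, f0 x = 0.
  by exists (cst 0).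
have f0B := besov_ball_zero l0 w alpha p2 q1 rho0 f00.
set r : R := 2 `^ (- nu).
have r0 : 0 < r by rewrite powR_gt0.
have r1 : r <= 1.
  rewrite /r powRN invf_le1 ?powR_gt0//.
  by have := @ler_powR R 2 (ler1n _ 2) 0 nu (ltW nu0); rewrite powRr0.
(* What the private and nonprivate cases share: at an admissible scale [j] the squared value of the
   bump at [x0] is of the order of the rate. *)
have main j (risk : \bar R) T : (l0 < j)%N ->
    cL * Num.min (T `^ (- (2 * nu))) 1 <= (r ^+ j) ^+ 2 ->
    (forall f : {mfun measurableTypeR R >-> measurableTypeR R},
      besov_ball l0 w alpha p q rho f -> (forall x, `|f x| <= amp * r ^+ j) ->
      (forall x, W / 2 ^+ j < `|x - x0| -> f x = 0) -> ((f x0 ^+ 2 / 64)%:E <= risk)%E) ->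
    (((c0 * amp) ^+ 2 / 64 * cL * Num.min (T `^ (- (2 * nu))) 1)%:E <= risk)%E.
  move=> lj lowj lowf; have ampa : amp <= a0 by rewrite ge_min lexx.
  have [f [fB fh fw fx]] := bump j amp lj amp0 ampa.
  apply: le_trans (lowf f fB fh fw); rewrite lee_fin -mulrA.
  apply: (@le_trans _ _ ((c0 * amp) ^+ 2 / 64 * (r ^+ j) ^+ 2)).
    by rewrite ler_wpM2l// divr_ge0// sqr_ge0.
  rewrite mulrAC ler_wpM2r ?invr_ge0// -exprMn -[leRHS]real_normK ?num_real//.
  by rewrite lerXn2r ?nnegrE ?mulr_ge0 ?exprn_ge0// ltW.
have rj1 j : 0 < r ^+ j <= 1 by rewrite exprn_gt0//= exprn_ile1// ltW.
have J0 j : 0 < 2 ^+ j :> R by rewrite exprn_gt0.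
have h0 j : 0 <= amp * r ^+ j.
  by have /andP[rj _] := rj1 j; rewrite mulr_ge0// ltW.
have h2 j : amp * r ^+ j <= 2^-1.
  have /andP[rj rj'] := rj1 j; apply: (@le_trans _ _ (16^-1 * 1)); last by rewrite mulr1; lra.
  by rewrite ler_pM// ltW.
have w0 j : 0 <= W / 2 ^+ j by rewrite divr_ge0// ltW.
split.
  have [j [lj Tj lowj]] := low Ta Ta0.
  apply: (main j _ Ta lj lowj) => f fB fh fw.
  have bal := dyadic_balance2 nu0 Ta0 Tj; rewrite -/r TaE in bal.
  set y := r ^+ j / 2 ^+ j in bal.
  have y0 : 0 <= y by have /andP[rj _] := rj1 j; rewrite divr_ge0// ltW.
  have KE : 4 * (amp * r ^+ j) * (W / 2 ^+ j) * (expR Ceps + 1) = 4 * amp * W * E * y.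
    by rewrite /y /E; ring.
  have sm : m%:R * (n%:R * (4 * (amp * r ^+ j) * (W / 2 ^+ j) * (expR Ceps + 1)) * eps) ^+ 2
      <= 16^-1.
    rewrite KE (_ : _ * _ = (4 * amp * W * E) ^+ 2 *
      (m%:R * n%:R ^+ 2 * eps ^+ 2 * y ^+ 2)); last by ring.
    apply: (@le_trans _ _ (4^-1 ^+ 2 * 1)).
      apply: ler_pM => //; first exact: sqr_ge0.
        by do 3 (apply: mulr_ge0; last exact: sqr_ge0).
      by rewrite lerXn2r ?nnegrE// !mulr_ge0 ?(ltW amp0)// (le_trans ler01).
    by rewrite mulr1 exprVn -natrX.
  apply: (lower_private fB f0B f00 (h0 j) (h2 j) (w0 j) fh fw eps0 delta0) => //.
  - set z := _ * eps in sm *; have zz : z ^+ 2 <= 2^-1 ^+ 2.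
      apply: (@le_trans _ _ 16^-1); last by rewrite exprVn -natrX lef_pV2 ?posrE// ler_nat.
      by apply: le_trans sm; rewrite ler_peMl ?sqr_ge0// ler1n.
    apply: (le_trans (ler_norm z)).
    by rewrite -(@ler_pXn2r _ 2)// ?nnegrE// real_normK ?num_real.
  - by apply: (le_trans sm); rewrite lef_pV2 ?posrE// ler_nat.
  - have /andP[rj rj'] := rj1 j.
    rewrite mulrACA -/y.
    have y1 : y <= 1.
      by rewrite ler_pdivrMr// mul1r (le_trans rj')// exprn_ege1// ler1n.
    apply: le_trans (ler_wpM2l (mulr_ge0 (ltW amp0) W0) y1) _.
    by rewrite mulr1 (le_trans ampW)// invf_le1// ler1n.
have [j [lj Tj lowj]] := low Tb Tb0.
apply: (main j _ Tb lj lowj) => f fB fh fw.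
apply: (lower_nonprivate fB f0B f00 (h0 j) (h2 j) (w0 j) fh fw).
have := dyadic_balance1 nu0 Tb0 Tj; rewrite -/r TbE.
set y := (r ^+ j) ^+ 2 / 2 ^+ j => bal.
rewrite (_ : _ * (4 * _ * _) = 4 * (amp * (amp * W)) * (m%:R * n%:R * y)); last first.
  by rewrite /y; ring.
have mny0 : 0 <= m%:R * n%:R * y.
  by have /andP[rj _] := rj1 j; rewrite mulr_ge0// divr_ge0 ?sqr_ge0// ltW.
have aaW : amp * (amp * W) <= 16^-1 * 16^-1 by rewrite ler_pM// ?mulr_ge0// ltW.
have aaW0 : 0 <= 4 * (amp * (amp * W)) by rewrite !mulr_ge0// ltW.
by apply: (le_trans (ler_wpM2l aaW0 bal)); rewrite mulr1; lra.
Qed.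

(** Each lower bound gives one of the two rates; the larger rate is at least half of their sum. *)
Lemma half_min_le {R : realType} (u v : R) : 0 <= u -> u <= v ->
  2^-1 * Num.min (u + v) 1 <= Num.min v 1.
Proof.
move=> u0 uv; rewrite le_min.
have h1 : Num.min (u + v) 1 <= u + v by rewrite ge_min lexx.
have h2 : Num.min (u + v) 1 <= 1 by rewrite ge_min lexx orbT.
by move: h1 h2; set t := Num.min _ _ => h1 h2; apply/andP; split; lra.
Qed.

Theorem corollary2 (R : realType) (alpha rho Ceps x0 : R) (p q : \bar R)
    (A l0 : nat) (w : nat -> nat -> R -> R) :
  (2%:E <= p)%E -> (1 <= q)%E ->
  2^-1 < alpha - inv_exponent p ->
  0 < rho -> 0 < Ceps ->
  cdv_basis A l0 w -> alpha < A%:R ->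
  0 <= x0 <= 1 ->
  let nu := alpha - inv_exponent p in
  exists M : nat -> nat -> R,
    (forall m n, 1 <= M m n) /\
    (exists2 K : R, 0 < K &
       forall m n, (1 < m * n)%N -> M m n <= K * ln (m * n)%:R) /\
    exists c C : R, 0 < c /\ 0 < C /\
      forall (m n : nat -> nat) (eps delta : nat -> R),
        (m i * n i)%N @[i --> \oo] --> \oo ->
        (forall i, 0 < eps i <= Ceps) ->
        (forall i, 0 <= delta i) ->
        delta i / ((m i * n i)%:R)^-1 @[i --> \oo] --> (0 : R) ->
        \forall i \near \oo,
          let rate :=
            Num.min (M (m i) (n i) * private_rate nu (m i) (n i) (eps i)) 1 in
          let risk :=
            minimax_risk (fun _ : 'I_(m i) => n i) (fun _ => eps i)
              (fun _ => delta i) x0 (besov_ball l0 w alpha p q rho) in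
          ((c * rate)%:E <= risk)%E /\ (risk <= (C * rate)%:E)%E.
Proof.
move=> p2 q1 nu2 rho0 Ceps0 cdv alphaA x01 nu.
have p1 : (1 <= p)%E by apply: le_trans p2; rewrite lee_fin ler1n.
have nu0 : 0 < nu by apply: lt_trans nu2; rewrite invr_gt0.
have ip0 : 0 <= inv_exponent p.
  by rewrite /inv_exponent fine_ge0// inve_ge0 (le_trans _ p1)// lee_fin.
have nuA : nu < A%:R by apply: le_lt_trans alphaA; rewrite lerBlDr lerDl.
have A0 : (0 < A)%N by rewrite -(ltr_nat R); exact: lt_trans nu0 nuA.
have [D [M [C [S H]]]] := cdv_basis_mra A0 cdv.
have [KU KU0 upper] := minimax_upper H p1 q1 rho0 nu0 nuA x01.
have [KL KL0 lower] := minimax_lower Ceps H p2 q1 rho0 nu0 x01.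
have [KR KR0 rates] := dyadic_upper l0 nu0.
exists (fun _ _ => 1); split => //; split.
  (* As [m n >= 2], the logarithm is at least [ln 2]. *)
  have ln2 : 0 < ln (2 : R) by rewrite ln_gt0// ltr1n.
  exists (ln 2)^-1; first by rewrite invr_gt0.
  move=> m n mn; rewrite mulrC ler_pdivlMr// mul1r ler_ln ?posrE ?ltr0n// ?ler_nat//.
  exact: ltnW.
exists (KL / 2), (KU * (KR + 1)); split; first by rewrite divr_gt0.
split; first by rewrite mulr_gt0// ltr_wpDl// ltW.
move=> m n eps delta mn epsC delta0 dmn.
have mn0 : \forall i \near \oo, (0 < m i * n i)%N by move/cvgnyPgt : mn => /(_ 0%N).
(* Of [delta] only this is used: eventually [m n delta] is below the threshold of the private lower
   bound. *)
have d512 : 0 < 512^-1 :> R by rewrite invr_gt0 ltr0n.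
move/cvgrPdist_lt : dmn => /(_ _ d512).
apply: filterS2 mn0 => i mni; rewrite sub0r normrN => di.
have /andP[mi ni] : (0 < m i)%N && (0 < n i)%N by rewrite -muln_gt0.
have m0R : 0 < (m i)%:R :> R by rewrite ltr0n.
have n0R : 0 < (n i)%:R :> R by rewrite ltr0n.
have /andP[e0 eC] := epsC i.
have dsmall : (m i)%:R * (n i)%:R * delta i <= 512^-1.
  apply: ltW; apply: le_lt_trans di; rewrite invrK natrM mulrC.
  exact: ler_norm.
have low := lower _ _ _ _ mi ni (epsC i) (delta0 i) dsmall.
clear lower d512 di dsmall.
pose a : R := (m i)%:R * (n i)%:R ^+ 2 * eps i ^+ 2.
have a0 : 0 < a by rewrite !mulr_gt0// exprn_gt0.
pose b : R := (m i * n i)%:R; have b0 : 0 < b by rewrite ltr0n.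
have k1 : 0 < 2 * nu + 1 by rewrite addr_gt0// mulr_gt0.
have k2 : 0 < 2 * nu + 2 by rewrite addr_gt0// mulr_gt0.
(* The resolutions at which squared bias and variance balance, without rounding to powers of 2. *)
pose Ta := a `^ (2 * nu + 2)^-1; pose Tb := b `^ (2 * nu + 1)^-1.
have Ta0 : 0 < Ta by rewrite powR_gt0.
have Tb0 : 0 < Tb by rewrite powR_gt0.
have TaE : Ta `^ (2 * nu + 2) = a.
  by rewrite /Ta -powRrM mulVf ?lt0r_neq0// powRr1// ltW.
have TbE : Tb `^ (2 * nu + 1) = b.
  by rewrite /Tb -powRrM mulVf ?lt0r_neq0// powRr1// ltW.
have rateE : private_rate nu (m i) (n i) (eps i) = two_rates nu Ta Tb.
  rewrite /private_rate /two_rates /Ta /Tb -!powRrM -/a -/b.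
  by congr (_ `^ _ + _ `^ _); rewrite mulrN mulrC.
rewrite mul1r rateE /=; split.
  have TbE' : Tb `^ (2 * nu + 1) = (m i)%:R * (n i)%:R by rewrite TbE /b natrM.
  have [la lb] := low Ta Tb Ta0 Tb0 TaE TbE'.
  rewrite /two_rates; set x := Ta `^ _ in la *; set y := Tb `^ _ in lb *.
  have x0' : 0 <= x := powR_ge0 _ _.
  have y0' : 0 <= y := powR_ge0 _ _.
  clearbody x y.
  have half_min (u v : R) : 0 <= u -> u <= v -> KL / 2 * Num.min (u + v) 1 <= KL * Num.min v 1.
    by move=> u0 uv; rewrite -mulrA ler_wpM2l ?(ltW KL0)// half_min_le.
  have [xy|yx] := leP x y.
    apply: (le_trans _ lb).
    rewrite lee_fin.
    exact: (half_min x y x0' xy).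
  apply: (le_trans _ la).
  rewrite lee_fin addrC.
  exact: (half_min y x y0' (ltW yx)).
(* The constant bound is the same for every admissible scale; [l0.+1] is the first one. *)
have risk1 := (upper _ _ l0.+1 _ _ mi ni (ltnSn l0) e0 (delta0 i)).2.
have s0 : 0 <= two_rates nu Ta Tb by rewrite addr_ge0 ?powR_ge0.
have [s1|s1] := leP (two_rates nu Ta Tb) 1; last first.
  by apply: (le_trans risk1); rewrite lee_fin mulr1 ler_peMr ?(ltW KU0)// lerDr ltW.
have KRs : KR * two_rates nu Ta Tb <= (KR + 1) * two_rates nu Ta Tb.
  by rewrite ler_wpM2r// lerDl.
rewrite -mulrA; case: (rates Ta Tb Ta0 Tb0) => [big|[J [lJ small]]].
  apply: (le_trans risk1); rewrite lee_fin ler_peMr ?(ltW KU0)//.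
  exact: le_trans big KRs.
apply: (le_trans (upper _ _ J _ _ mi ni lJ e0 (delta0 i)).1).
rewrite lee_fin ler_wpM2l ?(ltW KU0)//; apply: le_trans KRs.
by move: small; rewrite TaE TbE.
Qed.
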